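(* Let $k$ be an algebraically closed field, let $Q$ be a finite connected quiver without oriented cycle and without multiple arrows, let $I_0$ be a monomial admissible ideal of $kQ$, and let $A=kQ/I_0$, viewed as a $k$-category with object set $Q_0$. Let $\widehat F\colon\widehat{\mathcal C}\to A$ be the Galois covering with group $\pi_1(Q)$ defined by the presentation $A=kQ/I_0$. Then $\widehat F$ is a universal cover of $A$ in the following sense. For every group $G$ and every Galois covering $F\colon\mathcal C\to A$ with group $G$ such that $\mathcal C$ is connected and locally bounded, there exist an isomorphism of $k$-algebras $\psi\colon A\xrightarrow{\sim}A$ extending the identity map on the set $Q_0$ of vertices (i.e. a $k$-linear automorphism of the $k$-category $A$ that is the identity on objects), a normal subgroup $N\vartriangleleft\pi_1(Q)$, and a Galois covering $F'\colon\widehat{\mathcal C}\to\mathcal C$ with group $N$, such that $F\circ F'=\psi\circ\widehat F$ and such that there exists an exact sequence of groups $1\to N\to\pi_1(Q)\to G\to 1$.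
   Context: Quivers: $Q=(Q_0,Q_1,s,t)$; paths are written from right to left: $\alpha_n\cdots\alpha_1$ with $s(\alpha_{i+1})=t(\alpha_i)$; $e_x$ is the stationary path at $x$. An oriented cycle is a path of positive length with equal source and target; $Q$ has multiple arrows if it has two distinct arrows with the same source and the same target. $Q$ is connected if its underlying graph is. $k$-categories: a $k$-category has a set of objects, $k$-vector spaces ${}_y\mathcal C_x$ of morphisms from $x$ to $y$, and $k$-bilinear composition; all functors are $k$-linear. It is connected if it is not the disjoint union of two full subcategories (both nonempty). It is locally bounded if: (1) for every object $x$ the spaces $\bigoplus_y{}_y\mathcal C_x$ and $\bigoplus_y{}_x\mathcal C_y$ are finite dimensional; (2) each ${}_x\mathcal C_x$ is a local algebra; (3) distinct objects are not isomorphic. The path category $kQ$ has object set $Q_0$, and ${}_ykQ_x$ has as basis the paths from $x$ to $y$. An ideal $I$ of $kQ$ is admissible if every morphism in $I$ is a linear combination of paths of length at least $2$ and $kQ/I$ is locally bounded. It is monomial if it is generated by a set of paths. Galois covering: a Galois covering with group $G$ of $\mathcal C$ by $\mathcal C'$ is a functor $F\colon\mathcal C'\to\mathcal C$ endowed with a group morphism $G\to\mathrm{Aut}(\mathcal C')$ such that (1) the induced action of $G$ on the objects of $\mathcal C'$ is free; (2) $F\circ g=F$ for all $g\in G$; (3) for every $k$-linear functor $F'\colon\mathcal C'\to\mathcal C''$ with $F'\circ g=F'$ for all $g\in G$ there is a unique functor $\overline{F'}\colon\mathcal C\to\mathcal C''$ with $\overline{F'}\circ F=F'$. Fundamental group and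 the covering $\widehat F$: a walk in $Q$ is a path in the quiver obtained from $Q$ by adding a formal inverse $\alpha^{-1}\colon y\to x$ for each arrow $\alpha\colon x\to y$. Let $\sim$ be the smallest equivalence relation on walks, compatible with concatenation, with $\alpha\alpha^{-1}\sim e_y$ and $\alpha^{-1}\alpha\sim e_x$ for every arrow $\alpha\colon x\to y$. Fix $x_0\in Q_0$. $\pi_1(Q)=\pi_1(Q,x_0)$ is the group of $\sim$-classes of walks from $x_0$ to $x_0$ (it is the fundamental group of the underlying graph of $Q$; as $I_0$ is monomial it is also the fundamental group $\pi_1(Q,I_0)$ of the bound quiver). Let $\widetilde Q$ be the quiver whose vertices are the classes $[\gamma]$ of walks $\gamma$ with source $x_0$ and whose arrows are the pairs $([\gamma],\alpha)\colon[\gamma]\to[\alpha\gamma]$ with $\alpha\in Q_1$, $s(\alpha)=t(\gamma)$. Let $p\colon\widetilde Q\to Q$ be the quiver map $[\gamma]\mapsto t(\gamma)$, $([\gamma],\alpha)\mapsto\alpha$. The group $\pi_1(Q,x_0)$ acts on $\widetilde Q$ by $g\cdot[\gamma]=[\gamma g^{-1}]$. Let $\widetilde I$ be the ideal of $k\widetilde Q$ generated by the paths whose image under $p$ lies in $I_0$. Then $\widehat{\mathcal C}=k\widetilde Q/\widetilde I$, and $\widehat F\colon\widehat{\mathcal C}\to kQ/I_0=A$ is the functor induced by $p$, with the induced action of $\pi_1(Q)$. *)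

(* Defs.v *)
From HB Require Import structures.
From mathcomp Require Import all_boot all_algebra.
From mathcomp Require Import generic_quotient ring_quotient.
From mathcomp Require Import finmap monalg.
From mathcomp Require Import boolp classical_sets cardinality.

Set Implicit Arguments.
Unset Strict Implicit.
Unset Printing Implicit Defensive.

Import GRing.Theory.
Local Open Scope ring_scope.

(* [khom x y] is the space of morphisms from x to y, and [kcomp g f] is
   "g after f". *)
Record kcat (k : fieldType) := KCat {
  kobj :> Type;
  khom : kobj -> kobj -> lmodType k;
  kid : forall x, khom x x;
  kcomp : forall x y z, khom y z -> khom x y -> khom x z;
  kcompA : forall w x y z (h : khom y z) (g : khom x y) (f : khom w x),
    kcomp h (kcomp g f) = kcomp (kcomp h g) f;
  kcomp1l : forall x y (f : khom x y), kcomp (kid y) f = f;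
  kcomp1r : forall x y (f : khom x y), kcomp f (kid x) = f;
  kcomp_linearl : forall x y z (f : khom x y),
    linear (fun g : khom y z => kcomp g f);
  kcomp_linearr : forall x y z (g : khom y z),
    linear (fun f : khom x y => kcomp g f) }.

Arguments kid {k} _ _.

Record kfun (k : fieldType) (C D : kcat k) := KFun {
  fobj :> C -> D;
  fmor : forall x y, khom x y -> khom (fobj x) (fobj y);
  fmor_linear : forall x y, linear (@fmor x y);
  fmor_id : forall x, fmor (kid C x) = kid D (fobj x);
  fmor_comp : forall x y z (g : khom y z) (f : khom x y),
    fmor (kcomp g f) = kcomp (fmor g) (fmor f) }.

Section KFun.
Variable k : fieldType.
Implicit Types B C D E : kcat k.

Lemma kfun_eq C D (o : C -> D)
    (m m' : forall x y, khom x y -> khom (o x) (o y)) p1 p2 p3 p1' p2' p3' :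
  (forall x y f, m x y f = m' x y f) ->
  @KFun k C D o m p1 p2 p3 = @KFun k C D o m' p1' p2' p3'.
Proof.
move=> mE; have E : m = m'.
  by apply: functional_extensionality_dep => x;
     apply: functional_extensionality_dep => y; apply/funext => f; exact: mE.
by case: _ / E p1' p2' p3' => *; congr KFun; exact: Prop_irrelevance.
Qed.

Definition kfun_id C : kfun C C.
Proof. by refine (@KFun k C C id (fun x y f => f) _ _ _). Defined.

Definition kfun_comp C D E (G : kfun D E) (F : kfun C D) : kfun C E.
Proof.
refine (@KFun k C E (G \o F) (fun x y f => fmor G (fmor F f)) _ _ _).
- by move=> x y a f g; rewrite !fmor_linear.
- by move=> x; rewrite !fmor_id.
- by move=> x y z g f; rewrite !fmor_comp.
Defined.

Lemma kfun_compA B C D E (H : kfun D E) (G : kfun C D) (F : kfun B C) :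
  kfun_comp H (kfun_comp G F) = kfun_comp (kfun_comp H G) F.
Proof. exact: kfun_eq. Qed.

Lemma kfun_comp1l C D (F : kfun C D) : kfun_comp (kfun_id D) F = F.
Proof. by case: F => *; exact: kfun_eq. Qed.

Lemma kfun_comp1r C D (F : kfun C D) : kfun_comp F (kfun_id C) = F.
Proof. by case: F => *; exact: kfun_eq. Qed.

End KFun.

Section KAut.
Variables (k : fieldType) (C : kcat k).

Record kaut := KAut {
  aut_fun :> kfun C C;
  aut_inv : kfun C C;
  aut_funK : kfun_comp aut_inv aut_fun = kfun_id C;
  aut_invK : kfun_comp aut_fun aut_inv = kfun_id C }.

Lemma kaut_eq (F G : kaut) : aut_fun F = aut_fun G -> F = G.
Proof.
case: F G => F F' FK F'K [G G' GK G'K] /= FG.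
have FG' : F' = G'.
  by rewrite -[F']kfun_comp1r -G'K kfun_compA -FG FK kfun_comp1l.
subst G G'; congr KAut; exact: Prop_irrelevance.
Qed.

Definition kaut_one := KAut (kfun_comp1l (kfun_id C)) (kfun_comp1l (kfun_id C)).

Definition kaut_inv (F : kaut) := KAut (aut_invK F) (aut_funK F).

Definition kaut_mul (F G : kaut) : kaut.
Proof.
refine (@KAut (kfun_comp F G) (kfun_comp (aut_inv G) (aut_inv F)) _ _).
- by rewrite -kfun_compA (kfun_compA (aut_inv F)) aut_funK kfun_comp1l aut_funK.
- by rewrite -kfun_compA (kfun_compA G) aut_invK kfun_comp1l aut_invK.
Defined.

HB.instance Definition _ := gen_eqMixin kaut.
HB.instance Definition _ := gen_choiceMixin kaut.

Lemma kaut_mulA : associative kaut_mul.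
Proof. by move=> F G H; apply: kaut_eq; exact: kfun_compA. Qed.
Lemma kaut_mul1g : left_id kaut_one kaut_mul.
Proof. by move=> F; apply: kaut_eq; exact: kfun_comp1l. Qed.
Lemma kaut_mulg1 : right_id kaut_one kaut_mul.
Proof. by move=> F; apply: kaut_eq; exact: kfun_comp1r. Qed.
Lemma kaut_mulVg : left_inverse kaut_one kaut_inv kaut_mul.
Proof. by move=> F; apply: kaut_eq; exact: aut_funK. Qed.
Lemma kaut_mulgV : right_inverse kaut_one kaut_inv kaut_mul.
Proof. by move=> F; apply: kaut_eq; exact: aut_invK. Qed.

HB.instance Definition _ := isGroup.Build kaut
  kaut_mulA kaut_mul1g kaut_mulg1 kaut_mulVg kaut_mulgV.

End KAut.

Section LocallyBounded.
Variables (k : fieldType) (C : kcat k).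

Definition kinverse (x y : C) (f : khom x y) (g : khom y x) :=
  kcomp g f = kid C x /\ kcomp f g = kid C y.

Definition kisomorphic (x y : C) :=
  exists (f : khom x y) (g : khom y x), kinverse f g.

Definition kconnected :=
  forall P : C -> Prop,
    (forall x y, P x -> ~ P y ->
       (forall f : khom x y, f = 0) /\ (forall f : khom y x, f = 0)) ->
    (forall x, P x) \/ (forall x, ~ P x).

(* Elements of the external direct sum of the V i are the finitely supported
   families; it is finite dimensional when finitely many of them span it. *)
Definition finite_support (J : Type) (V : J -> lmodType k)
    (f : forall i, V i) := finite_set [set i | f i <> 0]%classic.

Definition dsum_findim (J : Type) (V : J -> lmodType k) :=
  exists (n : nat) (b : 'I_n -> forall i, V i),
    (forall j, finite_support (b j)) /\
    forall f : forall i, V i, finite_support f ->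
      exists c : 'I_n -> k, forall i, f i = \sum_(j < n) c j *: b j i.

(* The ring of endomorphisms is local: it is nonzero and a sum of two non-invertible elements
   is non-invertible. *)
Definition local_end (x : C) :=
  let unit_ (f : khom x x) := exists g, kinverse f g in
  kid C x <> 0 /\ forall f g : khom x x, ~ unit_ f -> ~ unit_ g -> ~ unit_ (f + g).

Definition locally_bounded :=
  [/\ forall x : C, dsum_findim (fun y => khom x y) /\
                    dsum_findim (fun y => khom y x),
      forall x : C, local_end x
    & forall x y : C, kisomorphic x y -> x = y].

End LocallyBounded.

(* Functors are compared by Leibniz equality; by proof irrelevance and functional
   extensionality this is equality on objects and on morphisms.  A multiplicative
   map between groups is a group morphism. *)
Definition galois_covering (k : fieldType) (G : groupType) (C' C : kcat k)
    (r : {multiplicative G -> kaut C'}) (F : kfun C' C) : Prop :=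
  [/\ forall (g : G) (x : C'), r g x = x -> g = 1%g,
      forall g : G, kfun_comp F (r g) = F
    & forall (C'' : kcat k) (F' : kfun C' C''),
        (forall g : G, kfun_comp F' (r g) = F') ->
        exists! F'' : kfun C C'', kfun_comp F'' F = F'].

Record kideal (k : fieldType) (C : kcat k) := KIdeal {
  ideal_mem : forall x y : C, {pred khom x y};
  ideal_submod : forall x y, GRing.submod_closed (@ideal_mem x y);
  ideal_compl : forall x y z (g : khom y z) (f : khom x y),
    f \in @ideal_mem x y -> kcomp g f \in @ideal_mem x z;
  ideal_compr : forall x y z (g : khom y z) (f : khom x y),
    g \in @ideal_mem y z -> kcomp g f \in @ideal_mem x z }.

Arguments ideal_mem {k C} _ x y _.

HB.instance Definition _ (k : fieldType) (C : kcat k) (I : kideal C) (x y : C) :=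
  GRing.isSubmodClosed.Build k (khom x y) (ideal_mem I x y) (ideal_submod I x y).

Section Quotient.
Variables (k : fieldType) (C : kcat k) (I : kideal C).
Local Open Scope quotient_scope.

Definition qhom (x y : C) : Type := Quotient.quot (ideal_mem I x y).

HB.instance Definition _ x y := GRing.Zmodule.on (qhom x y).
HB.instance Definition _ x y := Quotient.on (qhom x y).

Definition qpi x y (f : khom x y) : qhom x y := \pi f.
Definition qrepr x y (u : qhom x y) : khom x y := repr u.

Lemma qreprK x y (u : qhom x y) : qpi (qrepr u) = u.
Proof. exact: reprK. Qed.

Lemma qpiP x y (f g : khom x y) : qpi f = qpi g <-> f - g \in ideal_mem I x y.
Proof. by rewrite Quotient.idealrBE; split=> /eqP. Qed.

Lemma qpi_repr x y (f : khom x y) : qrepr (qpi f) - f \in ideal_mem I x y.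
Proof. by apply/qpiP; rewrite qreprK. Qed.

Lemma qpiD x y (f g : khom x y) : qpi (f + g) = qpi f + qpi g.
Proof. by rewrite /qpi; exact: raddfD. Qed.

Definition qscale x y (a : k) (u : qhom x y) : qhom x y := qpi (a *: qrepr u).

Lemma qpiZ x y a (f : khom x y) : qpi (a *: f) = qscale a (qpi f).
Proof.
apply/qpiP; rewrite -scalerBr -opprB scalerN -scaleNr.
by apply: rpredZ; exact: qpi_repr.
Qed.

Lemma qscaleA x y a b (u : qhom x y) : qscale a (qscale b u) = qscale (a * b) u.
Proof. by rewrite -[u]qreprK -!qpiZ scalerA. Qed.
Lemma qscale1 x y : left_id 1 (@qscale x y).
Proof. by move=> u; rewrite -[u]qreprK -!qpiZ scale1r. Qed.
Lemma qscaleDr x y : right_distributive (@qscale x y) +%R.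
Proof.
by move=> a u v; rewrite -[u]qreprK -[v]qreprK -qpiD -!qpiZ -qpiD scalerDr.
Qed.
Lemma qscaleDl x y (u : qhom x y) : {morph (@qscale x y)^~ u : a b / a + b}.
Proof. by move=> a b; rewrite -[u]qreprK -!qpiZ -qpiD scalerDl. Qed.

HB.instance Definition _ x y := GRing.Zmodule_isLmodule.Build k (qhom x y)
  (@qscaleA x y) (@qscale1 x y) (@qscaleDr x y) (@qscaleDl x y).

Lemma qpi_linear x y : linear (@qpi x y).
Proof. by move=> a f g; rewrite qpiD qpiZ. Qed.

Definition qcomp x y z (v : qhom y z) (u : qhom x y) : qhom x z :=
  qpi (kcomp (qrepr v) (qrepr u)).

Lemma kcompBl (x y z : C) (g g' : khom y z) (f : khom x y) :
  kcomp (g - g') f = kcomp g f - kcomp g' f.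
Proof.
by rewrite addrC -scaleN1r (kcomp_linearl f) scaleN1r addrC.
Qed.

Lemma kcompBr (x y z : C) (g : khom y z) (f f' : khom x y) :
  kcomp g (f - f') = kcomp g f - kcomp g f'.
Proof.
by rewrite addrC -scaleN1r (kcomp_linearr g) scaleN1r addrC.
Qed.

Lemma qpi_comp x y z (g : khom y z) (f : khom x y) :
  qpi (kcomp g f) = qcomp (qpi g) (qpi f).
Proof.
apply/esym/qpiP.
rewrite -(subrKA (kcomp (qrepr (qpi g)) f) (kcomp _ (qrepr (qpi f)))).
rewrite -kcompBr -kcompBl rpredD //.
  by apply: ideal_compl; exact: qpi_repr.
by apply: ideal_compr; exact: qpi_repr.
Qed.

Definition kquot : kcat k.
Proof.
refine (@KCat k C (fun x y => qhom x y) (fun x => qpi (kid C x)) qcomp _ _ _ _ _).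
- move=> w x y z h g f; rewrite -[h]qreprK -[g]qreprK -[f]qreprK.
  by rewrite -!qpi_comp kcompA.
- by move=> x y f; rewrite -[f]qreprK -qpi_comp kcomp1l.
- by move=> x y f; rewrite -[f]qreprK -qpi_comp kcomp1r.
- move=> x y z f a g g'; rewrite -[f]qreprK -[g]qreprK -[g']qreprK.
  by rewrite -qpi_linear -!qpi_comp -qpi_linear kcomp_linearl.
- move=> x y z g a f f'; rewrite -[g]qreprK -[f]qreprK -[f']qreprK.
  by rewrite -qpi_linear -!qpi_comp -qpi_linear kcomp_linearr.
Defined.

End Quotient.

Section QuotientFunctor.
Variables (k : fieldType) (C D : kcat k) (F : kfun C D).
Variables (I : kideal C) (J : kideal D).
Hypothesis FIJ : forall x y (f : khom x y),
  f \in ideal_mem I x y -> fmor F f \in ideal_mem J (F x) (F y).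

Definition kquot_fmor x y (u : qhom I x y) : qhom J (F x) (F y) :=
  qpi J (fmor F (qrepr u)).

Lemma kquot_fmorE x y (f : khom x y) : kquot_fmor (qpi I f) = qpi J (fmor F f).
Proof.
apply/qpiP; have -> : fmor F (qrepr (qpi I f)) - fmor F f =
    fmor F (qrepr (qpi I f) - f).
  by rewrite addrC -scaleN1r -fmor_linear scaleN1r addrC.
by apply: FIJ; exact: qpi_repr.
Qed.

Definition kquot_fun : kfun (kquot I) (kquot J).
Proof.
refine (@KFun k (kquot I) (kquot J) F kquot_fmor _ _ _).
- move=> x y a u v; rewrite -[u]qreprK -[v]qreprK.
  by rewrite -qpi_linear !kquot_fmorE fmor_linear qpi_linear.
- by move=> x; rewrite [LHS]kquot_fmorE fmor_id.
- move=> x y z v u; rewrite -[u]qreprK -[v]qreprK.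
  by rewrite -[kcomp _ _]qpi_comp !kquot_fmorE fmor_comp qpi_comp.
Defined.

End QuotientFunctor.

Section GeneratedIdeal.
Variables (k : fieldType) (C : kcat k).
Variable S : forall x y : C, khom x y -> Prop.

Definition gen_mem (x y : C) : {pred khom x y} := fun f =>
  `[< forall J : kideal C,
        (forall x y (g : khom x y), S g -> g \in ideal_mem J x y) ->
        f \in ideal_mem J x y >].

Definition kideal_gen : kideal C.
Proof.
refine (@KIdeal k C gen_mem _ _ _).
- move=> x y; split; first by apply/asboolP => J _; exact: rpred0.
  move=> a f g /asboolP fJ /asboolP gJ; apply/asboolP => J SJ.
  by rewrite rpredD ?rpredZ ?fJ ?gJ.
- move=> x y z g f /asboolP fJ; apply/asboolP => J SJ.
  by apply: ideal_compl; exact: fJ.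
- move=> x y z g f /asboolP gJ; apply/asboolP => J SJ.
  by apply: ideal_compr; exact: gJ.
Defined.

Lemma kideal_gen_sub x y (f : khom x y) : S f -> f \in ideal_mem kideal_gen x y.
Proof. by move=> Sf; apply/asboolP => J; apply. Qed.

Lemma kideal_gen_min (J : kideal C) :
  (forall x y (g : khom x y), S g -> g \in ideal_mem J x y) ->
  forall x y (f : khom x y), f \in ideal_mem kideal_gen x y -> f \in ideal_mem J x y.
Proof. by move=> SJ x y f /asboolP; exact. Qed.

End GeneratedIdeal.

Section IdealPreimage.
Variables (k : fieldType) (C D : kcat k) (F : kfun C D) (J : kideal D).

Definition kideal_preim : kideal C.
Proof.
refine (@KIdeal k C (fun x y f => fmor F f \in ideal_mem J (F x) (F y)) _ _ _).
- move=> x y; split.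
    rewrite -topredE /=; have -> : (0 : khom x y) = (-1) *: 0 + 0.
      by rewrite scaler0 addr0.
    by rewrite fmor_linear scaleN1r addNr; exact: rpred0.
  move=> a f g; rewrite -!topredE /= => fJ gJ.
  by rewrite fmor_linear; apply: rpredD => //; exact: rpredZ.
- by move=> x y z g f fJ; rewrite -topredE /= fmor_comp; exact: ideal_compl.
- by move=> x y z g f gJ; rewrite -topredE /= fmor_comp; exact: ideal_compr.
Defined.

End IdealPreimage.

Section FreeModule.
Variables (k : fieldType) (K : choiceType).

Definition malg_lin (V : lmodType k) (h : K -> V) (f : {malg k[K]}) : V :=
  \sum_(w <- msupp f) f@_w *: h w.

Lemma malg_linEw (V : lmodType k) (h : K -> V) (d : {fset K}) (f : {malg k[K]}) : (msupp f `<=` d)%fset ->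
  malg_lin h f = \sum_(w <- d) f@_w *: h w.
Proof.
move=> le_fd; rewrite /malg_lin (big_fset_incl _ le_fd) // => w _.
by rewrite -mcoeff_eq0 => /eqP ->; rewrite scale0r.
Qed.

Lemma malg_lin_linear (V : lmodType k) (h : K -> V) : linear (malg_lin h).
Proof.
move=> a f g; set d := (msupp f `|` msupp g)%fset.
have sub_d : (msupp (a *: f + g) `<=` d)%fset.
  apply: fsubset_trans (msuppD_le _ _) _.
  by apply: fsetSU; exact: msuppZ_le.
rewrite (malg_linEw _ sub_d) (malg_linEw _ (fsubsetUl (msupp f) (msupp g))).
rewrite (malg_linEw _ (fsubsetUr (msupp f) (msupp g))) scaler_sumr -big_split /=.
by apply: eq_bigr => w _; rewrite mcoeffD mcoeffZ scalerDl scalerA.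
Qed.

Lemma malg_linU (V : lmodType k) (h : K -> V) w : malg_lin h << w >> = h w.
Proof.
rewrite (malg_linEw (d := [fset w]%fset) _ msuppU_le) big_seq_fset1 mcoeffUU; exact: scale1r.
Qed.

Lemma malg_lin_ext (V : lmodType k) (F G : {malg k[K]} -> V) : linear F -> linear G ->
  (forall w, F << w >> = G << w >>) -> forall f, F f = G f.
Proof.
move=> Fl Gl FG f; pose H g := F g - G g.
have Hl : linear H.
  by move=> a u v; rewrite /H Fl Gl scalerBr opprD addrACA.
have H0 : H 0 = 0 by rewrite -[X in H X](addNr 0) -scaleN1r Hl scaleN1r addNr.
suff: H f = 0 by move/eqP; rewrite subr_eq0 => /eqP.
rewrite [f]monalgE; elim/big_rec: _ => // w g _ Hg.
have -> : << f@_w *g w >> = f@_w *: << w >> :> {malg k[K]}.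
  by apply/malgP => v; rewrite mcoeffZ !mcoeffU mulrnAr mulr1.
by rewrite Hl Hg addr0 /H FG subrr scaler0.
Qed.

Lemma malg_lin_comb (V : lmodType k) a (h h' : K -> V) f :
  malg_lin (fun w => a *: h w + h' w) f = a *: malg_lin h f + malg_lin h' f.
Proof.
rewrite /malg_lin scaler_sumr -big_split /=; apply: eq_bigr => w _.
by rewrite scalerDr !scalerA mulrC.
Qed.

Lemma eq_malg_lin (V : lmodType k) (h h' : K -> V) f :
  h =1 h' -> malg_lin h f = malg_lin h' f.
Proof. by move=> hE; apply: eq_bigr => w _; rewrite hE. Qed.

End FreeModule.

Record quiver := Quiver {
  vert : choiceType;
  arr : choiceType;
  src : arr -> vert;
  tgt : arr -> vert }.

Section Paths.
Variable Q : quiver.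

Fixpoint is_path (x : vert Q) (s : seq (arr Q)) (y : vert Q) : bool :=
  if s is a :: s' then (src a == x) && is_path (tgt a) s' y else x == y.

(* The path written alpha_n ... alpha_1 is the list [:: alpha_1; ...; alpha_n]. *)
Definition qpath (x y : vert Q) := {s : seq (arr Q) | is_path x s y}.

HB.instance Definition _ x y := Choice.on (qpath x y).

Definition plen x y (p : qpath x y) := size (val p).

Lemma is_path_cat x y z s s' :
  is_path x s y -> is_path y s' z -> is_path x (s ++ s') z.
Proof.
by elim: s x => [|a s IH] x /= => [/eqP-> // | /andP[-> /IH]]; exact.
Qed.

Definition pid x : qpath x x := exist _ [::] (eqxx x).

Lemma is_path_arr a : is_path (src a) [:: a] (tgt a).
Proof. by rewrite /= !eqxx. Qed.

Definition parr a : qpath (src a) (tgt a) := exist _ [:: a] (is_path_arr a).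

Definition pcomp x y z (q : qpath y z) (p : qpath x y) : qpath x z :=
  exist _ (val p ++ val q) (is_path_cat (valP p) (valP q)).

Lemma pcompA w x y z (r : qpath y z) (q : qpath x y) (p : qpath w x) :
  pcomp r (pcomp q p) = pcomp (pcomp r q) p.
Proof. by apply: val_inj => /=; rewrite catA. Qed.

Lemma pcomp1l x y (p : qpath x y) : pcomp (pid y) p = p.
Proof. by apply: val_inj => /=; rewrite cats0. Qed.

Lemma pcomp1r x y (p : qpath x y) : pcomp p (pid x) = p.
Proof. exact: val_inj. Qed.

End Paths.

Section PathCategory.
Variables (k : fieldType) (Q : quiver).

Definition phom (x y : vert Q) : lmodType k := {malg k[qpath x y]}.

Definition phom_comp x y z (g : phom y z) (f : phom x y) : phom x z :=
  malg_lin (fun q => malg_lin (fun p => << pcomp q p >> : phom x z) f) g.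

Lemma phom_comp_linearl x y z (f : phom x y) :
  linear (fun g : phom y z => phom_comp g f).
Proof. exact: malg_lin_linear. Qed.

Lemma phom_comp_linearr x y z (g : phom y z) :
  linear (fun f : phom x y => phom_comp g f).
Proof.
move=> a f f'; rewrite /phom_comp -malg_lin_comb; apply: eq_malg_lin => q.
exact: malg_lin_linear.
Qed.

Lemma phom_compU x y z (q : qpath y z) (p : qpath x y) :
  phom_comp << q >> << p >> = << pcomp q p >>.
Proof. by rewrite /phom_comp !malg_linU. Qed.

Lemma phom_compA w x y z (h : phom y z) (g : phom x y) (f : phom w x) :
  phom_comp h (phom_comp g f) = phom_comp (phom_comp h g) f.
Proof.
move: h; apply: malg_lin_ext => [a u v|a u v|r]; rewrite ?phom_comp_linearl //.
move: g; apply: malg_lin_ext => [a u v|a u v|q];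
  rewrite ?(phom_comp_linearl, phom_comp_linearr) //.
move: f; apply: malg_lin_ext => [a u v|a u v|p]; rewrite ?phom_comp_linearr //.
by rewrite !phom_compU pcompA.
Qed.

Lemma phom_comp1l x y (f : phom x y) : phom_comp << pid y >> f = f.
Proof.
move: f; apply: malg_lin_ext => [a u v|a u v|p]; rewrite ?phom_comp_linearr //.
by rewrite phom_compU pcomp1l.
Qed.

Lemma phom_comp1r x y (f : phom x y) : phom_comp f << pid x >> = f.
Proof.
move: f; apply: malg_lin_ext => [a u v|a u v|p]; rewrite ?phom_comp_linearl //.
by rewrite phom_compU pcomp1r.
Qed.

Definition path_cat : kcat k :=
  @KCat k (vert Q) phom (fun x => << pid x >>) phom_comp
    phom_compA phom_comp1l phom_comp1r phom_comp_linearl phom_comp_linearr.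

Definition path_mor (x y : vert Q) (p : qpath x y) :
  @khom k path_cat x y := << p >>.

End PathCategory.

Arguments path_mor k {Q x y} p.

Section QuotientFunctorTheory.
Variable k : fieldType.

Lemma kquot_fun_eq (C D : kcat k) (F F' : kfun C D) (I : kideal C)
    (J : kideal D) H H' :
  F = F' -> @kquot_fun k C D F I J H = @kquot_fun k C D F' I J H'.
Proof. by move=> FF'; subst F'; congr kquot_fun; exact: Prop_irrelevance. Qed.

Lemma kquot_fun_id (C : kcat k) (I : kideal C) H :
  @kquot_fun k C C (kfun_id C) I I H = kfun_id (kquot I).
Proof. by apply: kfun_eq => x y u; exact: qreprK. Qed.

Lemma kquot_fun_comp (C D E : kcat k) (F : kfun C D) (G : kfun D E)
    (I : kideal C) (J : kideal D) (L : kideal E) HF HG H :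
  kfun_comp (@kquot_fun k D E G J L HG) (@kquot_fun k C D F I J HF) =
  @kquot_fun k C E (kfun_comp G F) I L H.
Proof.
apply: kfun_eq => x y u /=.
by rewrite -[u]qreprK (kquot_fmorE HF) (kquot_fmorE HG) (kquot_fmorE H).
Qed.

End QuotientFunctorTheory.

Section QuiverMaps.

Record qmap (Q Q' : quiver) := QMap {
  vmap : vert Q -> vert Q';
  amap : arr Q -> arr Q';
  src_amap : forall a, src (amap a) = vmap (src a);
  tgt_amap : forall a, tgt (amap a) = vmap (tgt a) }.

Lemma qmap_eq Q Q' (f g : qmap Q Q') : vmap f =1 vmap g -> amap f =1 amap g -> f = g.
Proof.
case: f g => [v a s t] [v' a' s' t'] /= /funext vv' /funext aa'; subst v' a'.
by congr QMap; exact: Prop_irrelevance.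
Qed.

Definition qmap_id Q : qmap Q Q := @QMap Q Q id id (fun=> erefl) (fun=> erefl).

Definition qmap_comp Q Q' Q'' (g : qmap Q' Q'') (f : qmap Q Q') : qmap Q Q''.
Proof.
refine (@QMap Q Q'' (vmap g \o vmap f) (amap g \o amap f) _ _) => a /=.
- by rewrite !src_amap.
- by rewrite !tgt_amap.
Defined.

Lemma is_path_map Q Q' (f : qmap Q Q') x y s :
  is_path x s y -> is_path (vmap f x) (map (amap f) s) (vmap f y).
Proof.
elim: s x => [|a s IH] x /= => [/eqP->|/andP[/eqP <- /IH]]; first exact: eqxx.
by rewrite src_amap eqxx tgt_amap.
Qed.

Definition path_map Q Q' (f : qmap Q Q') x y (p : qpath x y) :
  qpath (vmap f x) (vmap f y) :=
  exist _ (map (amap f) (val p)) (is_path_map f (valP p)).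

Variable k : fieldType.

Definition path_fmor Q Q' (f : qmap Q Q') x y (u : phom k x y) :
    phom k (vmap f x) (vmap f y) :=
  malg_lin (fun p => << path_map f p >> : phom k (vmap f x) (vmap f y)) u.

Lemma path_fmorU Q Q' (f : qmap Q Q') x y (p : qpath x y) :
  path_fmor f << p >> = << path_map f p >>.
Proof. exact: malg_linU. Qed.

Lemma path_fmor_linear Q Q' (f : qmap Q Q') x y : linear (@path_fmor Q Q' f x y).
Proof. exact: malg_lin_linear. Qed.

Lemma path_fmor_comp Q Q' (f : qmap Q Q') x y z (v : phom k y z) (u : phom k x y) :
  path_fmor f (phom_comp v u) = phom_comp (path_fmor f v) (path_fmor f u).
Proof.
move: v; apply: malg_lin_ext => [a v v'|a v v'|q].
- by rewrite phom_comp_linearl path_fmor_linear.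
- by rewrite path_fmor_linear phom_comp_linearl.
move: u; apply: malg_lin_ext => [a u u'|a u u'|p].
- by rewrite phom_comp_linearr path_fmor_linear.
- by rewrite path_fmor_linear phom_comp_linearr.
rewrite phom_compU !path_fmorU phom_compU; congr mkmalgU.
by apply: val_inj; rewrite /= map_cat.
Qed.

Definition path_fun Q Q' (f : qmap Q Q') : kfun (path_cat k Q) (path_cat k Q').
Proof.
refine (@KFun k (path_cat k Q) (path_cat k Q') (vmap f)
  (fun x y => @path_fmor Q Q' f x y) _ _ _).
- exact: path_fmor_linear.
- by move=> x; rewrite [LHS]path_fmorU; congr mkmalgU; exact: val_inj.
- by move=> x y z v u; exact: path_fmor_comp.
Defined.

Lemma path_fun_id Q : path_fun (qmap_id Q) = kfun_id (path_cat k Q).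
Proof.
apply: kfun_eq => x y; apply: malg_lin_ext => [a u v|//|p].
  exact: path_fmor_linear.
by rewrite [LHS]path_fmorU; congr mkmalgU; apply: val_inj; exact: map_id.
Qed.

Lemma path_fun_comp Q Q' Q'' (g : qmap Q' Q'') (f : qmap Q Q') :
  path_fun (qmap_comp g f) = kfun_comp (path_fun g) (path_fun f).
Proof.
apply: kfun_eq => x y; apply: malg_lin_ext => [a u v|a u v|p].
- exact: path_fmor_linear.
- by rewrite /= !path_fmor_linear.
rewrite [LHS]path_fmorU /= !path_fmorU; congr mkmalgU; apply: val_inj.
exact: map_comp.
Qed.

End QuiverMaps.

Section BoundQuivers.
Variables (k : fieldType) (Q : quiver).
Implicit Type I : kideal (path_cat k Q).

Definition admissible I :=
  (forall x y (f : {malg k[qpath x y]}), f \in ideal_mem I x y ->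
     forall p, p \in msupp f -> (2 <= plen p)%N) /\
  locally_bounded (kquot I).

Definition path_gens (P : forall x y : vert Q, qpath x y -> Prop)
    (x y : path_cat k Q) (f : khom x y) :=
  exists2 p : qpath x y, P x y p & f = path_mor k p.

Definition monomial I :=
  exists P : forall x y : vert Q, qpath x y -> Prop,
    forall x y, ideal_mem I x y =i ideal_mem (kideal_gen (path_gens P)) x y.

Definition finite_quiver :=
  finite_set [set: vert Q]%classic /\ finite_set [set: arr Q]%classic.

Definition no_oriented_cycle := forall (x : vert Q) (p : qpath x x), plen p = 0%N.

Definition no_multiple_arrows :=
  forall a b : arr Q, src a = src b -> tgt a = tgt b -> a = b.

End BoundQuivers.

Section Walks.
Variable Q : quiver.

(* [inl a] is the arrow a and [inr a] is its formal inverse. *)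
Definition double_quiver : quiver :=
  @Quiver (vert Q) (arr Q + arr Q)%type
    (fun b => match b with inl a => src a | inr a => tgt a end)
    (fun b => match b with inl a => tgt a | inr a => src a end).

Definition walk (x y : vert Q) := @qpath double_quiver x y.

Definition wid (x : vert Q) : walk x x := @pid double_quiver x.
Definition wcomp x y z (v : walk y z) (w : walk x y) : walk x z := pcomp v w.
Definition warr (a : arr Q) : walk (src a) (tgt a) := @parr double_quiver (inl a).
Definition winv (a : arr Q) : walk (tgt a) (src a) := @parr double_quiver (inr a).

Definition qconnected := forall x y : vert Q, inhabited (walk x y).

Inductive homotopic : forall x y : vert Q, walk x y -> walk x y -> Prop :=
| htp_refl x y (w : walk x y) : homotopic w w
| htp_sym x y (v w : walk x y) : homotopic v w -> homotopic w v
| htp_trans x y (u v w : walk x y) :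
    homotopic u v -> homotopic v w -> homotopic u w
| htp_comp x y z (v v' : walk y z) (w w' : walk x y) :
    homotopic v v' -> homotopic w w' -> homotopic (wcomp v w) (wcomp v' w')
| htp_cancelr a : homotopic (wcomp (warr a) (winv a)) (wid (tgt a))
| htp_cancell a : homotopic (wcomp (winv a) (warr a)) (wid (src a)).

Definition homotopicb x y (v w : walk x y) : bool := `[< homotopic v w >].

Lemma homotopicb_refl x y : reflexive (@homotopicb x y).
Proof. by move=> w; apply/asboolP; exact: htp_refl. Qed.
Lemma homotopicb_sym x y : symmetric (@homotopicb x y).
Proof. by move=> v w; apply: asbool_equiv_eq; split; exact: htp_sym. Qed.
Lemma homotopicb_trans x y : transitive (@homotopicb x y).
Proof.
move=> v u w /asboolP uv /asboolP vw; apply/asboolP; exact: htp_trans uv vw.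
Qed.

Canonical homotopicb_equiv x y := EquivRel (@homotopicb x y)
  (@homotopicb_refl x y) (@homotopicb_sym x y) (@homotopicb_trans x y).

Definition wclass (x y : vert Q) := {eq_quot @homotopicb x y}%qT.

HB.instance Definition _ x y := Choice.on (wclass x y).

Definition wcls x y (w : walk x y) : wclass x y := (\pi_(wclass x y) w)%qT.

Lemma wclsP x y (v w : walk x y) : wcls v = wcls w <-> homotopic v w.
Proof. by split=> [/eqmodP/asboolP | vw]; last exact/eqmodP/asboolP. Qed.

Definition wrep x y (c : wclass x y) : walk x y := repr c.

Lemma wrepK x y (c : wclass x y) : wcls (wrep c) = c.
Proof. exact: reprK. Qed.

Definition cid x : wclass x x := wcls (wid x).

Definition ccomp x y z (d : wclass y z) (c : wclass x y) : wclass x z :=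
  wcls (wcomp (wrep d) (wrep c)).

Lemma ccompE x y z (v : walk y z) (w : walk x y) :
  ccomp (wcls v) (wcls w) = wcls (wcomp v w).
Proof. by apply/wclsP; apply: htp_comp; apply/wclsP; exact: wrepK. Qed.

Lemma ccompA w x y z (e : wclass y z) (d : wclass x y) (c : wclass w x) :
  ccomp e (ccomp d c) = ccomp (ccomp e d) c.
Proof.
by rewrite -[e]wrepK -[d]wrepK -[c]wrepK !ccompE; congr wcls; exact: pcompA.
Qed.

Lemma ccomp1l x y (c : wclass x y) : ccomp (cid y) c = c.
Proof. by rewrite -[c]wrepK ccompE; congr wcls; exact: pcomp1l. Qed.

Lemma ccomp1r x y (c : wclass x y) : ccomp c (cid x) = c.
Proof. by rewrite -[c]wrepK ccompE; congr wcls; exact: pcomp1r. Qed.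

Definition flip (b : arr Q + arr Q) :=
  match b with inl a => inr a | inr a => inl a end.

Lemma is_path_rev x y (s : seq (arr Q + arr Q)) :
  @is_path double_quiver x s y -> @is_path double_quiver y (rev (map flip s)) x.
Proof.
elim: s x => [|b s IH] x /= => [/eqP->|/andP[/eqP <- /IH p]]; first exact: eqxx.
rewrite rev_cons -cats1; apply: is_path_cat p _.
by case: b {IH} => a /=; rewrite !eqxx.
Qed.

Definition wrev x y (w : walk x y) : walk y x :=
  exist _ (rev (map flip (val w))) (is_path_rev (valP w)).

Lemma wrevK x y (w : walk x y) : wrev (wrev w) = w.
Proof.
apply: val_inj; rewrite /= map_rev revK -map_comp map_id_in // => -[a|a] //.
Qed.

Lemma wrev_comp x y z (v : walk y z) (w : walk x y) :
  wrev (wcomp v w) = wcomp (wrev w) (wrev v).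
Proof. by apply: val_inj; rewrite /= map_cat rev_cat. Qed.

Lemma wrev_cancel1 (b : arr double_quiver) :
  homotopic (wcomp (wrev (parr b)) (parr b)) (wid (src b)).
Proof.
case: b => a.
- rewrite (_ : wrev _ = winv a); first exact: htp_cancell.
  exact: val_inj.
- rewrite (_ : wrev _ = warr a); first exact: htp_cancelr.
  exact: val_inj.
Qed.

Lemma wrev_cancel x y (w : walk x y) : homotopic (wcomp (wrev w) w) (wid x).
Proof.
move E : (val w) => s; elim: s x w E => [|b s IH] x w E.
  have e := valP w; rewrite E in e; have {}e := eqP e; subst y.
  rewrite (_ : wcomp _ _ = wid x); last by apply: val_inj; rewrite /= E.
  exact: htp_refl.
have := valP w; rewrite E => /andP[/eqP e p']; subst x.
pose w' : walk (@tgt double_quiver b) y := exist _ s p'.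
have -> : w = @wcomp _ _ y w' (parr b) by exact: val_inj.
rewrite wrev_comp (_ : wcomp _ _ =
  wcomp (wrev (parr b)) (wcomp (wcomp (wrev w') w') (parr b))); last first.
  by apply: val_inj; rewrite /= !catA.
apply: htp_trans (wrev_cancel1 b); apply: htp_comp (htp_refl _) _.
rewrite -[X in homotopic _ X](pcomp1l (Q := double_quiver)).
by apply: htp_comp (htp_refl _); exact: (IH _ w').
Qed.

Definition cinv x y (c : wclass x y) : wclass y x := wcls (wrev (wrep c)).

Lemma ccompVl x y (c : wclass x y) : ccomp (cinv c) c = cid x.
Proof. by rewrite -{2}[c]wrepK ccompE; apply/wclsP; exact: wrev_cancel. Qed.

Lemma ccompVr x y (c : wclass x y) : ccomp c (cinv c) = cid y.
Proof.
rewrite -{1}[c]wrepK ccompE; apply/wclsP.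
by rewrite -{1}[wrep c]wrevK; exact: wrev_cancel.
Qed.

Definition pi1 (x0 : vert Q) : Type := wclass x0 x0.

HB.instance Definition _ x0 := Choice.on (pi1 x0).
HB.instance Definition _ x0 := isGroup.Build (pi1 x0)
  (@ccompA x0 x0 x0 x0) (@ccomp1l x0 x0) (@ccomp1r x0 x0)
  (@ccompVl x0 x0) (@ccompVr x0 x0).

End Walks.

Section UniversalCover.
Variables (Q : quiver) (x0 : vert Q).

Definition cover_vert : choiceType := {y : vert Q & wclass x0 y}.

(* An arrow ([gamma], a) is stored as a together with the class of a walk gamma
   from x0 to src a. *)
Definition cover_arr : choiceType := {a : arr Q & wclass x0 (src a)}.

Definition cover_quiver : quiver :=
  @Quiver cover_vert cover_arr
    (fun b => Tagged (fun y => wclass x0 y) (tagged b))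
    (fun b => Tagged (fun y => wclass x0 y) (ccomp (wcls (warr (tag b))) (tagged b))).

Definition cover_map : qmap cover_quiver Q :=
  @QMap cover_quiver Q (fun v : cover_vert => tag v) (fun b : cover_arr => tag b)
    (fun=> erefl) (fun=> erefl).

(* g . [gamma] = [gamma g^-1] *)
Definition cover_act (g : pi1 x0) : qmap cover_quiver cover_quiver.
Proof.
refine (@QMap cover_quiver cover_quiver
  (fun v : cover_vert => Tagged (fun y => wclass x0 y) (ccomp (tagged v) (cinv g)))
  (fun b : cover_arr =>
     Tagged (fun a => wclass x0 (src a)) (ccomp (tagged b) (cinv g))) _ _).
- by [].
- by move=> b; rewrite /= ccompA.
Defined.

Lemma cover_act1 : cover_act 1%g = qmap_id cover_quiver.
Proof.
have E : cinv (1%g : pi1 x0) = cid x0 by exact: (@invg1 (pi1 x0)).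
by apply: qmap_eq => -[y c] /=; rewrite E ccomp1r.
Qed.

Lemma cover_actM g h : cover_act (g * h)%g = qmap_comp (cover_act g) (cover_act h).
Proof.
have E : cinv (g * h)%g = ccomp (cinv h) (cinv g) by exact: (@invgM (pi1 x0)).
by apply: qmap_eq => -[y c] /=; rewrite E ccompA.
Qed.

Lemma cover_map_act g : qmap_comp cover_map (cover_act g) = cover_map.
Proof. exact: qmap_eq. Qed.

Variables (k : fieldType) (I0 : kideal (path_cat k Q)).

Definition cover_gens (x y : path_cat k cover_quiver) (f : khom x y) :=
  exists2 w : @qpath cover_quiver x y, f = path_mor k w &
    path_mor k (path_map cover_map w) \in ideal_mem I0 _ _.

Definition cover_ideal : kideal (path_cat k cover_quiver) :=
  kideal_gen cover_gens.

Definition cover_cat : kcat k := kquot cover_ideal.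

Lemma cover_map_ideal x y (f : @khom k (path_cat k cover_quiver) x y) :
  f \in ideal_mem cover_ideal x y ->
  fmor (path_fun k cover_map) f \in ideal_mem I0 _ _.
Proof.
pose P := kideal_preim (path_fun k cover_map) I0.
move: f; apply: (kideal_gen_min (J := P)) => x' y' _ [w -> wI].
by rewrite -topredE /= /path_mor path_fmorU.
Qed.

Definition cover_fun : kfun cover_cat (kquot I0) := kquot_fun cover_map_ideal.

Lemma cover_act_ideal g x y (f : @khom k (path_cat k cover_quiver) x y) :
  f \in ideal_mem cover_ideal x y ->
  fmor (path_fun k (cover_act g)) f \in ideal_mem cover_ideal _ _.
Proof.
pose P := kideal_preim (path_fun k (cover_act g)) cover_ideal.
move: f; apply: (kideal_gen_min (J := P)) => x' y' _ [w -> wI].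
rewrite -topredE /= /path_mor path_fmorU; apply: kideal_gen_sub.
exists (path_map (cover_act g) w) => //.
have -> : path_map cover_map (path_map (cover_act g) w) = path_map cover_map w :>
    qpath (vmap cover_map x') (vmap cover_map y').
  by apply: val_inj; rewrite /= -map_comp.
by [].
Qed.

Definition cover_act_fun (g : pi1 x0) : kfun cover_cat cover_cat :=
  kquot_fun (cover_act_ideal g).

Lemma cover_act_fun1 : cover_act_fun 1%g = kfun_id cover_cat.
Proof.
have E : path_fun k (cover_act 1%g) = kfun_id (path_cat k cover_quiver).
  by rewrite cover_act1 path_fun_id.
rewrite -(@kquot_fun_id k _ cover_ideal (fun x y f => id)).
exact: kquot_fun_eq.
Qed.

Lemma cover_act_funM g h :
  cover_act_fun (g * h)%g = kfun_comp (cover_act_fun g) (cover_act_fun h).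
Proof.
have E : path_fun k (cover_act (g * h)%g) =
    kfun_comp (path_fun k (cover_act g)) (path_fun k (cover_act h)).
  by rewrite cover_actM path_fun_comp.
rewrite [RHS]kquot_fun_comp => [x y f fI|H]; last exact: kquot_fun_eq.
by rewrite -E; exact: cover_act_ideal.
Qed.

Definition cover_act_aut (g : pi1 x0) : kaut cover_cat.
Proof.
refine (@KAut k cover_cat (cover_act_fun g) (cover_act_fun g^-1%g) _ _).
- by rewrite -cover_act_funM mulVg cover_act_fun1.
- by rewrite -cover_act_funM mulgV cover_act_fun1.
Defined.

Lemma cover_act_autM : {morph cover_act_aut : g h / (g * h)%g}.
Proof. by move=> g h; apply: kaut_eq; exact: cover_act_funM. Qed.

HB.instance Definition _ := monoid.isMultiplicative.Build (pi1 x0) (kaut cover_cat)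
  cover_act_aut cover_act_autM.

End UniversalCover.

Section Subgroups.
Variables (G : groupType) (N : groupClosed G).

Definition subgrp := {g : G | g \in N}.

HB.instance Definition _ := SubChoice.on subgrp.

Lemma subgrp_closed : group_closed (N : {pred G}).
Proof. by split; [exact: gpred1 | exact: gpredF]. Qed.

HB.instance Definition _ := SubChoice_isSubGroup.Build G _ subgrp subgrp_closed.

Definition subgrp_incl (n : subgrp) : G := val n.

Lemma subgrp_inclM : {morph subgrp_incl : m n / (m * n)%g}.
Proof. by []. Qed.

HB.instance Definition _ :=
  monoid.isMultiplicative.Build subgrp G subgrp_incl subgrp_inclM.

Definition normal_subgroup := forall g n : G, n \in N -> (n ^ g)%g \in N.

End Subgroups.

Definition short_exact (N P G : groupType) (i : {multiplicative N -> P})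
    (t : {multiplicative P -> G}) : Prop :=
  [/\ injective i,
      forall p, t p = 1%g <-> exists n, i n = p
    & forall g, exists p, t p = g].

Section RestrictedAction.
Variables (k : fieldType) (C : kcat k) (G : groupType).
Variables (N : groupClosed G) (r : {multiplicative G -> kaut C}).

Definition restr_act (n : subgrp N) : kaut C := r (val n).

Lemma restr_actM : {morph restr_act : m n / (m * n)%g}.
Proof. by move=> m n; rewrite /restr_act !gmulfM. Qed.

HB.instance Definition _ :=
  monoid.isMultiplicative.Build (subgrp N) (kaut C) restr_act restr_actM.

End RestrictedAction.

Arguments restr_act {k C G} N r n.
Arguments cover_cat {Q} x0 {k} I0.
Arguments cover_fun {Q} x0 {k} I0.
Arguments cover_act_aut {Q} x0 {k} I0 g.
Arguments subgrp_incl {G} N n.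

(* Main.v *)
Require Import Defs.
From HB Require Import structures.
From mathcomp Require Import all_boot all_algebra.
From mathcomp Require Import finmap monalg zify.
From mathcomp Require Import boolp classical_sets cardinality.
(* Again, so that [pcomp] and [cid] denote the path composition and the class of
   the trivial walk. *)
Require Import Defs.

(* Write A = kQ/I_0 and let F : C -> A be a Galois covering with group G.  Its
   universal property, tested against the category of matrices over C, shows that
   the fibres of F are the G-orbits and that the morphisms of A decompose
   uniquely into sums of images of morphisms of C; tested against the image of
   F, it shows that F is onto.  The choice of one object in each fibre
   then turns A into a G-graded category, and everything reduces to the
   following claim: there is an automorphism psi of A, the identity on objects,
   which maps every arrow to a homogeneous morphism.

   To prove it, one constructs for m = 1, 2, ... endomorphisms chi of A and
   homogeneous u_a such that chi(a) - u_a lies in rad^(m+1) for every arrow a,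
   chi(a) - a being in rad^2; the absence of multiple arrows gives the case m = 1,
   with chi = id.
   Write u_a - chi(a) as a combination of paths b of length m+1 modulo rad^(m+2).
   The b with the degree of a are removed from u_a, the others are added to a:
   this defines a substitution sigma of the arrows of kQ, and chi is replaced
   by chi o sigma.  The point is that sigma preserves I_0.  If p = w a v is
   in I_0 then the product u_p of the (new) u's along p is homogeneous of degree
   deg p, and modulo rad^(|p|+m+1) it is the sum of the terms w b v, which have
   another degree; as the powers of the radical are graded, this sum vanishes
   modulo rad^(|p|+m+1), and as I_0 is monomial each w b v is in I_0.

   Finally the degree extends to walks, the universal cover lifts to C by sending
   the class of a walk c ending at y to deg(c) s(y), and N is the kernel of
   c |-> deg(c)^-1. *)

Set Implicit Arguments.
Unset Strict Implicit.
Unset Printing Implicit Defensive.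

Import GRing.Theory.
Local Open Scope ring_scope.

(** * Transport along equalities of objects *)

Section Linear.
Variables (k : fieldType) (C : kcat k).

Lemma kcomp0l (x y z : C) (f : khom x y) : kcomp (0 : khom y z) f = 0.
Proof. by rewrite -(subrr (0 : khom y z)) kcompBl subrr. Qed.

Lemma kcomp0r (x y z : C) (g : khom y z) : kcomp g (0 : khom x y) = 0.
Proof. by rewrite -(subrr (0 : khom x y)) kcompBr subrr. Qed.

Lemma kcompDl (x y z : C) (g g' : khom y z) (f : khom x y) :
  kcomp (g + g') f = kcomp g f + kcomp g' f.
Proof. by rewrite -{1}[g]scale1r (kcomp_linearl f) scale1r. Qed.

Lemma kcompDr (x y z : C) (g : khom y z) (f f' : khom x y) :
  kcomp g (f + f') = kcomp g f + kcomp g f'.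
Proof. by rewrite -{1}[f]scale1r (kcomp_linearr g) scale1r. Qed.

Lemma kcomp_suml (x y z : C) (I : Type) (s : seq I) (P : pred I)
    (g : I -> khom y z) (f : khom x y) :
  kcomp (\sum_(i <- s | P i) g i) f = \sum_(i <- s | P i) kcomp (g i) f.
Proof.
by elim/big_rec2: _ => [|i u v _ <-]; rewrite ?kcomp0l ?kcompDl.
Qed.

Lemma kcomp_sumr (x y z : C) (I : Type) (s : seq I) (P : pred I)
    (g : khom y z) (f : I -> khom x y) :
  kcomp g (\sum_(i <- s | P i) f i) = \sum_(i <- s | P i) kcomp g (f i).
Proof.
by elim/big_rec2: _ => [|i u v _ <-]; rewrite ?kcomp0r ?kcompDr.
Qed.

Variables (D : kcat k) (F : kfun C D).

Lemma fmorB (x y : C) (f g : khom x y) : fmor F (f - g) = fmor F f - fmor F g.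
Proof. by rewrite addrC -scaleN1r fmor_linear scaleN1r addrC. Qed.

Lemma fmor0 (x y : C) : fmor F (0 : khom x y) = 0.
Proof. by rewrite -(subrr (0 : khom x y)) fmorB subrr. Qed.

Lemma fmorD (x y : C) (f g : khom x y) : fmor F (f + g) = fmor F f + fmor F g.
Proof. by rewrite -{1}[f]scale1r fmor_linear scale1r. Qed.

Lemma fmorZ (x y : C) c (f : khom x y) : fmor F (c *: f) = c *: fmor F f.
Proof. by rewrite -[c *: f]addr0 fmor_linear fmor0 addr0. Qed.

Lemma fmor_sum (x y : C) (I : Type) (s : seq I) (P : pred I) (f : I -> khom x y) :
  fmor F (\sum_(i <- s | P i) f i) = \sum_(i <- s | P i) fmor F (f i).
Proof. by elim/big_rec2: _ => [|i u v _ <-]; rewrite ?fmor0 ?fmorD. Qed.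

End Linear.

Section Cast.
Variables (k : fieldType) (C : kcat k).

(* Transport of morphisms along equalities of objects, with junk value 0 when
   the objects differ, so that no equality proof occurs in the terms. *)
Definition kto (x' y' x y : C) (f : khom x y) : khom x' y' :=
  match pselect (x = x'), pselect (y = y') with
  | left e, left e' =>
      eq_rect x (fun z => khom z y') (eq_rect y (fun z => khom x z) f y' e') x' e
  | _, _ => 0
  end.

Lemma kto_refl (x y : C) (f : khom x y) : kto x y f = f.
Proof.
rewrite /kto; case: pselect => [e|//]; case: pselect => [e'|//].
by rewrite (Prop_irrelevance e erefl) (Prop_irrelevance e' erefl).
Qed.

Lemma kto_src (x x' y y' : C) (f : khom x y) : x <> x' -> kto x' y' f = 0.
Proof. by rewrite /kto; case: pselect. Qed.

Lemma kto_tgt (x x' y y' : C) (f : khom x y) : y <> y' -> kto x' y' f = 0.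
Proof. by rewrite /kto; case: pselect => // ?; case: pselect. Qed.

Lemma kto_linear (x x' y y' : C) : linear (@kto x' y' x y).
Proof.
move=> c f g; have [e|ne] := pselect (x = x');
  last by rewrite !kto_src // scaler0 addr0.
have [e'|ne] := pselect (y = y'); last by rewrite !kto_tgt // scaler0 addr0.
by subst x' y'; rewrite !kto_refl.
Qed.

HB.instance Definition _ (x x' y y' : C) :=
  GRing.isLinear.Build k (khom x y) (khom x' y') *:%R (@kto x' y' x y)
    (@kto_linear x x' y y').

Lemma kto_trans (x x' x'' y y' y'' : C) (f : khom x y) :
  x = x' -> y = y' -> kto x'' y'' (kto x' y' f) = kto x'' y'' f.
Proof. by move=> e e'; subst x' y'; rewrite kto_refl. Qed.

Lemma kto_id (x x' : C) : x = x' -> kto x' x' (kid C x) = kid C x'.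
Proof. by move=> e; subst x'; rewrite kto_refl. Qed.

Lemma kto_comp (x x' y y' z z' : C) (g : khom y z) (f : khom x y) :
  y = y' -> kto x' z' (kcomp g f) = kcomp (kto y' z' g) (kto x' y' f).
Proof.
move=> e; subst y'.
have [e|ne] := pselect (x = x'); last by rewrite !(kto_src _ _ ne) kcomp0r.
have [e'|ne] := pselect (z = z'); last by rewrite !(kto_tgt _ _ ne) kcomp0l.
by subst x' z'; rewrite !kto_refl.
Qed.

End Cast.

Section CastFunctor.
Variables (k : fieldType) (C D : kcat k).

Lemma fmor_kto (F : kfun C D) (x x' y y' : C) (f : khom x y) :
  x = x' -> y = y' -> fmor F (kto x' y' f) = kto (F x') (F y') (fmor F f).
Proof. by move=> e e'; subst x' y'; rewrite !kto_refl. Qed.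

Lemma kfunP (F G : kfun C D) : (forall x, F x = G x) ->
  (forall x y (f : khom x y), kto (G x) (G y) (fmor F f) = fmor G f) -> F = G.
Proof.
case: F G => [o m p1 p2 p3] [o' m' p1' p2' p3'] /= /funext e; subst o'.
by move=> mE; apply: kfun_eq => x y f; rewrite -mE kto_refl.
Qed.

Lemma kfun_eqE (F G : kfun C D) x y (f : khom x y) :
  F = G -> fmor G f = kto (G x) (G y) (fmor F f).
Proof. by move=> ->; rewrite kto_refl. Qed.

End CastFunctor.

Section GroupMorphism.
Variables (G H : groupType) (f : {multiplicative G -> H}).

Lemma group_morph1 : f 1%g = 1%g.
Proof. by apply: (mulgI (f 1%g)); rewrite -gmulfM !mulg1. Qed.

Lemma group_morphV g : f g^-1%g = (f g)^-1%g.
Proof. by apply: (mulgI (f g)); rewrite -gmulfM !mulgV group_morph1. Qed.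

End GroupMorphism.

Section MultiplicativeAction.
Variables (k : fieldType) (G : groupType) (C : kcat k).
Variable r : {multiplicative G -> kaut C}.

Lemma act1_obj x : r 1%g x = x.
Proof. by rewrite group_morph1. Qed.

Lemma actM_obj g h x : r (g * h)%g x = r g (r h x).
Proof. by rewrite gmulfM. Qed.

Lemma actK_obj g x : r g^-1%g (r g x) = x.
Proof. by rewrite -actM_obj mulVg act1_obj. Qed.

Lemma actM_mor g h x y (f : khom x y) :
  fmor (r (g * h)%g) f =
  kto (r (g * h)%g x) (r (g * h)%g y) (fmor (r g) (fmor (r h) f)).
Proof. by rewrite gmulfM kto_refl. Qed.

Lemma act1_mor x y (f : khom x y) :
  fmor (r 1%g) f = kto (r 1%g x) (r 1%g y) f.
Proof. by rewrite group_morph1 kto_refl. Qed.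

End MultiplicativeAction.

(** * Consequences of the universal property of a Galois covering *)

Section MatrixCategory.
Variables (k : fieldType) (C : kcat k).
Local Notation idx := {classic C}.

Lemma eq_big_support (V : zmodType) (s t : seq idx) (f : idx -> V) :
  uniq s -> uniq t ->
  (forall z, f z <> 0 -> z \in s) -> (forall z, f z <> 0 -> z \in t) ->
  \sum_(z <- s) f z = \sum_(z <- t) f z.
Proof.
move=> us ut fs ft.
have H (u : seq idx) : \sum_(z <- u) f z = \sum_(z <- [seq z <- u | f z != 0]) f z.
  rewrite big_filter (bigID (fun z => f z != 0)) /= [X in _ + X]big1 ?addr0 //.
  by move=> z /negPn/eqP.
rewrite H [RHS]H; apply: perm_big; apply: uniq_perm; rewrite ?filter_uniq // => z.
rewrite !mem_filter; case: eqP => //= nz.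
by rewrite (fs _ nz) (ft _ nz).
Qed.

(** The finitely many spanning families have finite support, and every family vanishes outside the
    union of these supports; a morphism [f] is tested as the family concentrated at its target. *)
Lemma findim_support (x : C) : dsum_findim (fun y => khom x y) ->
  {s : seq idx | uniq s & forall y (f : khom x y), f <> 0 -> (y : idx) \in s}.
Proof.
move=> H; apply: cid2; case: H => n [b [bfin bspan]].
have bs (j : 'I_n) : exists s : seq idx, forall y, b j y <> 0 -> y \in s.
  have [s sE] := (@finite_seqP idx _).1 (bfin j).
  exists s => y nz.
  have : [set i | b j i <> 0]%classic y by [].
  by rewrite sE.
have [s sE] := choice bs.
exists (undup (flatten [seq s j | j <- enum 'I_n])); first exact: undup_uniq.
move=> y f nz; rewrite (mem_undup _ (y : idx)).
pose v : forall z : C, khom x z := fun z => kto x z f.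
have vfin : finite_support v.
  apply: (@sub_finite_set _ _ [set (y : idx)]%classic); last exact: finite_set1.
  by move=> z /= vz; apply: contrapT => zy; apply: vz; apply: kto_tgt => e;
    exact: zy.
have [c cE] := bspan _ vfin.
apply/flatten_mapP; apply: contrapT => H; apply: nz.
have := cE y; rewrite /v kto_refl => ->; apply: big1 => j _.
have [->|nz] := pselect (b j y = 0); first by rewrite scaler0.
by exfalso; apply: H; exists j; [rewrite mem_enum|exact: sE].
Qed.

Hypothesis C_findim : forall x : C, dsum_findim (fun y => khom x y).

Definition row_support (x : C) : seq idx := s2val (findim_support (C_findim x)).

Lemma row_support_uniq x : uniq (row_support x).
Proof. exact: (s2valP (findim_support (C_findim x))). Qed.

Lemma mem_row_support x y (f : khom x y) : f <> 0 -> (y : idx) \in row_support x.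
Proof. exact: (s2valP' (findim_support (C_findim x))). Qed.

Definition mx_family := forall x y : C, khom x y.

Definition supported (X Y : C -> Prop) (m : mx_family) :=
  forall x y, m x y <> 0 -> X x /\ Y y.

(** Matrices are indexed by all pairs of objects of [C] and vanish outside [X] times [Y], so that
    the type of the entries does not depend on the subsets [X] and [Y], which are the objects of
    [mx_cat]. *)
Definition mx_hom (X Y : C -> Prop) : Type := {m : mx_family | supported X Y m}.

HB.instance Definition _ X Y := gen_eqMixin (mx_hom X Y).
HB.instance Definition _ X Y := gen_choiceMixin (mx_hom X Y).

Lemma mx_homP X Y (m n : mx_hom X Y) :
  (forall x y, sval m x y = sval n x y) -> m = n.
Proof.
case: m n => [m mP] [n nP] /= mn; apply: eq_exist.
by apply: functional_extensionality_dep => x;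
   apply: functional_extensionality_dep => y; exact: mn.
Qed.

Lemma mx_linP X Y c (m n : mx_hom X Y) :
  supported X Y (fun x y => c *: sval m x y + sval n x y).
Proof.
move=> x y nz; apply: contrapT => H; apply: nz.
have [m0|m1] := pselect (sval m x y = 0); last by have := svalP m _ _ m1.
have [n0|n1] := pselect (sval n x y = 0); last by have := svalP n _ _ n1.
by rewrite m0 n0 scaler0 addr0.
Qed.

Lemma mx_zeroP X Y : supported X Y (fun x y => 0).
Proof. by []. Qed.

Definition mx_zero X Y : mx_hom X Y := exist _ _ (@mx_zeroP X Y).
Definition mx_lin X Y c (m n : mx_hom X Y) : mx_hom X Y :=
  exist _ _ (@mx_linP X Y c m n).
Definition mx_add X Y (m n : mx_hom X Y) := mx_lin 1 m n.
Definition mx_scale X Y c (m : mx_hom X Y) := mx_lin c m (mx_zero X Y).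
Definition mx_opp X Y (m : mx_hom X Y) := mx_scale (-1) m.

Lemma mx_addA X Y : associative (@mx_add X Y).
Proof. by move=> m n p; apply: mx_homP => x y /=; rewrite !scale1r addrA. Qed.
Lemma mx_addC X Y : commutative (@mx_add X Y).
Proof. by move=> m n; apply: mx_homP => x y /=; rewrite !scale1r addrC. Qed.
Lemma mx_add0 X Y : left_id (mx_zero X Y) (@mx_add X Y).
Proof. by move=> m; apply: mx_homP => x y /=; rewrite scaler0 add0r. Qed.
Lemma mx_addN X Y : left_inverse (mx_zero X Y) (@mx_opp X Y) (@mx_add X Y).
Proof.
by move=> m; apply: mx_homP => x y /=; rewrite addr0 scale1r scaleN1r addNr.
Qed.

HB.instance Definition _ X Y := GRing.isZmodule.Build (mx_hom X Y)
  (@mx_addA X Y) (@mx_addC X Y) (@mx_add0 X Y) (@mx_addN X Y).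

Lemma mx_scaleA X Y a b (m : mx_hom X Y) :
  mx_scale a (mx_scale b m) = mx_scale (a * b) m.
Proof. by apply: mx_homP => x y /=; rewrite !addr0 scalerA. Qed.
Lemma mx_scale1 X Y : left_id 1 (@mx_scale X Y).
Proof. by move=> m; apply: mx_homP => x y /=; rewrite addr0 scale1r. Qed.
Lemma mx_scaleDr X Y : right_distributive (@mx_scale X Y) +%R.
Proof.
by move=> a m n; apply: mx_homP => x y /=; rewrite !addr0 !scale1r scalerDr.
Qed.
Lemma mx_scaleDl X Y (m : mx_hom X Y) : {morph (@mx_scale X Y)^~ m : a b / a + b}.
Proof.
by move=> a b; apply: mx_homP => x y /=; rewrite !addr0 scale1r scalerDl.
Qed.

HB.instance Definition _ X Y := GRing.Zmodule_isLmodule.Build k (mx_hom X Y)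
  (@mx_scaleA X Y) (@mx_scale1 X Y) (@mx_scaleDr X Y) (@mx_scaleDl X Y).

Lemma mx_linE X Y c (m n : mx_hom X Y) x y :
  sval (c *: m + n) x y = c *: sval m x y + sval n x y.
Proof. by rewrite /= !addr0 scale1r. Qed.

(** In fact the sum over all [y]: the entry [m x y] vanishes for [y] outside [row_support x]. *)
Definition mx_mul (n m : mx_family) : mx_family := fun x z =>
  \sum_(y <- row_support x) kcomp (n y z) (m x y).

Lemma mx_mulP X Y Z (n : mx_hom Y Z) (m : mx_hom X Y) :
  supported X Z (mx_mul (sval n) (sval m)).
Proof.
move=> x z nz; apply: contrapT => H; apply: nz; apply: big1 => y _.
have [->|m1] := pselect (sval m x y = 0); first by rewrite kcomp0r.
have [->|n1] := pselect (sval n y z = 0); first by rewrite kcomp0l.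
case: H; have [Xx _] := svalP m _ _ m1; have [_ Zz] := svalP n _ _ n1.
by split.
Qed.

Definition mx_comp X Y Z (n : mx_hom Y Z) (m : mx_hom X Y) : mx_hom X Z :=
  exist _ _ (@mx_mulP X Y Z n m).

Lemma mx_compE X Y Z (n : mx_hom Y Z) (m : mx_hom X Y) x z :
  sval (mx_comp n m) x z =
  \sum_(y <- row_support x) kcomp (sval n y z) (sval m x y).
Proof. by []. Qed.

Definition mx_id_fam (X : C -> Prop) : mx_family := fun x y =>
  if `[< X x >] then kto x y (kid C x) else 0.

Lemma mx_idP X : supported X X (mx_id_fam X).
Proof.
move=> x y; rewrite /mx_id_fam; case: asboolP => // Xx nz; split=> //.
by have [<-//|ne] := pselect (x = y); case: nz; rewrite kto_tgt.
Qed.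

Definition mx_id X : mx_hom X X := exist _ _ (@mx_idP X).

Lemma mx_compA W X Y Z (p : mx_hom Y Z) (n : mx_hom X Y) (m : mx_hom W X) :
  mx_comp p (mx_comp n m) = mx_comp (mx_comp p n) m.
Proof.
apply: mx_homP => x w /=; rewrite /mx_mul.
under eq_bigr do rewrite kcomp_sumr.
under [RHS]eq_bigr do rewrite kcomp_suml.
rewrite exchange_big /=; apply: eq_bigr => y _.
under eq_bigr do rewrite kcompA.
(* One side sums [z] over [row_support x], the other over [row_support y]; the index of a nonzero
   term belongs to both ranges. *)
apply: eq_big_support; rewrite ?row_support_uniq // => z nz.
- apply: (@mem_row_support _ _ (kcomp (sval n y z) (sval m x y))) => e.
  by apply: nz; rewrite -kcompA e kcomp0r.
- apply: (@mem_row_support _ _ (sval n y z)) => e.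
  by apply: nz; rewrite e kcomp0r kcomp0l.
Qed.

Lemma mx_sum1 (V : zmodType) (s : seq idx) (f : idx -> V) z :
  uniq s -> (f z <> 0 -> z \in s) -> (forall y, y <> z -> f y = 0) ->
  \sum_(y <- s) f y = f z.
Proof.
move=> us fz f0; have <- : \sum_(y <- [:: z]) f y = f z by rewrite big_seq1.
apply: eq_big_support => // y nz.
- by have [e|/f0//] := pselect (y = z); rewrite e fz // -e.
- by rewrite inE; apply/eqP; apply: contrapT => /f0.
Qed.

Lemma mx_comp1l X Y (m : mx_hom X Y) : mx_comp (mx_id Y) m = m.
Proof.
apply: mx_homP => x y /=; rewrite /mx_mul (@mx_sum1 _ _ _ y) ?row_support_uniq //.
- rewrite /mx_id_fam; case: asboolP => [_|nY]; first by rewrite kto_refl kcomp1l.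
  rewrite kcomp0l; apply: contrapT => /nesym /(svalP m)[_]; exact: nY.
- by move=> nz; apply: (@mem_row_support _ _ (sval m x y)) => e; apply: nz;
  rewrite e kcomp0r.
- move=> z ne; rewrite /mx_id_fam; case: ifP => _; last by rewrite kcomp0l.
  by rewrite kto_tgt ?kcomp0l.
Qed.

Lemma mx_comp1r X Y (m : mx_hom X Y) : mx_comp m (mx_id X) = m.
Proof.
apply: mx_homP => x y /=; rewrite /mx_mul (@mx_sum1 _ _ _ x) ?row_support_uniq //.
- rewrite /mx_id_fam; case: asboolP => [_|nX]; first by rewrite kto_refl kcomp1r.
  rewrite kcomp0r; apply: contrapT => /nesym /(svalP m)[Xx _]; exact: nX.
- by move=> nz; apply: (@mem_row_support _ _ (mx_id_fam X x x)) => e; apply: nz;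
  rewrite e kcomp0r.
- move=> z /nesym ne; rewrite /mx_id_fam; case: ifP => _; last by rewrite kcomp0r.
  by rewrite kto_tgt ?kcomp0r.
Qed.

Lemma mx_comp_linearl X Y Z (m : mx_hom X Y) :
  linear (fun n : mx_hom Y Z => mx_comp n m).
Proof.
move=> c n n'; apply: mx_homP => x z;
  rewrite mx_linE !mx_compE scaler_sumr -big_split.
by apply: eq_bigr => y _; rewrite mx_linE; exact: kcomp_linearl.
Qed.

Lemma mx_comp_linearr X Y Z (n : mx_hom Y Z) :
  linear (fun m : mx_hom X Y => mx_comp n m).
Proof.
move=> c m m'; apply: mx_homP => x z;
  rewrite mx_linE !mx_compE scaler_sumr -big_split.
by apply: eq_bigr => y _; rewrite mx_linE; exact: kcomp_linearr.
Qed.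

Definition mx_cat : kcat k :=
  @KCat k (C -> Prop) (fun X Y => mx_hom X Y) mx_id mx_comp
    mx_compA mx_comp1l mx_comp1r mx_comp_linearl mx_comp_linearr.

Lemma sval_kto (X X' Y Y' : mx_cat) (m : khom X Y) :
  X = X' -> Y = Y' -> sval (kto X' Y' m : mx_hom X' Y') = sval (m : mx_hom X Y).
Proof. by move=> e e'; subst X' Y'; rewrite kto_refl. Qed.

End MatrixCategory.

(** * The orbit functor from [C] to matrices *)

Section OrbitFunctor.
Variables (k : fieldType) (C : kcat k) (G : groupType).
Variable r : {multiplicative G -> kaut C}.
Hypothesis C_findim : forall x : C, dsum_findim (fun y => khom x y).
Hypothesis r_free : forall (g : G) (x : C), r g x = x -> g = 1%g.

Lemma act_inj g h (x : C) : r g x = r h x -> g = h.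
Proof.
move=> e; apply: (mulgI h^-1%g); rewrite mulVg; apply: (r_free (x := x)).
by rewrite actM_obj e actK_obj.
Qed.

Definition orbit (x : C) : C -> Prop := fun x' => exists g, x' = r g x.

(** The formal sum of all translates of [f]. As the action is free, [x'] determines the [g] with
    [x' = r g x], and in that row only column [r g y] can be nonzero. *)
Definition translates (x y : C) (f : khom x y) : mx_family C := fun x' y' =>
  match pselect (orbit x x') with
  | left h => kto x' y' (fmor (r (projT1 (boolp.cid h))) f)
  | right _ => 0
  end.

Lemma translatesE x y (f : khom x y) g x' y' :
  x' = r g x -> translates f x' y' = kto x' y' (fmor (r g) f).
Proof.
move=> e; rewrite /translates; case: pselect => [h|]; last by case; exists g.
by case: (boolp.cid h) => g' /=; rewrite e => /act_inj ->.
Qed.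

Lemma translates_out x y (f : khom x y) x' y' :
  ~ orbit x x' -> translates f x' y' = 0.
Proof. by rewrite /translates; case: pselect. Qed.

Lemma translatesP x y (f : khom x y) :
  supported (orbit x) (orbit y) (translates f).
Proof.
move=> x' y'; have [[g e]|o] := pselect (orbit x x');
  last by rewrite translates_out.
rewrite (translatesE _ _ e) => nz; split; first by exists g.
by exists g; apply: contrapT => /nesym ne; apply: nz; exact: kto_tgt.
Qed.

Definition orbit_mor x y (f : khom x y) : mx_hom (orbit x) (orbit y) :=
  exist _ _ (@translatesP x y f).

Lemma orbit_mor_linear x y : linear (@orbit_mor x y).
Proof.
move=> c f f'; apply: mx_homP => x' y'; rewrite mx_linE /=.
have [[g e]|o] := pselect (orbit x x').
  by rewrite !(translatesE _ _ e) fmor_linear kto_linear.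
by rewrite !translates_out // scaler0 addr0.
Qed.

Lemma orbit_mor_id x : orbit_mor (kid C x) = mx_id (orbit x).
Proof.
apply: mx_homP => x' y' /=; rewrite /mx_id_fam; case: asboolP => [[g e]|o].
  by rewrite (translatesE _ _ e) fmor_id; subst x'.
by rewrite translates_out.
Qed.

Lemma orbit_mor_comp x y z (h : khom y z) (f : khom x y) :
  orbit_mor (kcomp h f) = mx_comp C_findim (orbit_mor h) (orbit_mor f).
Proof.
apply: mx_homP => x' z'; rewrite mx_compE /=.
have [[g e]|o] := pselect (orbit x x'); last first.
  rewrite translates_out // big1 // => y' _.
  by rewrite (translates_out f) // kcomp0r.
rewrite (@mx_sum1 _ _ _ _ _ (r g y)) ?row_support_uniq //.
- rewrite !(translatesE _ _ e) (translatesE _ _ (erefl (r g y))) fmor_comp.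
  exact: kto_comp.
- move=> nz; apply: (@mem_row_support _ _ _ _ _ (translates f x' (r g y))) => e0.
  by apply: nz; rewrite e0 kcomp0r.
- move=> y' /nesym ne; rewrite [X in kcomp _ X](translatesE _ _ e).
  by rewrite kto_tgt // kcomp0r.
Qed.

(** This functor is [G]-invariant, hence factors through the covering, and yet it distinguishes
    orbits and remembers every morphism. *)
Definition orbit_fun : kfun C (mx_cat C_findim) :=
  @KFun k C (mx_cat C_findim) orbit orbit_mor
    orbit_mor_linear orbit_mor_id orbit_mor_comp.

Lemma orbit_act g x : orbit (r g x) = orbit x.
Proof.
apply/funext => x'; apply/propext; split=> -[h ->].
  by exists (h * g)%g; rewrite actM_obj.
by exists (h * g^-1)%g; rewrite actM_obj actK_obj.
Qed.

Lemma orbit_fun_act g : kfun_comp orbit_fun (r g) = orbit_fun.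
Proof.
apply: kfunP => [x|x y f]; first exact: orbit_act.
apply: mx_homP => x' y'; rewrite sval_kto /=; try exact: orbit_act.
have [[h e]|o] := pselect (orbit (r g x) x'); last first.
  by rewrite !translates_out // -(orbit_act g).
rewrite (translatesE _ _ e) (@translatesE _ _ _ (h * g)%g) ?actM_obj //.
by rewrite actM_mor kto_trans ?actM_obj.
Qed.

End OrbitFunctor.

Section GaloisEntries.
Variables (k : fieldType) (C A : kcat k) (G : groupType).
Variables (r : {multiplicative G -> kaut C}) (F : kfun C A).
Hypothesis C_findim : forall x : C, dsum_findim (fun y => khom x y).
Hypothesis galF : galois_covering r F.

(** The functor that [orbit_fun] induces on the base maps [F z] to the orbit of [z]. *)
Lemma galois_trans x x' : F x = F x' -> exists g, x' = r g x.
Proof.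
case: galF => fr _ univ e.
have [F'' [F''E _]] := univ _ (orbit_fun C_findim fr) (orbit_fun_act C_findim fr).
have oE z : F'' (F z) = orbit r z by have :=
  congr1 (fun H => H z) (congr1 (@fobj _ _ _) F''E).
have : orbit r x x' by rewrite -oE e oE; exists 1%g; rewrite act1_obj.
by [].
Qed.

(* The entries of the matrix which the functor induced by [orbit_fun] assigns
   to a morphism of the base. *)
Lemma galois_entries : exists E : forall x y : A, khom x y -> forall a b : C, khom a b,
  [/\ forall x y a b, linear (fun f : khom x y => E x y f a b),
      forall a b (v : khom a b), E _ _ (fmor F v) a b = v
    & forall a b (v : khom a b) b', b' <> b -> E _ _ (fmor F v) a b' = 0].
Proof.
case: galF => fr _ univ.
have [F'' [F''E _]] := univ _ (orbit_fun C_findim fr) (orbit_fun_act C_findim fr).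
have EE a b (v : khom a b) b' :
    sval (fmor F'' (fmor F v) : mx_hom _ _) a b' = kto a b' v.
  have := kfun_eqE v (esym F''E); rewrite /= => ->.
  have oE z : F'' (F z) = orbit r z
    by have := congr1 (fun H => H z) (congr1 (@fobj _ _ _) F''E).
  (* Row [a] belongs to the translate by 1, so [v] itself is read there. *)
  rewrite sval_kto // /= (@translatesE _ _ _ _ _ _ _ _ 1%g) ?act1_obj //.
  by rewrite act1_mor kto_trans ?act1_obj.
exists (fun x y f a b => sval (fmor F'' f : mx_hom _ _) a b); split.
- by move=> x y a b c f g; rewrite fmor_linear mx_linE.
- by move=> a b v; rewrite EE kto_refl.
- by move=> a b v b' ne; rewrite EE kto_tgt // => /esym.
Qed.

End GaloisEntries.

(** * The image of a functor, as a category *)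

Section ImageCategory.
Variables (k : fieldType) (C A : kcat k) (F : kfun C A).

(** Finite sums of images of morphisms of [C]; the lifts [a] and [b] of the end points may change
    from one summand to the next. *)
Inductive fspan (x y : A) : khom x y -> Prop :=
| fspan0 : fspan (0 : khom x y)
| fspanD a b (v : khom a b) f : F a = x -> F b = y -> fspan f ->
    fspan (kto x y (fmor F v) + f).

Lemma fspan_lin x y c (f g : khom x y) :
  fspan f -> fspan g -> fspan (c *: f + g).
Proof.
elim=> [|a b v {}f ex ey _ IH] gs; first by rewrite scaler0 add0r.
by rewrite scalerDr -addrA -linearZ -fmorZ; apply: fspanD => //; exact: IH.
Qed.

Lemma fspan_kto x x' y y' (f : khom x y) : x = x' -> y = y' ->
  fspan f -> fspan (kto x' y' f).
Proof. by move=> e e'; subst x' y'; rewrite kto_refl. Qed.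

Lemma fspan_fmor a b (v : khom a b) : fspan (fmor F v).
Proof. by rewrite -[fmor F v]addr0 -[fmor F v]kto_refl; apply: fspanD;
  last exact: fspan0. Qed.

Lemma fspan_submod x y :
  GRing.submod_closed (fun f : khom x y => `[< fspan f >] : bool).
Proof.
split=> [|c f g /asboolP fs /asboolP gs]; first by apply/asboolP; exact: fspan0.
by apply/asboolP; exact: fspan_lin.
Qed.

Definition fspan_pred x y : {pred khom x y} := fun f : khom x y => `[< fspan f >].

HB.instance Definition _ x y :=
  GRing.isSubmodClosed.Build k (khom x y) (@fspan_pred x y) (@fspan_submod x y).

Definition image_hom (x y : A) : Type := {f : khom x y | f \in @fspan_pred x y}.

HB.instance Definition _ x y := SubChoice.on (image_hom x y).
HB.instance Definition _ x y := [SubChoice_isSubLmodule of image_hom x y by <:].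

Definition image_mk x y (f : khom x y) (fP : f \in @fspan_pred x y) :
  image_hom x y := exist _ f fP.

Lemma image_homP x y (f : image_hom x y) : fspan (val f).
Proof. exact/asboolP/(valP f). Qed.

Definition image_obj : Type := {x : A | exists a, F a = x}.

Lemma fspan_id (x : image_obj) : kid A (sval x) \in @fspan_pred (sval x) (sval x).
Proof.
case: x => x xP /=; apply/asboolP; case: xP => a <-.
by rewrite -(fmor_id F); exact: fspan_fmor.
Qed.

Hypothesis fspan_comp : forall x y z (g : khom y z) (f : khom x y),
  fspan g -> fspan f -> fspan (kcomp g f).

Definition image_id (x : image_obj) : image_hom (sval x) (sval x) :=
  image_mk (fspan_id x).

Lemma image_compP x y z (g : image_hom y z) (f : image_hom x y) :
  kcomp (val g) (val f) \in @fspan_pred x z.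
Proof. by apply/asboolP/fspan_comp; exact: image_homP. Qed.

Definition image_comp x y z (g : image_hom y z) (f : image_hom x y) :
  image_hom x z := image_mk (image_compP g f).

Definition image_cat : kcat k.
Proof.
refine (@KCat k image_obj (fun x y => image_hom (sval x) (sval y)) image_id
  (fun x y z => @image_comp _ _ _) _ _ _ _ _).
- by move=> w x y z h g f; apply: val_inj; exact: kcompA.
- by move=> x y f; apply: val_inj; exact: kcomp1l.
- by move=> x y f; apply: val_inj; exact: kcomp1r.
- by move=> x y z f c g g'; apply: val_inj; exact: kcomp_linearl.
- by move=> x y z g c f f'; apply: val_inj; exact: kcomp_linearr.
Defined.

Lemma val_kto (X Y X' Y' : image_cat) (u : khom X Y) : X = X' -> Y = Y' ->
  val (kto X' Y' u : image_hom (sval X') (sval Y')) =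
  kto (sval X') (sval Y') (val (u : image_hom (sval X) (sval Y))).
Proof. by move=> e e'; subst X' Y'; rewrite !kto_refl. Qed.

Definition image_incl : kfun image_cat A.
Proof. by refine (@KFun k image_cat A (fun x : image_obj => sval x) (fun x y (f : image_hom _ _) => val f) _ _ _). Defined.

Lemma fmor_imageP a b (v : khom a b) : fmor F v \in @fspan_pred (F a) (F b).
Proof. by apply/asboolP; exact: fspan_fmor. Qed.

Definition image_corestr : kfun C image_cat.
Proof.
refine (@KFun k C image_cat (fun a => exist _ (F a) (ex_intro _ a erefl))
  (fun a b v => image_mk (fmor_imageP v)) _ _ _).
- by move=> x y c f g; apply: val_inj; exact: fmor_linear.
- by move=> x; apply: val_inj; exact: fmor_id.
- by move=> x y z g f; apply: val_inj; exact: fmor_comp.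
Defined.

Lemma image_incl_corestr : kfun_comp image_incl image_corestr = F.
Proof. by apply: kfunP => // x y f; rewrite kto_refl. Qed.

End ImageCategory.

Section GaloisConsequences.
Variables (k : fieldType) (C A : kcat k) (G : groupType).
Variables (r : {multiplicative G -> kaut C}) (F : kfun C A).
Hypothesis F_act : forall g : G, kfun_comp F (r g) = F.

Lemma act_base g x : F (r g x) = F x.
Proof. by rewrite -[in RHS](F_act g). Qed.

Lemma act_base_mor g x y (f : khom x y) :
  fmor F (fmor (r g) f) = kto (F (r g x)) (F (r g y)) (fmor F f).
Proof. by have := kfun_eqE f (esym (F_act g)). Qed.

Hypothesis F_trans : forall x x' : C, F x = F x' -> exists g, x' = r g x.

(** Two summands [fmor F w] and [fmor F v] meet in [A], but [w] need not start where [v] ends;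
    transitivity on the fibres provides a translate of [w] that does. *)
Lemma fspan_comp x y z (g : khom y z) (f : khom x y) :
  fspan F g -> fspan F f -> fspan F (kcomp g f).
Proof.
elim=> [|b' c w {}g ey ez _ IHg] fs; first by rewrite kcomp0l; exact: fspan0.
rewrite kcompDl -[kcomp _ f]scale1r; apply: fspan_lin; last exact: IHg.
elim: fs => [|a b v {IHg}f ex ey' _ IHf]; first by rewrite kcomp0r; exact: fspan0.
rewrite kcompDr; have [h e] := F_trans (etrans ey (esym ey')).
have -> : kcomp (kto y z (fmor F w)) (kto x y (fmor F v)) =
    kto x z (fmor F (kcomp (kto b (r h c) (fmor (r h) w)) v)).
  rewrite fmor_comp (@kto_comp _ _ _ x _ y _ z) //; congr kcomp.
  rewrite fmor_kto // kto_trans ?act_base // ?e ?act_base //.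
  by rewrite act_base_mor kto_trans ?act_base.
by apply: fspanD; rewrite ?act_base.
Qed.

Hypothesis F_univ : forall (C'' : kcat k) (F' : kfun C C''),
  (forall g : G, kfun_comp F' (r g) = F') ->
  exists! F'' : kfun A C'', kfun_comp F'' F = F'.

(** The corestriction of [F] to its image is invariant and so induces [I]. The inclusion after [I]
    and the identity both give [F] when composed with [F], so they coincide by uniqueness. *)
Lemma galois_section : exists I : kfun A (image_cat fspan_comp),
  kfun_comp (image_incl fspan_comp) I = kfun_id A.
Proof.
have H g : kfun_comp (image_corestr fspan_comp) (r g) = image_corestr fspan_comp.
  apply: kfunP => [x|x y f].
    by apply: eq_exist; exact: act_base.
  apply: val_inj; apply: etrans (val_kto _ _ _) _; try by apply: eq_exist;
    exact: act_base.
  by rewrite /= act_base_mor kto_trans ?act_base // kto_refl.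
have [I [IE _]] := F_univ H; exists I.
have [J [_ Juniq]] := F_univ F_act.
rewrite -(Juniq (kfun_id A)) ?kfun_comp1l //; apply/esym/Juniq.
by rewrite -kfun_compA IE image_incl_corestr.
Qed.

Lemma galois_surj y : exists x, F x = y.
Proof.
have [I IE] := galois_section.
have <- : sval (I y : image_obj F) = y.
  by have := congr1 (fun H => H y) (congr1 (@fobj _ _ _) IE).
by case: (I y).
Qed.

Lemma galois_span x y (f : khom x y) : fspan F f.
Proof.
have [I IE] := galois_section.
have := kfun_eqE f IE; rewrite /= => ->.
have eo z : sval (I z : image_obj F) = z.
  by have := congr1 (fun H => H z) (congr1 (@fobj _ _ _) IE).
by apply: fspan_kto; [exact: eo|exact: eo|exact: image_homP].
Qed.

End GaloisConsequences.

(** Injectivity of the map to the morphisms [F a -> y] from the direct sum of the spaces of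
    morphisms [a -> z], where [z] runs over the fibre of [y]. *)
Definition fibre_independent (k : fieldType) (C A : kcat k) (F : kfun C A) :=
  forall (a : C) (y : A) (s : seq {classic C}) (v : forall z : C, khom a z),
    uniq s -> (forall z : C, (z : {classic C}) \in s -> F z = y) ->
    \sum_(z <- s) kto (F a) y (fmor F (v z)) = 0 ->
    forall z : C, (z : {classic C}) \in s -> v z = 0.

(** * A criterion for being a Galois covering *)

Section Converse.
Variables (k : fieldType) (C A : kcat k) (G : groupType).
Variables (r : {multiplicative G -> kaut C}) (F : kfun C A).
Hypothesis F_act : forall g : G, kfun_comp F (r g) = F.
Hypothesis F_surj : forall y, exists x, F x = y.
Hypothesis F_trans : forall x x' : C, F x = F x' -> exists g, x' = r g x.
Hypothesis F_span : forall x y (f : khom x y), fspan F f.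
Hypothesis F_indep : fibre_independent F.

Section Induced.
Variables (C'' : kcat k) (F' : kfun C C'').
Hypothesis F'_act : forall g : G, kfun_comp F' (r g) = F'.

Definition induced_obj (y : A) : C'' := F' (projT1 (boolp.cid (F_surj y))).
Local Notation o := induced_obj.

Lemma induced_objE a y : F a = y -> F' a = o y.
Proof.
rewrite /o; case: (boolp.cid _) => b /= <- /F_trans [g ->].
by rewrite (act_base F'_act).
Qed.

(** The graph of the induced functor on morphisms: both components are sums over the same lifts. It
    is total because images span, and single-valued by [induced_rel_fun]. *)
Inductive induced_rel (x y : A) : khom x y -> khom (o x) (o y) -> Prop :=
| induced_rel0 : @induced_rel x y 0 0
| induced_relD a b (v : khom a b) f h : F a = x -> F b = y -> induced_rel f h ->
    induced_rel (kto x y (fmor F v) + f) (kto (o x) (o y) (fmor F' v) + h).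

Lemma induced_rel_lin x y c (f f' : khom x y) h h' :
  induced_rel f h -> induced_rel f' h' -> induced_rel (c *: f + f') (c *: h + h').
Proof.
elim=> [|a b v {}f {}h ex ey _ IH] gs; first by rewrite !scaler0 !add0r.
rewrite !scalerDr -!addrA -!linearZ -!fmorZ.
by apply: induced_relD => //; exact: IH.
Qed.

Lemma induced_rel_total x y (f : khom x y) : exists h, induced_rel f h.
Proof.
elim: (F_span f) => [|a b v {}f ex ey _ [h fh]]; first by exists 0;
  exact: induced_rel0.
by eexists; apply: induced_relD ex ey fh.
Qed.

Lemma induced_rel_fmor x y a b (v : khom a b) : F a = x -> F b = y ->
  induced_rel (kto x y (fmor F v)) (kto (o x) (o y) (fmor F' v)).
Proof.
move=> ex ey; rewrite -[X in induced_rel X]addr0 -[X in induced_rel _ X]addr0.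
by apply: induced_relD ex ey _; exact: induced_rel0.
Qed.

Lemma induced_rel_comp x y z (g : khom y z) (f : khom x y) hg hf :
  induced_rel g hg -> induced_rel f hf -> induced_rel (kcomp g f) (kcomp hg hf).
Proof.
elim=> [|b' c w {}g {}hg ey ez _ IHg] fs; first by rewrite !kcomp0l;
  exact: induced_rel0.
rewrite !kcompDl -[kcomp _ f]scale1r -[kcomp _ hf]scale1r.
apply: induced_rel_lin; last exact: IHg.
elim: fs => [|a b v {IHg}f {}hf ex ey' _ IHf]; first by rewrite !kcomp0r;
  exact: induced_rel0.
rewrite !kcompDr; have [h e] := F_trans (etrans ey (esym ey')).
(* The same translation of [w] is needed for [F] and for [F'], hence the statement for any invariant
   functor. *)
have H (D : kcat k) (H : kfun C D) (X Y Z : D) : (forall g, kfun_comp H (r g) = H) ->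
    H b = Y -> H b' = Y ->
    kcomp (kto Y Z (fmor H w)) (kto X Y (fmor H v)) =
    kto X Z (fmor H (kcomp (kto b (r h c) (fmor (r h) w)) v)).
  move=> H_act eb eb'; rewrite fmor_comp (@kto_comp _ _ _ X _ Y _ Z) //;
    congr kcomp.
  rewrite fmor_kto // kto_trans ?(act_base H_act) // ?e ?(act_base H_act) //.
  by rewrite (act_base_mor H_act) kto_trans ?(act_base H_act).
rewrite (H _ F) // (H _ F') //; try exact: induced_objE.
by apply: induced_relD; rewrite ?(act_base F_act).
Qed.

(** Each summand can be translated so as to start at [a0], and summands with the same target are
    collected; this is the form to which [fibre_independent] applies. *)
Lemma induced_rel_normal x y (f : khom x y) h (a0 : C) : F a0 = x -> induced_rel f h ->
  exists (s : seq {classic C}) (v : forall z : C, khom a0 z),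
    [/\ uniq s, forall z : C, (z : {classic C}) \in s -> F z = y,
        forall z : C, (z : {classic C}) \notin s -> v z = 0,
        f = \sum_(z <- s) kto x y (fmor F (v z))
      & h = \sum_(z <- s) kto (o x) (o y) (fmor F' (v z))].
Proof.
move=> e0; elim=> [|a b w {}f {}h ea eb _ [s [v [us sF sv -> ->]]]].
  by exists [::], (fun z => 0); split; rewrite ?big_nil.
have [g eg] := F_trans (etrans ea (esym e0)).
pose b' : {classic C} := r g b; pose w' := kto a0 b' (fmor (r g) w).
pose s' : seq {classic C} := if b' \in s then s else b' :: s.
have us' : uniq s' by rewrite /s'; case: ifPn => // nb; rewrite /= nb us.
have b's' : b' \in s' by rewrite /s'; case: ifP => // _; rewrite mem_head.
exists s', (fun z => v z + kto a0 z w'); split => //.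
- move=> z; rewrite /s'; case: ifP => _; first exact: sF.
  by rewrite inE => /orP[/eqP ->|/sF//]; rewrite act_base.
- move=> z zs'; rewrite sv; last first.
    by apply: contra zs'; rewrite /s'; case: ifP => // _; rewrite inE orbC => ->.
  rewrite add0r kto_tgt // => e; move: zs'; rewrite -e; exact/negP/negPn.
(* The two equations left, for [F] and for [F'], have one proof: the added family is concentrated at
   [b']. *)
all: set H := (X in fmor X _); set X := (Y in kto Y _ _); set Y := (Z in kto _ Z _).
all: have HD : \sum_(z <- s') kto X Y (fmor H (v z + kto a0 z w')) =
  \sum_(z <- s') kto X Y (fmor H (v z)) +
  \sum_(z <- s') kto X Y (fmor H (kto a0 z w'))
  by rewrite -big_split; apply: eq_bigr => z _; rewrite fmorD linearD.
all: rewrite HD addrC; congr (_ + _).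
1,3: rewrite /s'; case: ifPn => // nb;
  by rewrite big_cons sv // fmor0 linear0 add0r.
all: rewrite (@mx_sum1 _ _ _ _ _ b') // => [|z ne];
  last by rewrite [kto a0 z w']kto_tgt ?fmor0 ?linear0 // => /esym.
all: rewrite kto_refl /w' fmor_kto // ?eg //.
- by rewrite kto_trans ?(act_base_mor F_act) ?kto_trans ?(act_base F_act).
- by rewrite kto_trans ?(act_base_mor F'_act) ?kto_trans ?(act_base F'_act).
Qed.

(** By linearity 0 is related to the difference of [h] and [h']; in a normal form of 0, independence
    makes every lift vanish. *)
Lemma induced_rel_fun x y (f : khom x y) h h' :
  induced_rel f h -> induced_rel f h' -> h = h'.
Proof.
move=> fh fh'; have [a0 e0] := F_surj x.
have := induced_rel_lin (-1) fh fh'; rewrite !scaleN1r !(addrC (- _)) subrr => H.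
have [s [v [us sF _ /esym f0 hE]]] := induced_rel_normal e0 H.
apply/esym/eqP; rewrite -subr_eq0 hE big1_seq // => z /= zs.
rewrite -e0 in f0; by rewrite (F_indep us sF f0 zs) fmor0 linear0.
Qed.

Definition induced_mor x y (f : khom x y) : khom (o x) (o y) :=
  projT1 (boolp.cid (induced_rel_total f)).

Lemma induced_morP x y (f : khom x y) h : induced_rel f h -> induced_mor f = h.
Proof. by rewrite /induced_mor;
  case: (boolp.cid _) => h' /= fh' /(induced_rel_fun fh'). Qed.

Lemma induced_mor_rel x y (f : khom x y) : induced_rel f (induced_mor f).
Proof. by rewrite /induced_mor; case: (boolp.cid _). Qed.

Definition induced_fun : kfun A C''.
Proof.
refine (@KFun k A C'' o induced_mor _ _ _).
- move=> x y c f g; apply: induced_morP.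
  by apply: induced_rel_lin; exact: induced_mor_rel.
- move=> x; apply: induced_morP; have [a ea] := F_surj x.
  have := induced_rel_fmor (kid C a) ea ea.
  by rewrite !fmor_id !kto_id //; exact: induced_objE.
- by move=> x y z g f; apply: induced_morP; apply: induced_rel_comp;
  exact: induced_mor_rel.
Defined.

Lemma induced_funE : kfun_comp induced_fun F = F'.
Proof.
apply: kfunP => [x|x y f]; first by apply/esym/induced_objE.
rewrite /= (induced_morP (h := kto (o (F x)) (o (F y)) (fmor F' f))).
  by rewrite kto_trans ?kto_refl //; exact: induced_objE.
by have := induced_rel_fmor f erefl erefl; rewrite kto_refl.
Qed.

Lemma induced_fun_uniq (H : kfun A C'') : kfun_comp H F = F' -> induced_fun = H.
Proof.
move=> HF; have oH y : o y = H y.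
  have [a <-] := F_surj y; rewrite -(induced_objE (erefl (F a))).
  by rewrite -HF.
apply: kfunP => // x y f;
  rewrite /= (induced_morP (h := kto (o x) (o y) (fmor H f))).
  by rewrite kto_trans ?kto_refl.
elim: (F_span f) => [|a b v {}f ex ey _ IH].
  by rewrite fmor0 linear0; exact: induced_rel0.
have -> : kto (o x) (o y) (fmor H (kto x y (fmor F v) + f)) =
    kto (o x) (o y) (fmor F' v) + kto (o x) (o y) (fmor H f);
      last exact: induced_relD ex ey IH.
rewrite fmorD linearD /=; congr (_ + _).
rewrite fmor_kto // kto_trans ?ex ?ey // (kfun_eqE v HF) /= kto_trans //;
  by rewrite -HF.
Qed.

End Induced.

(** Spanning gives the existence of values of the induced functor and its uniqueness; independence
    makes the values well defined. *)
Lemma galois_of_span : (forall (g : G) (x : C), r g x = x -> g = 1%g) ->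
  galois_covering r F.
Proof.
move=> fr; split=> // C'' F' F'_act; exists (induced_fun F'_act); split.
  exact: induced_funE.
exact: induced_fun_uniq.
Qed.

End Converse.

(** * Path categories *)

Section FreeModuleSupport.
Variables (k : fieldType) (K : choiceType).

Lemma malg_lin_id (f : {malg k[K]}) : malg_lin (fun w => << w >> : {malg k[K]}) f = f.
Proof. by move: f; apply: malg_lin_ext => // [|w];
  [exact: malg_lin_linear|exact: malg_linU]. Qed.

Lemma mcoeff_malg_lin (K' : choiceType) (h : K -> {malg k[K']}) (f : {malg k[K]}) v :
  (malg_lin h f)@_v = \sum_(w <- msupp f) f@_w * (h w)@_v.
Proof. by rewrite /malg_lin raddf_sum; apply: eq_bigr => w _;
  rewrite -[LHS]/((_ *: _)@__) mcoeffZ. Qed.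

Lemma msupp_malg_lin (K' : choiceType) (h : K -> {malg k[K']}) (f : {malg k[K]}) v :
  v \in msupp (malg_lin h f) -> exists2 w, w \in msupp f & v \in msupp (h w).
Proof.
rewrite -mcoeff_neq0 mcoeff_malg_lin => nz; apply: contrapT => H.
move/eqP: nz; apply; apply: big1_seq => w /= wf.
have [|vw] := boolP (v \in msupp (h w)); first by move=> vw; case: H; exists w.
by rewrite (mcoeff_outdom vw) mulr0.
Qed.

Lemma mcoeff_malg_lin_inj (K' : choiceType) (h : K -> K') (f : {malg k[K]}) w :
  injective h -> (malg_lin (fun w => << h w >> : {malg k[K']}) f)@_(h w) = f@_w.
Proof.
move=> h_inj; rewrite -[in RHS](malg_lin_id f) !mcoeff_malg_lin.
by apply: eq_bigr => v _; rewrite !mcoeffU (inj_eq h_inj).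
Qed.

Lemma mcoeff_sum (J : Type) (s : seq J) (F : J -> {malg k[K]}) w :
  (\sum_(i <- s) F i)@_w = \sum_(i <- s) (F i)@_w.
Proof. exact: raddf_sum. Qed.

Lemma mcoeffB_self (f : {malg k[K]}) w : (f - f@_w *: << w >>)@_w = 0.
Proof. by rewrite mcoeffB mcoeffZ mcoeffUU mulr1 subrr. Qed.

Definition malg_filter (P : pred K) (f : {malg k[K]}) : {malg k[K]} :=
  malg_lin (fun w => if P w then << w >> else 0) f.

Lemma mcoeff_filter P (f : {malg k[K]}) w :
  (malg_filter P f)@_w = if P w then f@_w else 0.
Proof.
rewrite mcoeff_malg_lin; have [Pw|nPw] := boolP (P w).
  rewrite -[in RHS](malg_lin_id f) mcoeff_malg_lin; apply: eq_bigr => v _.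
  case: ifPn => // nPv; rewrite mcoeff0 mcoeffU.
  by case: eqP => // e; rewrite e Pw in nPv.
apply: big1 => v _; case: ifPn => [Pv|_]; last by rewrite mcoeff0 mulr0.
by rewrite mcoeffU; case: eqP => [e|_]; rewrite ?mulr0 //; rewrite -e Pv in nPw.
Qed.

Lemma msupp_filter P (f : {malg k[K]}) w :
  (w \in msupp (malg_filter P f)) = P w && (w \in msupp f).
Proof.
by rewrite -!mcoeff_neq0 mcoeff_filter; case: (P w); rewrite //= eqxx.
Qed.

Lemma malg_filterC P (f : {malg k[K]}) :
  f = malg_filter P f + malg_filter (predC P) f.
Proof.
apply/malgP => w; rewrite !mcoeffD !mcoeff_filter /=.
by case: (P w); rewrite /= ?add0r ?addr0.
Qed.

(** Used on a representative of [u a - chi a]: [P] selects the lowest length and [R] the degree of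
    [a]. *)
Lemma malg_filter_split P R (f : {malg k[K]}) :
  f = malg_filter (fun w => P w && ~~ R w) f + malg_filter (fun w => P w && R w) f +
      malg_filter (fun w => ~~ P w) f.
Proof.
apply/malgP => w; rewrite !mcoeffD !mcoeff_filter.
by case: (P w); case: (R w); rewrite /= ?add0r ?addr0.
Qed.

End FreeModuleSupport.

Section PathLemmas.
Variable Q : quiver.

Lemma qpath_ind (P : forall x y : vert Q, qpath x y -> Prop) :
  (forall x, P x x (pid x)) ->
  (forall a y (q : qpath (tgt a) y), P _ _ q -> P _ _ (pcomp q (parr a))) ->
  forall x y (p : qpath x y), P x y p.
Proof.
move=> P0 PS x y [s ps]; elim: s x ps => [|a s IH] x ps.
  by have e := eqP ps; subst y; rewrite (_ : exist _ _ _ = pid x) //;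
    exact: val_inj.
have /andP[/eqP e ps'] := ps; subst x.
have -> : exist _ (a :: s) ps = pcomp (exist _ s ps' : @qpath Q _ y) (parr a) by exact: val_inj.
exact: PS.
Qed.

Lemma pcomp_injl x y z (p : @qpath Q x y) : injective (fun q : qpath y z => pcomp q p).
Proof. by move=> q q' /(congr1 val) /= /eqP; rewrite eqseq_cat // eqxx => /eqP e;
  apply: val_inj; exact: e. Qed.

Lemma pcomp_injr x y z (q : @qpath Q y z) : injective (fun p : qpath x y => pcomp q p).
Proof.
move=> p p' /(congr1 val) /= e; apply: val_inj; apply/eqP.
have es : size (val p) = size (val p').
  by have /(congr1 size) := e; rewrite !size_cat => /addIn.
by have := eqseq_cat (val q) (val q) es; rewrite e !eqxx andbT => <-.
Qed.

Lemma is_path_tail (x : vert Q) (s s' : seq (arr Q)) y :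
  is_path x (s ++ s') y -> exists2 z, is_path x s z & is_path z s' y.
Proof.
elim: s x => [|a s IH] x /=; first by exists x.
by case/andP=> -> /IH.
Qed.

Hypothesis Q_acyclic : no_oriented_cycle Q.

Lemma acyclic_nil (x : vert Q) s : is_path x s x -> s = [::] :> seq (arr Q).
Proof. by move=> ps; have /size0nil := Q_acyclic (exist _ s ps : qpath x x). Qed.

Lemma acyclic_uniq (x : vert Q) s y : is_path x s y -> uniq (s : seq (arr Q)).
Proof.
elim: s x => [//|a s IH] x /= /andP[/eqP e ps]; rewrite (IH _ ps) andbT.
apply/negP => /splitPr sE; case: s / sE ps {IH} => s1 s2 ps.
have [z pz] := is_path_tail ps; rewrite /= => /andP[/eqP ez _].
by have := @acyclic_nil (src a) (a :: s1); rewrite /= eqxx ez => /(_ pz).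
Qed.

(** Otherwise the first arrow of [b] is [a], and the rest of [b] is a nontrivial path from [tgt a]
    to itself. *)
Lemma acyclic_prefix (a : arr Q) y z (b : qpath (src a) (tgt a)) (w : qpath (tgt a) y)
    (q : qpath z y) :
  (2 <= plen b)%N -> val b ++ val w <> a :: val q.
Proof.
case: b => -[|c [|c' s]] //= ps _ [e _]; move: ps; rewrite e eqxx /=.
by move/(@acyclic_nil _ (c' :: s)).
Qed.

Hypothesis arr_finite : finite_set [set: arr Q]%classic.

(** No path repeats an arrow, so its length is at most the number of arrows. *)
Lemma acyclic_bound : exists N, forall x y (p : @qpath Q x y), (plen p < N)%N.
Proof.
have [s sE] := (@finite_seqP _ _).1 arr_finite.
exists (size s).+1 => x y p; rewrite ltnS; apply: uniq_leq_size.
  exact: acyclic_uniq (valP p).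
move=> a _; have : [set: arr Q]%classic a by [].
by rewrite sE.
Qed.

End PathLemmas.

Section PathFunctor.
Variables (k : fieldType) (Q : quiver) (D : kcat k) (o : vert Q -> D).
Variable u : forall a : arr Q, khom (o (src a)) (o (tgt a)).

(** The recursion runs over a bare list, so transports replace the proof that the list is a path;
    along a path from [x] to [y] they are identities. *)
Fixpoint pev (s : seq (arr Q)) (x y : vert Q) : khom (o x) (o y) :=
  match s with
  | [::] => kto (o x) (o y) (kid D (o x))
  | a :: s' => kcomp (pev s' (tgt a) y) (kto (o x) (o (tgt a)) (u a))
  end.

Lemma pev_cat x y z s s' : is_path x s y ->
  pev (s ++ s') x z = kcomp (pev s' y z) (pev s x y).
Proof.
elim: s x => [|a s IH] x /= => [/eqP->|/andP[_ ps]].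
  by rewrite kto_refl kcomp1r.
by rewrite (IH _ ps) kcompA.
Qed.

Definition ev_mor x y (f : phom k x y) : khom (o x) (o y) :=
  malg_lin (fun p : qpath x y => pev (val p) x y) f.

(** The category [kQ] is free on its arrows: a functor can be prescribed on them. *)
Definition ev : kfun (path_cat k Q) D.
Proof.
refine (@KFun k (path_cat k Q) D o ev_mor _ _ _).
- by move=> x y; exact: malg_lin_linear.
- by move=> x; rewrite /ev_mor [LHS]malg_linU /= kto_refl.
- move=> x y z g f /=.
  move: g; apply: malg_lin_ext => [a g g'|a g g'|q].
  + by rewrite phom_comp_linearl; exact: malg_lin_linear.
  + by rewrite /ev_mor malg_lin_linear kcomp_linearl.
  move: f; apply: malg_lin_ext => [a f f'|a f f'|p].
  + by rewrite phom_comp_linearr; exact: malg_lin_linear.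
  + by rewrite /ev_mor malg_lin_linear kcomp_linearr.
  rewrite phom_compU /ev_mor !malg_linU; exact: (pev_cat _ _ (valP p)).
Defined.

Lemma ev_path x y (p : @qpath Q x y) : fmor ev (path_mor k p) = pev (val p) x y.
Proof. exact: malg_linU. Qed.

Lemma ev_pid x : fmor ev (path_mor k (pid x)) = kid D (o x).
Proof. by rewrite ev_path /= kto_refl. Qed.

Lemma ev_cons a y (q : qpath (tgt a) y) :
  fmor ev (path_mor k (pcomp q (parr a))) = kcomp (fmor ev (path_mor k q)) (u a).
Proof. by rewrite !ev_path /= kto_refl. Qed.

Lemma ev_arr a : fmor ev (path_mor k (parr a)) = u a.
Proof. by rewrite ev_path /= !kto_refl kcomp1l. Qed.

Lemma ev_sum x y (f : phom k x y) :
  fmor ev f = \sum_(p <- msupp f) f@_p *: fmor ev (path_mor k p).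
Proof. by apply: eq_bigr => p _; rewrite ev_path. Qed.

End PathFunctor.

Arguments ev {k Q D} o u.
Arguments ev_sum {k Q D} o u {x y} f.

Section PathCategorySupport.
Variables (k : fieldType) (Q : quiver).

Lemma path_mor_comp x y z (q : @qpath Q y z) (p : qpath x y) :
  kcomp (path_mor k q) (path_mor k p) = path_mor k (pcomp q p).
Proof. exact: phom_compU. Qed.

Lemma msupp_phom_comp x y z (g : phom k y z) (f : phom k x y) (r : @qpath Q x z) :
  r \in msupp (phom_comp g f) ->
  exists q p, [/\ q \in msupp g, p \in msupp f & r = pcomp q p].
Proof.
move=> /msupp_malg_lin[q qg /msupp_malg_lin[p pf rE]]; exists q, p; split=> //.
by move: rE; rewrite -mcoeff_neq0 mcoeffU; have [->//|_] := eqVneq (pcomp q p) r;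
  rewrite eqxx.
Qed.

Lemma mcoeff_phom_compl x y z (g : phom k y z) (p : @qpath Q x y) (q : qpath y z) :
  (phom_comp g << p >>)@_(pcomp q p) = g@_q.
Proof.
have H := @mcoeff_malg_lin_inj k _ _ _ (g : {malg k[qpath y z]}) q (@pcomp_injl _ _ _ z p).
have E : phom_comp g << p >> = malg_lin (fun q => << pcomp q p >> : phom k x z) g.
  by apply: eq_malg_lin => r; exact: malg_linU.
rewrite E; exact: H.
Qed.

Lemma mcoeff_phom_compr x y z (q : @qpath Q y z) (f : phom k x y) (p : qpath x y) :
  (phom_comp << q >> f)@_(pcomp q p) = f@_p.
Proof.
have H := @mcoeff_malg_lin_inj k _ _ _ (f : {malg k[qpath x y]}) p (@pcomp_injr _ x _ _ q).
by rewrite /phom_comp malg_linU; exact: H.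
Qed.

End PathCategorySupport.

(** * Homogeneous arrows of a graded monomial category *)

Section QuotientProjection.
Variables (k : fieldType) (B : kcat k) (I : kideal B).

Definition kquot_pi : kfun B (kquot I).
Proof.
refine (@KFun k B (kquot I) (fun x => x) (fun x y f => qpi I f) _ _ _).
- by move=> x y; exact: qpi_linear.
- by [].
- by move=> x y z; exact: qpi_comp.
Defined.

Lemma kquot_pi_surj (x y : B) (u : @khom k (kquot I) x y) :
  exists f : khom x y, u = fmor kquot_pi f.
Proof. by exists (qrepr (u : qhom I x y)); rewrite /= qreprK. Qed.

Lemma kquot_pi_eq0 (x y : B) (f : khom x y) :
  fmor kquot_pi f = 0 <-> f \in ideal_mem I x y.
Proof.
rewrite -[X in _ = X <-> _](fmor0 kquot_pi) /=.
by split=> [/qpiP|H]; [|apply/qpiP]; rewrite subr0.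
Qed.

Variables (D : kcat k) (T : kfun B D).
Hypothesis T_kills : forall x y (f : khom x y), f \in ideal_mem I x y -> fmor T f = 0.

Definition kquot_lift_mor (x y : B) (u : qhom I x y) : khom (T x) (T y) :=
  fmor T (qrepr u).

Lemma kquot_lift_morE (x y : B) (f : khom x y) :
  kquot_lift_mor (qpi I f) = fmor T f.
Proof.
by apply/eqP; rewrite -subr_eq0 -fmorB T_kills //; exact: qpi_repr.
Qed.

Definition kquot_lift : kfun (kquot I) D.
Proof.
refine (@KFun k (kquot I) D T kquot_lift_mor _ _ _).
- move=> x y c u v; rewrite -[u]qreprK -[v]qreprK -qpi_linear.
  by rewrite !kquot_lift_morE fmor_linear.
- by move=> x; rewrite [LHS]kquot_lift_morE fmor_id.
- move=> x y z v u; rewrite -[v]qreprK -[u]qreprK.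
  by rewrite -[kcomp _ _]qpi_comp !kquot_lift_morE fmor_comp.
Defined.

Lemma kquot_lift_pi (x y : B) (f : khom x y) :
  fmor kquot_lift (fmor kquot_pi f) = fmor T f.
Proof. exact: kquot_lift_morE. Qed.

End QuotientProjection.

Section PathFunctorTheory.
Variables (k : fieldType) (Q : quiver).
Notation PQ := (path_cat k Q).

Lemma phom_sum x y (f : phom k x y) :
  f = \sum_(p <- msupp f) f@_p *: (path_mor k p : @phom k Q x y).
Proof. by rewrite -{1}(malg_lin_id f). Qed.

Lemma fmor_phom (D : kcat k) (T : kfun PQ D) x y (f : phom k x y) :
  fmor T f = \sum_(p <- msupp f) f@_p *: fmor T (path_mor k p).
Proof. by rewrite {1}(phom_sum f) fmor_sum; apply: eq_bigr => p _;
  exact: fmorZ. Qed.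

Lemma fmor_ev (D : kcat k) (T : kfun PQ D) x y (f : phom k x y) :
  fmor T f = fmor (ev T (fun a => fmor T (path_mor k (parr a)))) f.
Proof.
rewrite !fmor_phom; apply: eq_bigr => p _; congr (_ *: _).
elim/qpath_ind: p => {x y f} [x|a y q IH]; first by rewrite ev_pid -fmor_id.
by rewrite ev_cons -IH -path_mor_comp fmor_comp.
Qed.

Lemma msupp_lin x y c (f g : @phom k Q x y) p :
  p \in msupp (c *: f + g) -> (p \in msupp f) || (p \in msupp g).
Proof.
rewrite -!mcoeff_neq0; apply: contraR;
  rewrite negb_or !negbK => /andP[/eqP f0 /eqP g0].
by rewrite mcoeffD mcoeffZ f0 g0 mulr0 addr0.
Qed.

Lemma msupp_path x y (p q : @qpath Q x y) :
  (q \in msupp (path_mor k p : phom k x y)) = (q == p).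
Proof.
rewrite -mcoeff_neq0 mcoeffU (eq_sym q).
by case: (eqVneq p q) => _; rewrite ?eqxx ?oner_neq0.
Qed.

End PathFunctorTheory.

(* Degrees are multiplied in the order of travel: [f] comes first in [hmg_comp]. *)
Record kgrading (k : fieldType) (C : kcat k) (G : groupType) := KGrading {
  hmg : G -> forall x y : C, khom x y -> Prop;
  hproj : G -> forall x y : C, khom x y -> khom x y;
  hmg0 : forall g x y, hmg g (0 : khom x y);
  hmg_lin : forall g x y c (f f' : khom x y), hmg g f -> hmg g f' -> hmg g (c *: f + f');
  hmg_id : forall x, hmg 1%g (kid C x);
  hmg_comp : forall g h x y z (f : khom x y) (f' : khom y z),
    hmg g f -> hmg h f' -> hmg (g * h)%g (kcomp f' f);
  hproj_linear : forall g x y, linear (@hproj g x y);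
  hprojE : forall g x y (f : khom x y), hmg g f -> hproj g f = f;
  hproj_out : forall g h x y (f : khom x y), hmg g f -> g <> h -> hproj h f = 0;
  hmg_ind : forall x y (P : khom x y -> Prop), P 0 ->
    (forall f f', P f -> P f' -> P (f + f')) -> (forall g f, hmg g f -> P f) ->
    forall f, P f }.

Section Degree.
Variables (Q : quiver) (G : groupType) (d : arr Q -> G).

Definition pdeg (s : seq (arr Q)) : G := foldr (fun a g => (d a * g)%g) 1%g s.

Lemma pdeg_cat s s' : pdeg (s ++ s') = (pdeg s * pdeg s')%g.
Proof. by elim: s => [|a s IH] /=; rewrite ?mul1g // IH mulgA. Qed.

End Degree.

(* [pi] stands for the quotient functor from kQ to A = kQ/I_0. *)
Section Filtration.
Variables (k : fieldType) (Q : quiver) (A : kcat k) (pi : kfun (path_cat k Q) A).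
Hypothesis pi_full : forall x y (u : khom (pi x) (pi y)), exists f, u = fmor pi f.
Hypothesis pi_paths : forall x y (f : phom k x y), fmor pi f = 0 ->
  forall p, p \in msupp f -> fmor pi (path_mor k p) = 0.

(* The j-th power of the radical of A. *)
Definition radp (j : nat) (x y : vert Q) (f : khom (pi x) (pi y)) :=
  exists2 h : phom k x y,
  forall p, p \in msupp h -> (j <= plen p)%N & f = fmor pi h.

Lemma radp0 j x y : radp j (0 : khom (pi x) (pi y)).
Proof.
exists 0; last by rewrite (fmor0 pi).
by move=> p; rewrite msupp0 inE.
Qed.

Lemma radp_lin j x y c (f g : khom (pi x) (pi y)) :
  radp j f -> radp j g -> radp j (c *: f + g).
Proof.
move=> [f' f'j ->] [g' g'j ->]; exists (c *: f' + g'); last by rewrite fmor_linear.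
by move=> p /msupp_lin /orP[/f'j|/g'j].
Qed.

Lemma radpZ j x y c (f : khom (pi x) (pi y)) : radp j f -> radp j (c *: f).
Proof. by move=> fj; rewrite -[c *: f]addr0; apply: radp_lin;
  last exact: radp0. Qed.

Lemma radpD j x y (f g : khom (pi x) (pi y)) : radp j f -> radp j g -> radp j (f + g).
Proof. by move=> fj gj; rewrite -[f]scale1r; exact: radp_lin. Qed.

Lemma radpN j x y (f : khom (pi x) (pi y)) : radp j f -> radp j (- f).
Proof. by rewrite -scaleN1r; exact: radpZ. Qed.

Lemma radpB j x y (f g : khom (pi x) (pi y)) : radp j f -> radp j g -> radp j (f - g).
Proof. by move=> fj gj; apply: radpD => //; exact: radpN. Qed.

Lemma radp_sum j x y (J : eqType) (s : seq J) (F : J -> khom (pi x) (pi y)) :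
  (forall i, i \in s -> radp j (F i)) -> radp j (\sum_(i <- s) F i).
Proof.
move=> H; rewrite big_seq; elim/big_ind: _ => //; [exact: radp0|exact: radpD].
Qed.

Lemma radp_le i j x y (f : khom (pi x) (pi y)) : (i <= j)%N -> radp j f -> radp i f.
Proof. by move=> ij [h hj ->]; exists h => // p /hj; exact: leq_trans. Qed.

Lemma radp_path x y (p : @qpath Q x y) : radp (plen p) (fmor pi (path_mor k p)).
Proof. by exists (path_mor k p) => // q; rewrite msupp_path => /eqP->. Qed.

Lemma radp_id x : radp 0 (kid A (pi x)).
Proof. by rewrite -(fmor_id pi); exact: (radp_path (pid x)). Qed.

Lemma radp_comp i j x y z (g : khom (pi y) (pi z)) (f : khom (pi x) (pi y)) :
  radp i f -> radp j g -> radp (i + j) (kcomp g f).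
Proof.
move=> [f' f'i ->] [g' g'j ->]; rewrite -(fmor_comp pi).
exists (phom_comp g' f') => // p /msupp_phom_comp[q [r [/g'j qj /f'i ri ->]]].
by rewrite /plen /= size_cat leq_add.
Qed.

(** Two representatives differ by an element of [I_0]. If one of them has only paths of length at
    least [j], a shorter [p] survives in the difference and is itself in [I_0], by monomiality. *)
Lemma radp_indep j x y (h : phom k x y) p :
  radp j (fmor pi h) -> p \in msupp h -> (plen p < j)%N ->
  fmor pi (path_mor k p) = 0.
Proof.
move=> [h' h'j /eqP]; rewrite -subr_eq0 -fmorB => /eqP hI ph pj.
apply: (pi_paths hI); rewrite -mcoeff_neq0 mcoeffB.
have /mcoeff_outdom -> : p \notin msupp h' by apply/negP => /h'j; rewrite leqNgt pj.
by rewrite subr0 mcoeff_neq0.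
Qed.

Notation evA u := (ev pi u).
Notation family := (forall a : arr Q, khom (pi (src a)) (pi (tgt a))).

Lemma radp_ev (u : family) x y (p : @qpath Q x y) : (forall a, radp 1 (u a)) ->
  radp (plen p) (fmor (evA u) (path_mor k p)).
Proof.
move=> u1; elim/qpath_ind: p => {x y} [x|a y q IH].
  by rewrite ev_pid; exact: radp_id.
by rewrite ev_cons; exact: (radp_comp (u1 a) IH).
Qed.

(** Change one factor at a time: each factor contributes order 1, while the difference of two
    factors has order [m.+1], a gain of [m]. *)
Lemma radp_evB (u u' : family) m x y (p : @qpath Q x y) :
  (forall a, radp 1 (u a)) -> (forall a, radp 1 (u' a)) ->
  (forall a, radp m.+1 (u a - u' a)) ->
  radp (plen p + m) (fmor (evA u) (path_mor k p) - fmor (evA u') (path_mor k p)).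
Proof.
move=> u1 u'1 uu'; elim/qpath_ind: p => {x y} [x|a y q IH].
  by rewrite !ev_pid subrr; exact: radp0.
rewrite !ev_cons; set U := fmor _ _; set U' := fmor _ _.
have -> : kcomp U (u a) - kcomp U' (u' a) = kcomp U (u a - u' a) + kcomp (U - U') (u' a).
  by rewrite kcompBl kcompBr addrA subrK.
apply: radpD; last by apply: (radp_comp (i := 1)).
apply: radp_le (radp_comp (uu' a) (radp_ev q u1)).
by rewrite /plen /= addSn addSn addnC.
Qed.

(** The case [m = 1] of [radp_evB]: a family congruent to the arrows modulo [rad^2] acts as the
    identity on each quotient of [rad^j] by [rad^(j+1)]. *)
Lemma radp_ev_sub (u : family) j x y (f : phom k x y) :
  (forall a, radp 2 (u a - fmor pi (path_mor k (parr a)))) ->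
  (forall p, p \in msupp f -> (j <= plen p)%N) ->
  radp j.+1 (fmor (evA u) f - fmor pi f).
Proof.
move=> u2 fj;
  have pi1 a : radp 1 (fmor pi (path_mor k (parr a))) by exact: (radp_path (parr a)).
have u1 a : radp 1 (u a).
  by rewrite -(subrK (fmor pi (path_mor k (parr a))) (u a)); apply: radpD => //;
    exact: radp_le (u2 a).
rewrite (fmor_ev pi) !fmor_phom -sumrB; apply: radp_sum => p /fj pj.
rewrite -scalerBr; apply: radpZ; apply: radp_le (radp_evB p u1 pi1 u2).
by rewrite addn1 ltnS.
Qed.

Variables (G : groupType) (gr : kgrading A G) (d : arr Q -> G).

Lemma hmg_ev (u : family) x y (p : @qpath Q x y) : (forall a, hmg gr (d a) (u a)) ->
  hmg gr (pdeg d (val p)) (fmor (evA u) (path_mor k p)).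
Proof.
move=> ud; elim/qpath_ind: p => {x y} [x|a y q IH].
  by rewrite ev_pid; exact: hmg_id.
by rewrite ev_cons; apply: hmg_comp.
Qed.

Lemma hmg_ev_supp (u : family) g x y (f : phom k x y) : (forall a, hmg gr (d a) (u a)) ->
  (forall p, p \in msupp f -> pdeg d (val p) = g) -> hmg gr g (fmor (evA u) f).
Proof.
move=> ud fg; rewrite fmor_phom big_seq; elim/big_rec: _ => [|p e pf IH].
  exact: hmg0.
by apply: hmg_lin => //; rewrite -(fg p pf); exact: hmg_ev.
Qed.

Lemma hproj_ev_out (u : family) g x y (f : phom k x y) : (forall a, hmg gr (d a) (u a)) ->
  (forall p, p \in msupp f -> pdeg d (val p) <> g) -> hproj gr g (fmor (evA u) f) = 0.
Proof.
move=> ud fg; rewrite fmor_phom big_seq; elim/big_rec: _ => [|p e pf IH].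
  have := hproj_linear gr g (-1) (0 : khom (pi x) (pi y)) 0.
  by rewrite scaler0 addr0 scaleN1r addNr.
by rewrite hproj_linear IH addr0 (hproj_out (hmg_ev p ud) (fg p pf)) scaler0.
Qed.

Variable N : nat.
Hypothesis Q_bound : forall x y (p : @qpath Q x y), (plen p < N)%N.

Lemma radp_bound j x y (f : khom (pi x) (pi y)) : (N <= j)%N -> radp j f -> f = 0.
Proof.
move=> Nj [h hj ->]; rewrite fmor_phom; apply: big1_seq => p /= /hj jp.
by have := leq_trans (Q_bound p) (leq_trans Nj jp); rewrite ltnn.
Qed.

(** The powers of the radical are graded. By descending induction on [j], starting from [rad^N = 0]:
    modulo [rad^(j+1)], [fmor pi h] equals [fmor (evA u) h], a combination of homogeneous products
    lying in [rad^j]. *)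
Lemma radp_hproj (u : family) j g x y (f : khom (pi x) (pi y)) :
  (forall a, hmg gr (d a) (u a)) ->
  (forall a, radp 2 (u a - fmor pi (path_mor k (parr a)))) ->
  radp j f -> radp j (hproj gr g f).
Proof.
move=> ud u2; have u1 a : radp 1 (u a).
  rewrite -(subrK (fmor pi (path_mor k (parr a))) (u a)); apply: radpD.
    exact: radp_le (u2 a).
  exact: (radp_path (parr a)).
have p0 : hproj gr g (0 : khom (pi x) (pi y)) = 0.
  have := hproj_linear gr g (-1) (0 : khom (pi x) (pi y)) 0.
  by rewrite scaler0 addr0 scaleN1r addNr.
have pB (f1 f2 : khom (pi x) (pi y)) : hproj gr g (f1 - f2) = hproj gr g f1 - hproj gr g f2.
  by rewrite addrC -scaleN1r hproj_linear scaleN1r addrC.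
have [n] : exists n, (N <= j + n)%N by exists N; rewrite leq_addl.
elim: n => [|n IH] in j f *.
  by rewrite addn0 => Nj /(radp_bound Nj) ->; rewrite p0; exact: radp0.
rewrite addnS -addSn => Nj [h hj ->].
rewrite -[fmor pi h](subKr (fmor (evA u) h)) pB; apply: radpB; last first.
  by apply: radp_le (IH _ _ Nj (radp_ev_sub u2 hj)).
rewrite fmor_phom big_seq; elim/big_rec: _ => [|p e ph IHe].
  by rewrite p0; exact: radp0.
rewrite hproj_linear; apply: radp_lin => //.
have [<-|ne] := pselect (pdeg d (val p) = g).
  by rewrite (hprojE (hmg_ev p ud)); apply: radp_le (radp_ev p u1); exact: hj.
by rewrite (hproj_out (hmg_ev p ud) ne); exact: radp0.
Qed.

End Filtration.

Section PathComposition.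
Variables (k : fieldType) (Q : quiver) (x y z : vert Q).

Lemma phom_compBl (g g' : phom k y z) (f : phom k x y) :
  phom_comp (g - g') f = phom_comp g f - phom_comp g' f.
Proof. exact: (@kcompBl k (path_cat k Q)). Qed.

Lemma phom_compDr (g : phom k y z) (f f' : phom k x y) :
  phom_comp g (f + f') = phom_comp g f + phom_comp g f'.
Proof. exact: (@kcompDr k (path_cat k Q)). Qed.

End PathComposition.

(** * Substitutions that add longer parallel paths to the arrows *)

Section Substitution.
Variables (k : fieldType) (Q : quiver).
Hypothesis Q_acyclic : no_oriented_cycle Q.
Variables (m : nat) (theta : forall a : arr Q, phom k (src a) (tgt a)).
Hypothesis m_gt0 : (0 < m)%N.
Hypothesis theta_len : forall a b, b \in msupp (theta a) -> plen b = m.+1.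

Definition subst_arr (a : arr Q) : phom k (src a) (tgt a) :=
  path_mor k (parr a) + theta a.

Definition subst : kfun (path_cat k Q) (path_cat k Q) :=
  ev (fun x => x : path_cat k Q) subst_arr.

Lemma subst_parr a : fmor subst (path_mor k (parr a)) = subst_arr a.
Proof. exact: (ev_arr _ a). Qed.

Definition subst_diff x y (p : @qpath Q x y) : phom k x y :=
  fmor subst (path_mor k p) - path_mor k p.

Lemma subst_diff_pid x : subst_diff (pid x) = 0.
Proof. by rewrite /subst_diff /subst ev_pid subrr. Qed.

Lemma subst_diff_cons a y (q : qpath (tgt a) y) :
  subst_diff (pcomp q (parr a)) =
  phom_comp (subst_diff q) (subst_arr a) + phom_comp (path_mor k q : phom k _ _) (theta a).
Proof.
rewrite /subst_diff /subst ev_cons phom_compBl -path_mor_comp -addrA; congr (_ + _).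
by rewrite -[subst_arr a]/(_ + _) phom_compDr opprD subrK.
Qed.

Lemma msupp_subst_arr a b : b \in msupp (subst_arr a) ->
  b = parr a \/ b \in msupp (theta a).
Proof.
rewrite /subst_arr -[path_mor k _]scale1r => /msupp_lin.
by rewrite msupp_path => /orP[/eqP|]; [left|right].
Qed.

Lemma msupp_subst_cons a y (q : qpath (tgt a) y) r :
  r \in msupp (subst_diff (pcomp q (parr a))) ->
  exists q' b, r = pcomp q' b /\
  (q' \in msupp (subst_diff q) /\ (b = parr a \/ b \in msupp (theta a)) \/
   q' = q /\ b \in msupp (theta a)).
Proof.
rewrite subst_diff_cons -[phom_comp _ _]scale1r => /msupp_lin /orP[] /msupp_phom_comp.
- by move=> [q' [b [q'q /msupp_subst_arr ba ->]]]; exists q', b; split=> //; left.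
- move=> [q' [b [q'q ba ->]]]; exists q', b; split=> //; right.
  by move: q'q; rewrite msupp_path => /eqP.
Qed.

Lemma plen_comp x y z (q : @qpath Q y z) (p : qpath x y) :
  plen (pcomp q p) = (plen p + plen q)%N.
Proof. exact: size_cat. Qed.

Lemma plen_parr (a : arr Q) : plen (parr a) = 1%N.
Proof. by []. Qed.

(** A term of the difference arises by replacing at least one arrow, and each replacement adds [m]
    to the length. *)
Lemma subst_diff_len x y (p q : @qpath Q x y) :
  q \in msupp (subst_diff p) -> (plen p + m <= plen q)%N.
Proof.
elim/qpath_ind: p q => {x y} [x|a y p IH] r;
  first by rewrite subst_diff_pid msupp0 inE.
move=> /msupp_subst_cons[q [b [-> [[/IH qp ba]|[-> /theta_len bm]]]]];
  rewrite !plen_comp plen_parr.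
  by case: ba => [->|/theta_len ->]; rewrite ?plen_parr; lia.
by rewrite bm; lia.
Qed.

Variables (G : groupType) (d : arr Q -> G).
Hypothesis theta_deg : forall a b, b \in msupp (theta a) -> pdeg d (val b) <> d a.

(** This length means that exactly one arrow has been replaced; its degree has changed, and the
    remaining factors cancel in the group. *)
Lemma subst_diff_deg x y (p q : @qpath Q x y) :
  q \in msupp (subst_diff p) -> plen q = (plen p + m)%N ->
  pdeg d (val q) <> pdeg d (val p).
Proof.
elim/qpath_ind: p q => {x y} [x|a y p IH] r;
  first by rewrite subst_diff_pid msupp0 inE.
move=> /msupp_subst_cons[q [b [-> [[qp ba]|[-> ba]]]]];
  rewrite !plen_comp !pdeg_cat plen_parr.
  have qm := subst_diff_len qp.
  case: ba => [->|/theta_len ->] e; last by lia.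
  by move=> /mulgI; apply: IH => //; move: e; rewrite plen_parr; lia.
by move=> _ /mulIg /=; rewrite mulg1; exact: theta_deg.
Qed.

(** By acyclicity, a path that begins with [c] cannot come from replacing an initial [c]. *)
Lemma theta_prefix c z t (g : phom k (tgt c) t) (q : @qpath Q z t) (s : @qpath Q (src c) t) :
  val s = c :: val q -> (phom_comp g (theta c))@_s = 0.
Proof.
move=> sE; apply: mcoeff_outdom;
  apply/negP => /msupp_phom_comp[g' [b' [_ /theta_len b'm e]]].
have := congr1 val e; rewrite sE => /esym; apply: acyclic_prefix => //.
by rewrite b'm; lia.
Qed.

Lemma mcoeff_subst_cons a y (p : qpath (tgt a) y) r :
  (subst_diff (pcomp p (parr a)))@_r =
  (phom_comp (subst_diff p) (path_mor k (parr a)))@_r +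
  (phom_comp (subst_diff p) (theta a))@_r +
  (phom_comp (path_mor k p : phom k _ _) (theta a))@_r.
Proof.
have E : phom_comp (subst_diff p) (subst_arr a) =
    phom_comp (subst_diff p) (path_mor k (parr a)) + phom_comp (subst_diff p) (theta a).
  exact: phom_compDr.
by rewrite subst_diff_cons E !mcoeffD.
Qed.

(** No cancellation occurs: by [theta_prefix], a path beginning with [a] gets its coefficient only
    from the term that keeps [a]. *)
Lemma subst_diff_step a y (p q : qpath (tgt a) y) : q \in msupp (subst_diff p) ->
  pcomp q (parr a) \in msupp (subst_diff (pcomp p (parr a))).
Proof.
rewrite -!mcoeff_neq0; apply: contra_neq => <-.
have := mcoeff_phom_compl (subst_diff p) (parr a) q.
have := @theta_prefix a _ _ (subst_diff p) q (pcomp q (parr a)) erefl.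
have := @theta_prefix a _ _ (path_mor k p : phom k _ _) q (pcomp q (parr a)) erefl.
rewrite (mcoeff_subst_cons p (pcomp q (parr a))).
move: (phom_comp (path_mor k p : phom k _ _) (theta a)) => X.
move: (phom_comp (subst_diff p) (theta a)) => Y.
move: (phom_comp (subst_diff p) _) => Z.
by move=> -> -> ->; rewrite !addr0.
Qed.

(** Every single replacement really occurs, with no cancellation against other terms. This is shown
    first for [w] after [b]; the arrows of [v] are then put in front by [subst_diff_step]. *)
Lemma subst_diff_replace a x y (v : qpath x (src a)) (w : qpath (tgt a) y) b :
  b \in msupp (theta a) ->
  pcomp (pcomp w b) v \in msupp (subst_diff (pcomp (pcomp w (parr a)) v)).
Proof.
move=> ba; have bm := theta_len ba.
have : pcomp w b \in msupp (subst_diff (pcomp w (parr a))).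
  (* Terms that keep [a] begin with [a], which acyclicity excludes here. *)
  have Y0 : pcomp w b \notin msupp (phom_comp (subst_diff w) (path_mor k (parr a) : phom k _ _)).
    apply/negP => /msupp_phom_comp[q [a' [_]]];
      rewrite msupp_path => /eqP -> /(congr1 val).
    by apply: acyclic_prefix => //; rewrite bm; lia.
  (* Terms that replace both [a] and an arrow of [w] are too long. *)
  have Z0 : pcomp w b \notin msupp (phom_comp (subst_diff w) (theta a)).
    apply/negP => /msupp_phom_comp[q [a' [/subst_diff_len qw /theta_len a'm /(congr1 (@plen _ _ _))]]].
    by rewrite !plen_comp bm; lia.
  move: ba; rewrite -!mcoeff_neq0; apply: contra_neq => <-.
  have := mcoeff_phom_compr w (theta a) b; have := mcoeff_outdom Z0.
  have := mcoeff_outdom Y0; rewrite (mcoeff_subst_cons w (pcomp w b)).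
  move: (phom_comp (subst_diff w) (path_mor k (parr a))) => X.
  move: (phom_comp (subst_diff w) (theta a)) => Y.
  move: (phom_comp _ (theta a)) => Z.
  by move=> -> -> ->; rewrite !add0r.
move: (pcomp w b) (pcomp w (parr a)) => {ba}; move: (src a) v => z v.
elim/qpath_ind: v => {x z} [x|c z v IH] q p qp; first by rewrite !pcomp1r.
by rewrite !pcompA; apply: subst_diff_step; exact: IH.
Qed.

End Substitution.

Lemma subr_telescope (V : zmodType) (X Y Z S T U : V) :
  X + Y + Z + U - S - (U + T) = Z - (S - Y) - (T - X).
Proof.
rewrite opprD !opprB !addrA [_ - S - U]addrAC addrK; congr (_ - _).
by rewrite [RHS]addrC !addrA; congr (_ - _); exact: addrAC.
Qed.

Lemma subr_detour (V : zmodType) (X Y Z U P : V) :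
  X - U = X - (Y + Z) + (Y - P) - (U - P) + Z.
Proof.
rewrite opprD opprB !addrA subrK [RHS]addrAC; congr (_ - _).
by rewrite [_ - Z + Y]addrAC !subrK.
Qed.

(** * Successive approximation of the arrows by homogeneous morphisms *)

Section Homogenize.
Variables (k : fieldType) (Q : quiver) (A : kcat k) (pi : kfun (path_cat k Q) A).
Hypothesis pi_full : forall x y (u : khom (pi x) (pi y)), exists f, u = fmor pi f.
Hypothesis pi_paths : forall x y (f : phom k x y), fmor pi f = 0 ->
  forall p, p \in msupp f -> fmor pi (path_mor k p) = 0.
Hypothesis pi_long : forall x y (f : phom k x y), fmor pi f = 0 ->
  forall p, p \in msupp f -> (2 <= plen p)%N.
Hypothesis Q_acyclic : no_oriented_cycle Q.
Variable N : nat.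
Hypothesis Q_bound : forall x y (p : @qpath Q x y), (plen p < N)%N.
Variables (G : groupType) (gr : kgrading A G).

Notation evA u := (ev pi u).
Notation family := (forall a : arr Q, khom (pi (src a)) (pi (tgt a))).
Notation radp := (radp (pi := pi)).
Notation pia a := (fmor pi (path_mor k (parr a))).

(** The condition for [chi] to define an endomorphism of [A]. *)
Definition kills (chi : family) :=
  forall x y (f : phom k x y), fmor pi f = 0 -> fmor (evA chi) f = 0.

(* [u] is homogeneous and agrees with [chi] up to order [m.+1], with difference
   [h]; the step makes them agree up to order [m.+2]. *)
Section Step.
Variables (d : arr Q -> G) (m : nat) (u chi : family).
Hypothesis m_gt0 : (0 < m)%N.
Hypothesis u_hmg : forall a, hmg gr (d a) (u a).
Hypothesis chi_kills : kills chi.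
Hypothesis chi2 : forall a, radp 2 (chi a - pia a).
Variable h : forall a : arr Q, phom k (src a) (tgt a).
Hypothesis h_len : forall a b, b \in msupp (h a) -> (m.+1 <= plen b)%N.
Hypothesis hE : forall a, u a - chi a = fmor pi (h a).

Definition step_out a : phom k (src a) (tgt a) :=
  malg_filter (fun b => (plen b == m.+1) && (pdeg d (val b) != d a)) (h a).
Definition step_in a : phom k (src a) (tgt a) :=
  malg_filter (fun b => (plen b == m.+1) && (pdeg d (val b) == d a)) (h a).
Definition step_chi : family := fun a => fmor (evA chi) (subst_arr step_out a).
Definition step_u : family := fun a => u a - fmor (evA u) (step_in a).
Notation sigma := (subst step_out).

Lemma step_out_len a b : b \in msupp (step_out a) -> plen b = m.+1.
Proof. by rewrite msupp_filter => /andP[/andP[/eqP]]. Qed.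

Lemma step_out_deg a b : b \in msupp (step_out a) -> pdeg d (val b) <> d a.
Proof. by rewrite msupp_filter => /andP[/andP[_ /eqP]]. Qed.

Lemma step_in_len a b : b \in msupp (step_in a) -> plen b = m.+1.
Proof. by rewrite msupp_filter => /andP[/andP[/eqP]]. Qed.

Lemma step_in_deg a b : b \in msupp (step_in a) -> pdeg d (val b) = d a.
Proof. by rewrite msupp_filter => /andP[/andP[_ /eqP]]. Qed.

Lemma step_chiE a : step_chi a = chi a + fmor (evA chi) (step_out a).
Proof. by rewrite /step_chi /subst_arr fmorD ev_arr. Qed.

Lemma radp_uchi a : radp m.+1 (u a - chi a).
Proof. by rewrite hE; exists (h a) => // b; exact: h_len. Qed.

Lemma step_base2 a : radp 2 (u a - pia a).
Proof.
rewrite -(subrK (chi a) (u a)) -addrA; apply: radpD => //.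
by apply: radp_le (radp_uchi a); rewrite ltnS.
Qed.

Definition step_rest a : phom k (src a) (tgt a) :=
  malg_filter (fun b => plen b != m.+1) (h a).

Lemma step_rest_len a b : b \in msupp (step_rest a) -> (m.+2 <= plen b)%N.
Proof.
by rewrite msupp_filter => /andP[ne /h_len];
  rewrite (leq_eqVlt m.+1) eq_sym (negPf ne).
Qed.

Lemma step_split a : h a = step_out a + step_in a + step_rest a.
Proof. exact: malg_filter_split. Qed.

(** The terms of length [m.+1] cancel up to order [m.+2], because [u], [chi] and [pi] agree on them
    to that order by [radp_ev_sub]. *)
Lemma step_close a : radp m.+2 (step_u a - step_chi a).
Proof.
rewrite step_chiE /step_u.
have -> : u a - fmor (evA u) (step_in a) - (chi a + fmor (evA chi) (step_out a)) =
  fmor pi (step_rest a) -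
  (fmor (evA u) (step_in a) - fmor pi (step_in a)) -
  (fmor (evA chi) (step_out a) - fmor pi (step_out a)).
  have : u a = fmor pi (step_out a) + fmor pi (step_in a) + fmor pi (step_rest a) + chi a.
    by rewrite -!fmorD -step_split -hE subrK.
  by move=> ->; exact: subr_telescope.
apply: radpB; first apply: radpB.
- by exists (step_rest a) => // b; exact: step_rest_len.
- by apply: radp_ev_sub => //; [exact: step_base2|move=> b /step_in_len ->].
- by apply: radp_ev_sub => // b /step_out_len ->.
Qed.

Lemma step_u_hmg a : hmg gr (d a) (step_u a).
Proof.
rewrite /step_u addrC -scaleN1r; apply: hmg_lin => //.
by apply: (hmg_ev_supp (d := d)) => // b; exact: step_in_deg.
Qed.

Lemma step_chi2 a : radp 2 (step_chi a - pia a).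
Proof.
rewrite step_chiE addrAC; apply: radpD => //; rewrite fmor_phom.
have chi1 b : radp 1 (chi b).
  rewrite -(subrK (pia b) (chi b)); apply: radpD; first exact: radp_le (chi2 b).
  exact: (radp_path pi (parr b)).
apply: radp_sum => b /step_out_len bm; apply: radpZ.
by apply: radp_le (radp_ev b chi1); rewrite bm.
Qed.

Lemma ev_step_chi x y (f : phom k x y) :
  fmor (evA step_chi) f = fmor (evA chi) (fmor (sigma) f).
Proof.
rewrite [RHS](fmor_ev (kfun_comp (evA chi) sigma)) !fmor_phom.
apply: eq_bigr => p _; congr (_ *: _); elim/qpath_ind: p => {x y f} [x|a y q IH].
  by rewrite !ev_pid.
by rewrite !ev_cons IH; congr kcomp;
  exact: (congr1 (fmor (evA chi) (x := _) (y := _)) (esym (subst_parr step_out a))).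
Qed.

(* The new [u] gives a morphism of degree [pdeg d p]; modulo [radp (plen p + m.+1)]
   it is the sum of the paths of length [plen p + m] in [subst_diff step_out p],
   none of which has that degree. *)
Lemma step_core x y (p q : @qpath Q x y) : fmor pi (path_mor k p) = 0 ->
  q \in msupp (subst_diff step_out p) -> plen q = (plen p + m)%N ->
  fmor pi (path_mor k q) = 0.
Proof.
move=> p0 qp qm; pose g := pdeg d (val p).
have pi1 a : radp 1 (pia a) by exact: (radp_path pi (parr a)).
have su1 a : radp 1 (step_u a).
  rewrite -(subrK (step_chi a) (step_u a)); apply: radpD;
    first exact: radp_le (step_close a).
  by rewrite -(subrK (pia a) (step_chi a)); apply: radpD => //;
    exact: radp_le (step_chi2 a).
have sc1 a : radp 1 (step_chi a).
  by rewrite -(subrK (pia a) (step_chi a)); apply: radpD => //;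
    exact: radp_le (step_chi2 a).
(* [D1] collects the terms with one replacement, [D2] those of higher order. *)
pose D1 : phom k x y :=
  malg_filter (fun r => plen r == plen p + m)%N (subst_diff step_out p).
pose D2 : phom k x y :=
  malg_filter (fun r => plen r != plen p + m)%N (subst_diff step_out p).
have D1m r : r \in msupp D1 -> plen r = (plen p + m)%N.
  by rewrite msupp_filter => /andP[/eqP].
have D2m r : r \in msupp D2 -> (plen p + m.+1 <= plen r)%N.
  rewrite msupp_filter => /andP[ne /(subst_diff_len m_gt0 step_out_len)].
  by rewrite leq_eqVlt eq_sym (negPf ne) addnS.
have DE : subst_diff step_out p = D1 + D2 by exact: malg_filterC.
have D1s r : r \in msupp D1 -> r \in msupp (subst_diff step_out p).
  by rewrite msupp_filter => /andP[].
have qD : q \in msupp D1 by rewrite msupp_filter qm eqxx.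
clearbody D1 D2.
(* As [p] is in [I_0], [chi] kills it and only the terms added by the substitution remain. *)
have chiD : fmor (evA step_chi) (path_mor k p) = fmor (evA chi) D1 + fmor (evA chi) D2.
  rewrite ev_step_chi -fmorD -DE.
  have -> : fmor sigma (path_mor k p) = subst_diff step_out p + path_mor k p.
    by rewrite /subst_diff subrK.
  by rewrite fmorD (chi_kills p0) addr0.
pose j := (plen p + m.+1)%N.
have T1 : radp j (fmor (evA step_u) (path_mor k p) - fmor (evA step_chi) (path_mor k p)).
  by apply: radp_evB => // a; exact: step_close.
have D1j r : r \in msupp D1 -> ((plen p + m) <= plen r)%N by move/D1m => ->.
have C1 : radp j (fmor (evA chi) D1 - fmor pi D1) by rewrite /j addnS;
  exact: radp_ev_sub.
have U1 : radp j (fmor (evA u) D1 - fmor pi D1).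
  by rewrite /j addnS; apply: radp_ev_sub => //; exact: step_base2.
have C2 : radp j (fmor (evA chi) D2).
  rewrite -(subrK (fmor pi D2) (fmor (evA chi) D2)); apply: radpD.
    by apply: radp_le (radp_ev_sub chi2 D2m); exact: leqnSn.
  exact: (ex_intro2 _ _ D2 D2m erefl).
have T : radp j (fmor (evA step_u) (path_mor k p) - fmor (evA u) D1).
  move: T1 C1 U1 C2; rewrite chiD.
  move: (fmor (evA step_u) (path_mor k p)) (fmor (evA chi) D1) (fmor (evA chi) D2) (fmor pi D1) (fmor (evA u) D1).
  move=> X Y Z P U T1 C1 U1 C2.
  rewrite (subr_detour X Y Z U P).
  by apply: radpD => //; apply: radpB => //; apply: radpD.
(* Project to degree [g]: this preserves [radp j], fixes the value of [step_u] at [p], and kills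
   that of [u] at [D1]. *)
have pj : radp j (fmor (evA step_u) (path_mor k p)).
  have := radp_hproj Q_bound g u_hmg step_base2 T.
  have hB (f1 f2 : khom (pi x) (pi y)) : hproj gr g (f1 - f2) = hproj gr g f1 - hproj gr g f2.
    by rewrite addrC -scaleN1r hproj_linear scaleN1r addrC.
  rewrite hB (hprojE (hmg_ev p step_u_hmg)) (hproj_ev_out u_hmg) ?subr0 // => r rD.
  exact: (subst_diff_deg m_gt0 step_out_len step_out_deg (D1s _ rD) (D1m _ rD)).
have uD : radp j (fmor (evA u) D1).
  by rewrite -(subKr (fmor (evA step_u) (path_mor k p)) (fmor (evA u) D1));
    exact: radpB.
have pD : radp j (fmor pi D1).
  by rewrite -(subKr (fmor (evA u) D1) (fmor pi D1)); exact: radpB.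
by apply: (radp_indep pi_paths pD qD); rewrite qm ltn_add2l.
Qed.

(** The new path occurs in [subst_diff] by [subst_diff_replace] and has the minimal length, so
    [step_core] applies. *)
Lemma step_replace a x y (v : qpath x (src a)) (w : qpath (tgt a) y) b :
  b \in msupp (step_out a) -> fmor pi (path_mor k (pcomp (pcomp w (parr a)) v)) = 0 ->
  fmor pi (path_mor k (pcomp (pcomp w b) v)) = 0.
Proof.
move=> bs p0; apply: (step_core p0).
  exact: (subst_diff_replace Q_acyclic m_gt0 step_out_len).
by rewrite !plen_comp plen_parr (step_out_len bs); lia.
Qed.

(** The arrows are replaced one at a time, each time staying in [I_0]; [v] is the initial segment
    already treated. *)
Lemma step_subst x y z (p : @qpath Q y z) (v : qpath x y) q :
  fmor pi (path_mor k (pcomp p v)) = 0 ->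
  q \in msupp (fmor sigma (path_mor k p) : phom k y z) ->
  fmor pi (path_mor k (pcomp q v)) = 0.
Proof.
elim/qpath_ind: p x v q => {y z} [y|a z p IH] x v q p0.
  by rewrite ev_pid msupp_path => /eqP ->.
rewrite ev_cons => /msupp_phom_comp[q' [b [q'p ba ->]]].
rewrite -pcompA; apply: IH q'p; rewrite pcompA.
by case: (msupp_subst_arr ba) => [->//|bs]; exact: step_replace bs p0.
Qed.

Lemma step_kills : kills step_chi.
Proof.
move=> x y f f0; rewrite fmor_phom; apply: big1_seq => p /andP[_ pf].
have p0 := pi_paths f0 pf; rewrite ev_step_chi chi_kills ?scaler0 //.
rewrite fmor_phom; apply: big1_seq => q /andP[_ qs].
by have := @step_subst _ _ _ p (pid x) q; rewrite !pcomp1r => -> //;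
  rewrite scaler0.
Qed.

End Step.

Hypothesis Q_simple : no_multiple_arrows Q.

Definition approximable (d : arr Q -> G) (m : nat) := exists u chi : family,
  [/\ forall a, hmg gr (d a) (u a), kills chi,
      forall a, radp 2 (chi a - pia a) & forall a, radp m.+1 (u a - chi a)].

Lemma approximableS d m : (0 < m)%N -> approximable d m -> approximable d m.+1.
Proof.
move=> m_gt0 [u [chi [ud chi0 chi2 uchi]]].
have [h hP] : exists h : forall a, phom k (src a) (tgt a), forall a,
    (forall b, b \in msupp (h a) -> (m.+1 <= plen b)%N) /\ u a - chi a = fmor pi (h a).
  exists (fun a => s2val (cid2 (uchi a))) => a; split;
    first exact: (s2valP (cid2 (uchi a))).
  exact: (s2valP' (cid2 (uchi a))).
have hl a := (hP a).1; have hE a := (hP a).2.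
exists (step_u d m u h), (step_chi d m chi h); split.
- by move=> a; exact: step_u_hmg.
- exact: (step_kills m_gt0 ud chi0 chi2 hl hE).
- by move=> a; exact: step_chi2.
- by move=> a; apply: (step_close _ m_gt0 chi2 hl hE).
Qed.

(** In the absence of multiple arrows, any morphism parallel to [a] is a multiple of [a] modulo
    [rad^2]. If all homogeneous ones had coefficient 0, then [a], being a sum of such, would be in
    [rad^2], against admissibility. *)
Lemma arrow_component a : exists g, exists2 f, hmg gr g f & radp 2 (f - pia a).
Proof.
have dec (f : khom (pi (src a)) (pi (tgt a))) : exists c, radp 2 (f - c *: pia a).
  have [h ->] := pi_full f; exists (h@_(parr a)).
  exists (h - h@_(parr a) *: path_mor k (parr a)); last by rewrite fmorB fmorZ.
  move=> p; rewrite ltnNge => ph; apply/negP => p1; move: ph.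
  have -> : p = parr a.
    case: p p1 => -[|b [|//]] ps _; apply: val_inj => /=.
      have := @acyclic_nil _ Q_acyclic (src a) [:: a].
      by rewrite /= eqxx -(eqP ps) eqxx => /(_ isT).
    by have /andP[/eqP sb /eqP tb] := ps; rewrite (Q_simple sb tb).
  by rewrite -mcoeff_neq0 (mcoeffB_self h) eqxx.
apply: contrapT => H.
have : radp 2 (pia a).
  apply: (@hmg_ind _ _ _ gr _ _ (fun f => radp 2 f)).
  - exact: radp0.
  - by move=> f f'; exact: radpD.
  - move=> g f fg; have [c fc] := dec f.
    have [c0|c0] := eqVneq c 0; first by move: fc; rewrite c0 scale0r subr0.
    case: H; exists g, (c^-1 *: f); first by rewrite -[_ *: f]addr0;
      apply: hmg_lin => //; exact: hmg0.
    rewrite -[pia a]scale1r -(mulVf c0) -scalerA -scalerBr; exact: radpZ.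
move=> R2; have /pi_long/(_ (parr a)) : fmor pi (path_mor k (parr a)) = 0.
  by apply: (radp_indep pi_paths R2) => //; rewrite msupp_path.
by rewrite msupp_path eqxx => /(_ isT).
Qed.

Theorem homogeneous_arrows : exists (d : arr Q -> G) (chi : family),
  [/\ forall a, hmg gr (d a) (chi a), kills chi
    & forall a, radp 2 (chi a - pia a)].
Proof.
have [d dP] := choice arrow_component.
have base : approximable d 1.
  exists (fun a => s2val (cid2 (dP a))), (fun a => pia a); split.
  - by move=> a; exact: (s2valP (cid2 (dP a))).
  - by move=> x y f f0; rewrite -(fmor_ev pi).
  - by move=> a; rewrite subrr; exact: radp0.
  - by move=> a; exact: (s2valP' (cid2 (dP a))).
(* The degrees [d] stay fixed during the iteration; past order [N] the approximation is an
   equality. *)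
have [u [chi [ud chi0 chi2 uchi]]] : approximable d N.+1.
  by elim: N => // m IH; exact: approximableS.
exists d, chi; split=> // a; suff -> : chi a = u a by [].
apply/esym/eqP; rewrite -subr_eq0; apply/eqP.
by apply: (radp_bound Q_bound) (uchi a); exact: leq_trans (leqnSn _) (leqnSn _).
Qed.

Section Unitriangular.
Variable chi : family.
Hypothesis chi_kills : kills chi.
Hypothesis chi2 : forall a, radp 2 (chi a - pia a).

(** [chi] differs from the identity by terms of higher order, so an element of its kernel lying in
    [rad^j] lies in [rad^(j+1)]. *)
Lemma ev_unitriangular_inj x y (f : phom k x y) : fmor (evA chi) f = 0 -> fmor pi f = 0.
Proof.
move=> f0;
  suff H j : radp j (fmor pi f) by exact: (radp_bound Q_bound (leqnn N) (H N)).
elim: j => [|j [g gj e]]; first by exists f.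
have g0 : fmor (evA chi) g = 0.
  have /chi_kills : fmor pi (f - g) = 0 by rewrite fmorB e subrr.
  by rewrite fmorB f0 sub0r => /eqP; rewrite oppr_eq0 => /eqP.
by have := radp_ev_sub chi2 gj; rewrite g0 sub0r e => /radpN; rewrite opprK.
Qed.

(** Descending induction on the order: [chi] maps a representative of [v] to [v] plus an error of
    higher order, which is already in the image. *)
Lemma ev_unitriangular_surj x y (v : khom (pi x) (pi y)) : exists f, fmor (evA chi) f = v.
Proof.
suff H n : forall j v, (N <= j + n)%N -> radp j v -> exists f : phom k x y, fmor (evA chi) f = v.
  by have [f fE] := pi_full v; apply: (H N 0%N) => //; exists f.
elim: n => [|n IH] j {}v; first by rewrite addn0 => Nj /(radp_bound Q_bound Nj) ->;
  exists 0; rewrite (fmor0 (evA chi)).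
rewrite addnS -addSn => Nj [g gj ->];
  have [f fE] := IH _ _ Nj (radp_ev_sub chi2 gj).
by exists (g - f); rewrite (fmorB (evA chi)) fE subKr.
Qed.

End Unitriangular.

End Homogenize.

(** * Lifting the universal cover *)

Section Kernel.
Variables (P G : groupType) (p : {multiplicative P -> G}).

Definition kernel : {pred P} := fun x => p x == 1%g.

Lemma kernelP x : reflect (p x = 1%g) (x \in kernel).
Proof. exact: eqP. Qed.

Lemma kernel1 : 1%g \in kernel.
Proof. by apply/kernelP; exact: group_morph1. Qed.

Lemma kernelM x y : x \in kernel -> y \in kernel -> (x * y)%g \in kernel.
Proof. by move=> /kernelP px /kernelP py; apply/kernelP;
  rewrite gmulfM px py mulg1. Qed.

Lemma kernelV x : x \in kernel -> x^-1%g \in kernel.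
Proof. by move=> /kernelP px; apply/kernelP; rewrite group_morphV px invg1. Qed.

HB.instance Definition _ := isMulClosed.Build P kernel kernelM.
HB.instance Definition _ := isMul1Closed.Build P kernel kernel1.
HB.instance Definition _ := isInvClosed.Build P kernel kernelV.

Definition kernel_subgroup : groupClosed P := kernel.

Lemma kernel_normal : normal_subgroup kernel_subgroup.
Proof.
move=> g n /kernelP pn; apply/kernelP.
by rewrite /conjg !gmulfM group_morphV pn mul1g mulVg.
Qed.

End Kernel.

(** * The grading given by a section of the covering, and the lift it permits *)

Section CoveringGrading.
Variables (k : fieldType) (C A : kcat k) (G : groupType).
Variables (r : {multiplicative G -> kaut C}) (F : kfun C A).
Hypothesis r_free : forall (g : G) (x : C), r g x = x -> g = 1%g.
Hypothesis F_act : forall g : G, kfun_comp F (r g) = F.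
Hypothesis F_trans : forall x x' : C, F x = F x' -> exists g, x' = r g x.
Hypothesis F_span : forall x y (f : khom x y), fspan F f.
Variable entries : forall x y : A, khom x y -> forall a b : C, khom a b.
Local Notation E := (@entries _ _).
Hypothesis E_linear : forall x y a b, linear (fun f : khom x y => E f a b).
Hypothesis E_fmor : forall a b (v : khom a b), E (fmor F v) a b = v.
Hypothesis E_out : forall a b (v : khom a b) b', b' <> b -> E (fmor F v) a b' = 0.
Variable s : A -> C.
Hypothesis sK : forall y, F (s y) = y.

Lemma entry0 x y a b : E (0 : khom x y) a b = 0.
Proof.
have := @E_linear x y a b (-1) 0 0.
by rewrite scaler0 addr0 scaleN1r addNr.
Qed.

Lemma entryD x y (f f' : khom x y) a b : E (f + f') a b = E f a b + E f' a b.
Proof. by have := @E_linear x y a b 1 f f'; rewrite !scale1r. Qed.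

Lemma entry_kto x y a b (v : khom a b) : F a = x -> F b = y ->
  E (kto x y (fmor F v)) a b = v.
Proof. by move=> ex ey; subst x y; rewrite kto_refl. Qed.

Lemma entry_out x y a b (v : khom a b) b' : F a = x -> F b = y -> b' <> b ->
  E (kto x y (fmor F v)) a b' = 0.
Proof. by move=> ex ey; subst x y; rewrite kto_refl; exact: E_out. Qed.

(** The translate of [v] that starts at [a'] ends at a proper translate of [b], by freeness, so the
    entry in column [b] vanishes. *)
Lemma entry_out_src x y a b (v : khom a b) a' : F a = x -> F b = y -> F a' = x ->
  a' <> a -> E (kto x y (fmor F v)) a' b = 0.
Proof.
move=> ex ey ea'; have [g ->] := F_trans (etrans ex (esym ea')) => ne.
have -> : kto x y (fmor F v) = kto x y (fmor F (fmor (r g) v)).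
  by rewrite (act_base_mor F_act) kto_trans ?(act_base F_act).
apply: entry_out; rewrite ?(act_base F_act) // => /esym /r_free g1.
by apply: ne; rewrite g1 act1_obj.
Qed.

Lemma entry_cast x x' y y' (f : khom x y) a a' b b' :
  x = x' -> y = y' -> a = a' -> b = b' ->
  E (kto x' y' f) a' b' = kto a' b' (E f a b).
Proof. by move=> ex ey ea eb; subst x' y' a' b'; rewrite !kto_refl. Qed.

Definition covering_hmg (g : G) (x y : A) (f : khom x y) :=
  exists v : khom (s x) (r g (s y)), f = kto x y (fmor F v).

Lemma covering_hmg0 g x y : covering_hmg g (0 : khom x y).
Proof. by exists 0; rewrite fmor0 linear0. Qed.

Lemma covering_hmg_lin g x y c (f f' : khom x y) :
  covering_hmg g f -> covering_hmg g f' -> covering_hmg g (c *: f + f').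
Proof.
by move=> [v ->] [v' ->]; exists (c *: v + v'); rewrite fmor_linear kto_linear.
Qed.

Definition covering_proj (g : G) (x y : A) (f : khom x y) : khom x y :=
  kto x y (fmor F (E f (s x) (r g (s y)))).

Lemma act_sK g y : F (r g (s y)) = y.
Proof. by rewrite (act_base F_act). Qed.

Definition covering_grading : kgrading A G.
Proof.
refine (@KGrading k A G covering_hmg covering_proj _ _ _ _ _ _ _ _).
- exact: covering_hmg0.
- exact: covering_hmg_lin.
- move=> x; exists (kto (s x) (r 1%g (s x)) (kid C (s x))).
  by rewrite fmor_kto ?act1_obj // kto_trans ?act1_obj // fmor_id kto_id.
(* The second lift is translated by [g], to start where the first one ends; this makes the degree
   [g * h]. *)
- move=> g h x y z _ _ [v ->] [w ->].
  exists (kcomp (kto (r g (s y)) (r (g * h)%g (s z)) (fmor (r g) w)) v).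
  rewrite fmor_comp (@kto_comp _ _ _ x _ y _ z) ?act_sK //; congr kcomp.
  rewrite fmor_kto ?actM_obj // kto_trans ?actM_obj // (act_base_mor F_act).
  by rewrite kto_trans ?(act_base F_act).
- by move=> g x y c f f'; rewrite /covering_proj E_linear fmor_linear kto_linear.
- by move=> g x y _ [v ->]; rewrite /covering_proj entry_kto ?act_sK.
- move=> g h x y _ [v ->] ne; rewrite /covering_proj entry_out ?act_sK //.
    by rewrite fmor0 linear0.
  by move=> /(act_inj r_free) /esym.
(* Each summand is translated to start at [s x]; its end is then a translate of [s y], whose group
   element is the degree. *)
- move=> x y P P0 PD PH f; elim: (F_span f) => // a b v {}f ea eb _ IH.
  apply: PD => //.
  have [h eh] : exists h, s x = r h a by apply: F_trans; rewrite sK.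
  have [g eg] : exists g, r h b = r g (s y).
    by apply: F_trans; rewrite sK (act_base F_act).
  apply: (PH g); exists (kto (s x) (r g (s y)) (fmor (r h) v)).
  rewrite fmor_kto // kto_trans -?eh -?eg ?sK ?(act_base F_act) //.
  by rewrite (act_base_mor F_act) kto_trans ?(act_base F_act).
Defined.

(* [B] stands for the universal cover and [Psi] for its covering functor followed
   by the automorphism psi of A. *)
Hypothesis C_connected : kconnected C.
Variables (B : kcat k) (P : groupType) (rho : {multiplicative P -> kaut B}).
Variables (Psi : kfun B A) (p : {multiplicative P -> G}) (deg : B -> G).
Hypothesis rho_free : forall (n : P) (x : B), rho n x = x -> n = 1%g.
Hypothesis Psi_act : forall n : P, kfun_comp Psi (rho n) = Psi.
Hypothesis Psi_trans : forall a b : B, Psi a = Psi b -> exists n, b = rho n a.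
Hypothesis Psi_indep : fibre_independent Psi.
Hypothesis Psi_span_from : forall (a : B) (y : A) (H : khom (Psi a) y -> Prop), H 0 ->
  (forall b (u : khom a b) f, Psi b = y -> H f ->
     H (kto (Psi a) y (fmor Psi u) + f)) -> forall f, H f.
Hypothesis Psi_span_to : forall (b : B) (x : A) (H : khom x (Psi b) -> Prop), H 0 ->
  (forall a (u : khom a b) f, Psi a = x -> H f ->
     H (kto x (Psi b) (fmor Psi u) + f)) -> forall f, H f.
Hypothesis deg_act : forall n a, deg (rho n a) = (p n * deg a)%g.
Hypothesis Psi_hmg : forall a b (u : khom a b),
  covering_hmg ((deg a)^-1 * deg b)%g (fmor Psi u).
Variable b0 : B.

Definition lift_obj (a : B) : C := r (deg a) (s (Psi a)).

Definition lift_mor (a b : B) (u : khom a b) : khom (lift_obj a) (lift_obj b) :=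
  E (fmor Psi u) (lift_obj a) (lift_obj b).

Lemma lift_objK a : F (lift_obj a) = Psi a.
Proof. exact: act_sK. Qed.

(** By homogeneity [fmor Psi u] lifts to a morphism [v] from [s (Psi a)]; the translate of [v] by
    [deg a] joins [lift_obj a] to [lift_obj b] and is the entry read by [lift_mor]. *)
Lemma lift_morK a b (u : khom a b) :
  kto (Psi a) (Psi b) (fmor F (lift_mor u)) = fmor Psi u.
Proof.
rewrite /lift_mor; have [v ->] := Psi_hmg u.
have e : r (deg a) (r ((deg a)^-1 * deg b)%g (s (Psi b))) = lift_obj b.
  by rewrite -actM_obj mulVKg.
have -> : kto (Psi a) (Psi b) (fmor F v) =
    kto (Psi a) (Psi b) (fmor F (kto (lift_obj a) (lift_obj b) (fmor (r (deg a)) v))).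
  rewrite fmor_kto // kto_trans ?e // ?(act_base F_act) ?sK // ?act_sK //.
  by rewrite (act_base_mor F_act) kto_trans ?(act_base F_act).
by rewrite entry_kto ?lift_objK.
Qed.

Lemma lift_morP a b (u : khom a b) (v : khom (lift_obj a) (lift_obj b)) :
  fmor Psi u = kto (Psi a) (Psi b) (fmor F v) -> lift_mor u = v.
Proof. by rewrite /lift_mor => ->; rewrite entry_kto ?lift_objK. Qed.

Definition lift_fun : kfun B C.
Proof.
refine (@KFun k B C lift_obj lift_mor _ _ _).
- by move=> a b c u v; rewrite /lift_mor fmor_linear E_linear.
- move=> a; apply: lift_morP; rewrite !fmor_id kto_id // lift_objK //.
- move=> a b c v u; apply: lift_morP.
  rewrite !fmor_comp -(lift_morK v) -(lift_morK u) -kto_comp ?lift_objK //.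
Defined.

Lemma lift_fun_comp : kfun_comp F lift_fun = Psi.
Proof. by apply: kfunP => [a|a b u]; [exact: lift_objK|exact: lift_morK]. Qed.

Lemma lift_fun_act n : p n = 1%g -> kfun_comp lift_fun (rho n) = lift_fun.
Proof.
move=> pn; have e a : lift_obj (rho n a) = lift_obj a.
  by rewrite /lift_obj deg_act pn mul1g (act_base Psi_act).
apply: kfunP => [a|a b u] /=; first exact: e.
rewrite /lift_mor (act_base_mor Psi_act).
rewrite (entry_cast _ _ _ (esym (e a)) (esym (e b))) ?(act_base Psi_act) //.
by rewrite kto_trans ?kto_refl.
Qed.

Lemma lift_trans a b : lift_fun a = lift_fun b -> exists2 n, p n = 1%g & b = rho n a.
Proof.
move=> e; have eP : Psi a = Psi b by rewrite -lift_objK [lift_obj a]e lift_objK.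
have [n en] := Psi_trans eP; exists n => //.
move: e; rewrite /= /lift_obj -eP en deg_act actM_obj => /esym; exact: r_free.
Qed.

(** Decompose the image of [v] in [A] by lifts to [B] starting at [a]; taking the entry in column
    [Y] keeps only the summands that end over [Y]. *)
Lemma lift_fspan_from a (Y : C) (v : khom (lift_obj a) Y) :
  @fspan k B C lift_fun (lift_obj a) Y v.
Proof.
rewrite -(@entry_kto (Psi a) (F Y) _ _ v) ?lift_objK //.
move: (kto _ _ _); apply: Psi_span_from; first by rewrite entry0; exact: fspan0.
move=> b u f eb IH; rewrite entryD.
have [e|ne] := pselect (lift_obj b = Y).
  rewrite (_ : E _ _ _ = kto (lift_obj a) Y (fmor lift_fun u)); first exact: fspanD.
  by subst Y;
    rewrite -(lift_morK u) kto_trans ?lift_objK // entry_kto ?lift_objK // kto_refl.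
rewrite -(lift_morK u) kto_trans ?lift_objK // entry_out ?lift_objK ?add0r //.
exact/nesym.
Qed.

Lemma lift_neq0_to b (Y : C) (v : khom Y (lift_obj b)) : v <> 0 ->
  exists a, lift_obj a = Y.
Proof.
rewrite -(@entry_kto (F Y) (Psi b) _ _ v) ?lift_objK //.
move: (kto _ _ _); apply: Psi_span_to; first by rewrite entry0.
move=> a u f ea IH; rewrite entryD.
have [e|ne] := pselect (lift_obj a = Y); first by exists a.
rewrite -(lift_morK u) kto_trans ?lift_objK // entry_out_src ?lift_objK ?add0r //.
exact/nesym.
Qed.

(** The objects in the image are closed under nonzero morphisms in both directions, and [C] is
    connected. *)
Lemma lift_surj Y : exists a, lift_fun a = Y.
Proof.
suff conn X Z : (exists a, lift_obj a = X) -> ~ (exists a, lift_obj a = Z) ->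
    (forall v : khom X Z, v = 0) /\ (forall v : khom Z X, v = 0).
  by have [|/(_ (lift_obj b0))[]] := C_connected conn; last by exists b0.
move=> [a <-] nZ; split=> v; apply: contrapT => nv; apply: nZ.
  by move: nv; elim: (lift_fspan_from v) => // c b u f _ eb _ _ _; exists b.
exact: lift_neq0_to nv.
Qed.

Lemma lift_fspan X Y (v : khom X Y) : fspan lift_fun v.
Proof. by have [a e] := lift_surj X; subst X; exact: lift_fspan_from. Qed.

(** Applying [F] turns a relation between the lifts into one for [Psi]. *)
Lemma lift_indep : fibre_independent lift_fun.
Proof.
move=> a Y l v ul lY v0; apply: (Psi_indep (y := F Y) ul).
  by move=> z zl; rewrite -lift_objK [lift_obj z]lY.
have := congr1 (fun w => kto (Psi a) (F Y) (fmor F w)) v0.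
rewrite fmor0 linear0 fmor_sum linear_sum /= => e;
  rewrite -[RHS]e big_seq [RHS]big_seq.
apply: eq_bigr => z /lY eY; subst Y.
by rewrite kto_refl -(lift_morK (v z)) kto_trans ?lift_objK.
Qed.

Lemma lift_galois : galois_covering (restr_act (kernel_subgroup p) rho) lift_fun.
Proof.
apply: galois_of_span.
- by move=> n; apply: lift_fun_act; exact/kernelP/(valP n).
- exact: lift_surj.
- move=> a b /lift_trans[n /kernelP pn ->].
  by exists (exist _ n pn : subgrp (kernel_subgroup p)).
- exact: lift_fspan.
- exact: lift_indep.
- by move=> n a /rho_free n1; apply: val_inj.
Qed.

Lemma lift_exact : short_exact (subgrp_incl (kernel_subgroup p)) p.
Proof.
split; first exact: val_inj.
- move=> n; split=> [/kernelP pn|[m <-]]; last exact/kernelP/(valP m).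
  by exists (exist _ n pn : subgrp (kernel_subgroup p)).
(* For surjectivity of [p], the translate by [g] of the lift of [b0] is the lift of some [b]; [b] is
   a translate of [b0] by some [n], and freeness gives [p n = g]. *)
- move=> g; have [b e] := lift_surj (r g (lift_obj b0)).
  have eP : Psi b0 = Psi b by rewrite -[RHS]lift_objK [lift_obj b]e (act_base F_act) lift_objK.
  have [n en] := Psi_trans eP; exists n.
  move: e; rewrite /= {1}/lift_obj -eP en deg_act actM_obj; exact: act_inj.
Qed.

End CoveringGrading.

(** * Monomial ideals contain the paths occurring in their elements *)

Section Monomial.
Variables (k : fieldType) (Q : quiver) (I0 : kideal (path_cat k Q)).

Definition path_support_mem (x y : vert Q) : {pred @khom k (path_cat k Q) x y} :=
  fun f => `[< forall p, p \in msupp (f : phom k x y) -> path_mor k p \in ideal_mem I0 x y >].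

Definition path_support_ideal : kideal (path_cat k Q).
Proof.
refine (@KIdeal k (path_cat k Q) path_support_mem _ _ _).
- move=> x y; split; first by apply/asboolP => p; rewrite msupp0 inE.
  move=> c f g /asboolP fI /asboolP gI; apply/asboolP => p.
  by move=> /msupp_lin/orP[/fI|/gI].
- move=> x y z g f /asboolP fI;
  apply/asboolP => r /msupp_phom_comp[q [p [_ /fI pI ->]]].
  by rewrite -path_mor_comp; exact: ideal_compl.
- move=> x y z g f /asboolP gI;
  apply/asboolP => r /msupp_phom_comp[q [p [/gI qI _ ->]]].
  by rewrite -path_mor_comp; exact: ideal_compr.
Defined.

(** The morphisms all of whose paths lie in [I0] form an ideal that contains the generating
    paths. *)
Lemma monomial_support : monomial I0 -> forall x y (f : phom k x y),
  f \in ideal_mem I0 x y -> forall p, p \in msupp f -> path_mor k p \in ideal_mem I0 x y.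
Proof.
move=> [P I0P] x y f; rewrite I0P => fI.
suff /asboolP : f \in ideal_mem path_support_ideal x y by [].
apply: (kideal_gen_min (J := path_support_ideal)) fI => x' y' _ [p Pp ->].
apply/asboolP => q; rewrite msupp_path => /eqP ->; rewrite I0P.
by apply: kideal_gen_sub; exists p.
Qed.

End Monomial.

(** * Automorphisms that fix the objects, and their composition with a covering *)

Section Twist.
Variables (k : fieldType) (A : kcat k) (t : forall x y : A, khom x y -> khom x y).
Hypothesis t_linear : forall x y, linear (@t x y).
Hypothesis t_id : forall x, t (kid A x) = kid A x.
Hypothesis t_comp : forall x y z (g : khom y z) (f : khom x y),
  t (kcomp g f) = kcomp (t g) (t f).
Hypothesis t_inj : forall x y (f : khom x y), t f = 0 -> f = 0.
Hypothesis t_surj : forall x y (g : khom x y), exists f, t f = g.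

Definition twist_fun : kfun A A := @KFun k A A (fun x => x) t t_linear t_id t_comp.

Definition untwist x y (g : khom x y) : khom x y := projT1 (boolp.cid (t_surj g)).

Lemma untwistK x y (g : khom x y) : t (untwist g) = g.
Proof. by rewrite /untwist; case: (boolp.cid _). Qed.

Lemma twistI x y : injective (@t x y).
Proof.
move=> f f' e; apply/eqP; rewrite -subr_eq0; apply/eqP/t_inj.
by have := fmorB twist_fun f f'; rewrite /= e subrr.
Qed.

Definition untwist_fun : kfun A A.
Proof.
refine (@KFun k A A (fun x => x) untwist _ _ _).
- by move=> x y c f g; apply: twistI; rewrite t_linear !untwistK.
- by move=> x; apply: twistI; rewrite t_id !untwistK.
- by move=> x y z g f; apply: twistI; rewrite t_comp !untwistK.
Defined.

Definition twist_aut : kaut A.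
Proof.
refine (@KAut k A twist_fun untwist_fun _ _).
- by apply: kfunP => // x y f; rewrite kto_refl; apply: twistI; exact: untwistK.
- by apply: kfunP => // x y f; rewrite kto_refl; exact: untwistK.
Defined.

Variables (B : kcat k) (Phi : kfun B A).

Lemma twist_act (P : groupType) (rho : {multiplicative P -> kaut B}) :
  (forall n, kfun_comp Phi (rho n) = Phi) ->
  forall n, kfun_comp (kfun_comp twist_fun Phi) (rho n) = kfun_comp twist_fun Phi.
Proof. by move=> H n; rewrite -kfun_compA H. Qed.

Lemma twist_indep : fibre_independent Phi -> fibre_independent (kfun_comp twist_fun Phi).
Proof.
move=> H a y l v ul ly v0; apply: (H a y) => //; apply: t_inj.
rewrite -[RHS]v0 -[t _]/(fmor twist_fun _) fmor_sum big_seq [RHS]big_seq;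
  apply: eq_bigr => z zl.
by rewrite fmor_kto //; exact: ly.
Qed.

Lemma twist_span_from (a : B) (y : A) :
  (forall (H : khom (Phi a) y -> Prop), H 0 ->
    (forall b (u : khom a b) f, Phi b = y -> H f ->
       H (kto (Phi a) y (fmor Phi u) + f)) -> forall f, H f) ->
  forall (H : khom (kfun_comp twist_fun Phi a) y -> Prop), H 0 ->
    (forall b (u : khom a b) f, kfun_comp twist_fun Phi b = y -> H f ->
       H (kto (kfun_comp twist_fun Phi a) y (fmor (kfun_comp twist_fun Phi) u) + f)) ->
    forall f, H f.
Proof.
move=> span H H0 HD f; rewrite -(untwistK f); move: (untwist f).
apply: span => [|b u {}f eb Hf]; first by rewrite -[t _]/(fmor twist_fun _) fmor0.
rewrite -[t _]/(fmor twist_fun _) fmorD fmor_kto //; exact: HD.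
Qed.

Lemma twist_span_to (b : B) (x : A) :
  (forall (H : khom x (Phi b) -> Prop), H 0 ->
    (forall a (u : khom a b) f, Phi a = x -> H f ->
       H (kto x (Phi b) (fmor Phi u) + f)) -> forall f, H f) ->
  forall (H : khom x (kfun_comp twist_fun Phi b) -> Prop), H 0 ->
    (forall a (u : khom a b) f, kfun_comp twist_fun Phi a = x -> H f ->
       H (kto x (kfun_comp twist_fun Phi b) (fmor (kfun_comp twist_fun Phi) u) + f)) ->
    forall f, H f.
Proof.
move=> span H H0 HD f; rewrite -(untwistK f); move: (untwist f).
apply: span => [|a u {}f ea Hf]; first by rewrite -[t _]/(fmor twist_fun _) fmor0.
rewrite -[t _]/(fmor twist_fun _) fmorD fmor_kto //; exact: HD.
Qed.

End Twist.

(** * The degree of a homotopy class of walks *)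

Section WalkDegree.
Variables (Q : quiver) (G : groupType) (d : arr Q -> G).

Definition wdeg_arr (b : arr (double_quiver Q)) : G :=
  match b with inl a => d a | inr a => (d a)^-1%g end.

Lemma wdeg_homotopic x y (v w : @walk Q x y) : homotopic v w ->
  pdeg wdeg_arr (val v) = pdeg wdeg_arr (val w).
Proof.
elim=> {x y v w} //= [x y u v w _ -> _ ->|x y z v v' w w' _ e _ e'|a|a] //.
- by rewrite !pdeg_cat e e'.
- by rewrite mulg1 mulVg.
- by rewrite mulg1 mulgV.
Qed.

Definition cdeg x y (c : @wclass Q x y) : G := pdeg wdeg_arr (val (wrep c)).

Lemma cdegE x y (w : @walk Q x y) : cdeg (wcls w) = pdeg wdeg_arr (val w).
Proof. by apply: wdeg_homotopic; apply/wclsP; exact: wrepK. Qed.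

Lemma cdeg_comp x y z (e : wclass y z) (c : @wclass Q x y) :
  cdeg (ccomp e c) = (cdeg c * cdeg e)%g.
Proof. by rewrite -[e]wrepK -[c]wrepK ccompE !cdegE /= pdeg_cat. Qed.

Lemma cdeg_id x : cdeg (@cid Q x) = 1%g.
Proof. exact: cdegE. Qed.

Lemma cdeg_inv x y (c : @wclass Q x y) : cdeg (cinv c) = (cdeg c)^-1%g.
Proof.
apply: (mulgI (cdeg c)); rewrite mulgV -cdeg_comp ccompVl; exact: cdeg_id.
Qed.

(* [cdeg] reverses products, as [ccomp e c] travels along [c] first;
  hence the inverse. *)
Definition pi1_deg (x0 : vert Q) (c : pi1 x0) : G := (cdeg c)^-1%g.

Lemma pi1_degM x0 : {morph @pi1_deg x0 : c e / (c * e)%g}.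
Proof. by move=> c e; rewrite /pi1_deg -invgM -cdeg_comp. Qed.

HB.instance Definition _ x0 :=
  monoid.isMultiplicative.Build (pi1 x0) G (@pi1_deg x0) (@pi1_degM x0).

End WalkDegree.

(** * Path lifting and the deck action on the cover of the quiver *)

Section PathLifting.
Variables (Q : quiver) (x0 : vert Q).
Notation CQ := (cover_quiver x0).

Definition cvert (y : vert Q) (c : wclass x0 y) : vert CQ :=
  Tagged (fun y => wclass x0 y) c.

Lemma cover_arr_inj (b b' : arr CQ) : src b = src b' -> tag b = tag b' -> b = b'.
Proof.
case: b b' => [a c] [a' c'] /= e ea; subst a'; congr existT.
by apply/eqP; have /eqP := e; rewrite eq_Tagged.
Qed.

(** Uniqueness of lifts: an arrow of the cover is determined by its source and its image. *)
Lemma cover_path_inj (v w w' : vert CQ) t t' :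
  is_path v t w -> is_path v t' w' ->
  map (fun b : arr CQ => tag b) t = map (fun b : arr CQ => tag b) t' -> t = t' /\ w = w'.
Proof.
elim: t t' v => [|b t IH] [|b' t'] v //=; first by move=> /eqP <- /eqP <-.
move=> /andP[/eqP ev pt] /andP[/eqP ev' pt'] [eb et].
have e := cover_arr_inj (etrans ev (esym ev')) eb; subst b'.
by have [-> ->] := IH _ _ pt pt' et.
Qed.

Lemma cover_lift_from x y (p : @qpath Q x y) (c : wclass x0 x) :
  exists (c' : wclass x0 y) (t : @qpath CQ (cvert c) (cvert c')),
    path_map (cover_map x0) t = p.
Proof.
elim/qpath_ind: p c => {x y} [x|a y p IH] c.
  by exists c, (pid (cvert c)); apply: val_inj.
have [c' [t tp]] := IH (ccomp (wcls (warr a)) c).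
pose b : arr CQ := Tagged (fun a => wclass x0 (src a)) c.
exists c', (@pcomp CQ (src b) (tgt b) (cvert c') t (parr b)); apply: val_inj => /=.
by congr cons; exact: (congr1 val tp).
Qed.

Lemma cover_lift_to x y (p : @qpath Q x y) (c' : wclass x0 y) :
  exists (c : wclass x0 x) (t : @qpath CQ (cvert c) (cvert c')),
    path_map (cover_map x0) t = p.
Proof.
elim/qpath_ind: p c' => {x y} [x|a y p IH] c'.
  by exists c', (pid (cvert c')); apply: val_inj.
have [c1 [t tp]] := IH c'.
pose c := ccomp (cinv (wcls (warr a))) c1.
have e : ccomp (wcls (warr a)) c = c1 by rewrite ccompA ccompVr ccomp1l.
exists c; move: t tp; rewrite -e => t tp.
pose b : arr CQ := Tagged (fun a => wclass x0 (src a)) c.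
exists (@pcomp CQ (src b) (tgt b) (cvert c') t (parr b)); apply: val_inj => /=.
by congr cons; exact: (congr1 val tp).
Qed.

Variables (G : groupType) (d : arr Q -> G).

Definition cover_deg (v : cover_vert x0) : G := cdeg d (tagged v).

(** Crossing a lifted arrow multiplies the degree of the class by that of the arrow. This is the
    degree needed to lift the covering functor to [C]. *)
Lemma cover_path_deg (v w : vert CQ) (t : @qpath CQ v w) :
  pdeg d (val (path_map (cover_map x0) t)) = ((cover_deg v)^-1 * cover_deg w)%g.
Proof.
elim/qpath_ind: t => {v w} [v|b w t IH] /=; first by rewrite mulVg.
rewrite [pdeg d _]IH {1}/cover_deg /= cdeg_comp cdegE /= mulg1 invgM !mulgA.
by rewrite mulgV mul1g.
Qed.

Lemma cover_deg_act (n : pi1 x0) v :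
  cover_deg (vmap (cover_act n) v) = (pi1_deg d n * cover_deg v)%g.
Proof. by rewrite /cover_deg /= cdeg_comp cdeg_inv. Qed.

Lemma cover_act_free (n : pi1 x0) v : vmap (cover_act n) v = v -> n = 1%g.
Proof.
case: v => y c /= /eqP; rewrite eq_Tagged => /eqP /= e.
have : cinv n = cid x0.
  by rewrite -[cinv n]ccomp1l -(ccompVl c) -ccompA e ccompVl.
move=> e1; rewrite -[n](@invgK (pi1 x0)); apply: etrans (@invg1 (pi1 x0)).
by congr (_^-1)%g.
Qed.

Lemma cover_act_trans (v w : cover_vert x0) : tag v = tag w ->
  exists n, w = vmap (cover_act n) v.
Proof.
case: v w => [y c] [y' c'] /= e; subst y'.
(* The action is by inverses on the right, so [n] has to satisfy [c n^-1 = c']. *)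
exists ((ccomp (cinv c) c' : pi1 x0)^-1)%g; congr existT.
have -> : cinv ((ccomp (cinv c) c' : pi1 x0)^-1)%g = ccomp (cinv c) c'.
  exact: (@invgK (pi1 x0)).
by rewrite ccompA ccompVr ccomp1l.
Qed.

End PathLifting.

(** * The covering functor: spanning and independence *)

Section CoverFunctor.
Variables (k : fieldType) (Q : quiver) (x0 : vert Q) (I0 : kideal (path_cat k Q)).
Notation CQ := (cover_quiver x0).
Notation B := (cover_cat x0 I0).
Notation A := (kquot I0).
Notation Phi := (cover_fun x0 I0).
Notation pi := (kquot_pi I0).
Notation cpi := (kquot_pi (cover_ideal x0 I0) : kfun (path_cat k CQ) B).

Lemma cover_fun_cpi v w (f : @phom k CQ v w) :
  fmor Phi (fmor cpi f) = fmor pi (path_fmor (cover_map x0) f).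
Proof. exact: (kquot_fmorE (@cover_map_ideal Q x0 k I0)). Qed.

Lemma cover_fun_path v w (t : @qpath CQ v w) :
  fmor Phi (fmor cpi (path_mor k t)) = fmor pi (path_mor k (path_map (cover_map x0) t)).
Proof. by rewrite cover_fun_cpi [path_fmor _ _]path_fmorU. Qed.

Lemma cover_fun_act (n : pi1 x0) : kfun_comp Phi (cover_act_aut x0 I0 n) = Phi.
Proof.
have E : kfun_comp (path_fun k (cover_map x0)) (path_fun k (cover_act n)) =
    path_fun k (cover_map x0) by rewrite -path_fun_comp cover_map_act.
rewrite [LHS]kquot_fun_comp => [x y f fI|H]; last exact: kquot_fun_eq.
by rewrite E; exact: cover_map_ideal.
Qed.

Lemma cover_span_from (v : B) (y : A) (H : khom (Phi v) y -> Prop) : H 0 ->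
  (forall w (u : khom v w) f, Phi w = y -> H f -> H (kto (Phi v) y (fmor Phi u) + f)) ->
  forall f, H f.
Proof.
move=> H0 HD f; have [h ->] := kquot_pi_surj f.
rewrite fmor_phom; elim/big_rec: _ => // p e _ He.
case: v H H0 HD f h p e He => x c H H0 HD f h p e He.
have [c' [t tp]] := cover_lift_from p c.
have := HD (cvert c') (h@_p *: fmor cpi (path_mor k t)) e erefl He.
by rewrite kto_refl fmorZ cover_fun_path tp.
Qed.

Lemma cover_span_to (w : B) (x : A) (H : khom x (Phi w) -> Prop) : H 0 ->
  (forall v (u : khom v w) f, Phi v = x -> H f -> H (kto x (Phi w) (fmor Phi u) + f)) ->
  forall f, H f.
Proof.
move=> H0 HD f; have [h ->] := kquot_pi_surj f.
rewrite fmor_phom; elim/big_rec: _ => // p e _ He.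
case: w H H0 HD f h p e He => y c' H H0 HD f h p e He.
have [c [t tp]] := cover_lift_to p c'.
have := HD (cvert c) (h@_p *: fmor cpi (path_mor k t)) e erefl He.
by rewrite kto_refl fmorZ cover_fun_path tp.
Qed.

Lemma cover_mor_ind v w (H : @khom k B v w -> Prop) :
  H 0 -> (forall c t f, H f -> H (c *: fmor cpi (path_mor k t) + f)) -> forall u, H u.
Proof.
move=> H0 HD u; have [h ->] := kquot_pi_surj u.
rewrite fmor_phom; elim/big_rec: _ => // t e _ He; exact: HD.
Qed.

Hypothesis I0_monomial : monomial I0.

Lemma cover_map_injective v w : injective (@path_map _ _ (cover_map x0) v w : @qpath CQ v w -> _).
Proof.
move=> t t' /(congr1 val) /= e; apply: val_inj.
by have [] := cover_path_inj (valP t) (valP t') e.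
Qed.

Lemma mcoeff_path_fmor v w (f : @phom k CQ v w) (t : @qpath CQ v w) :
  (path_fmor (cover_map x0) f)@_(path_map (cover_map x0) t) = f@_t.
Proof. exact: (mcoeff_malg_lin_inj f t (@cover_map_injective v w)). Qed.

Lemma mcoeff_path_fmor_out v w w' (f : @phom k CQ v w') (t : @qpath CQ v w) :
  w' <> w ->
  (@kto k (path_cat k Q) (tag v) (tag w) _ _ (path_fmor (cover_map x0) f)
    : phom k (tag v) (tag w))@_(path_map (cover_map x0) t) = 0.
Proof.
move=> ne; have [e|ne'] := pselect (tag w' = tag w); last first.
  by rewrite (@kto_tgt _ (path_cat k Q)) ?mcoeff0.
case: w' w e f t ne => [y' c'] [y c] /= e; subst y' => f t ne.
rewrite kto_refl; apply: mcoeff_outdom; apply/negP => /msupp_malg_lin[t' _].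
rewrite msupp_path => /eqP /(congr1 val) /= et; apply: ne.
by have [_ ->] := cover_path_inj (valP t) (valP t') et.
Qed.

(** Represent the relation in [kQ]: the sum of the images lies in [I0]. By unique lifting, the image
    of a path [t] of [f z0] gets no contribution from other [z], so it occurs in the sum.
    Monomiality puts it in [I0], so [t] is a generator of the ideal of the cover. *)
Lemma cover_indep : fibre_independent Phi.
Proof.
move=> v y l u ul ly u0 z0 z0l.
pose f z : @phom k CQ v z := qrepr (u z : qhom (cover_ideal x0 I0) v z).
have uf z : u z = fmor cpi (f z) by rewrite /= qreprK.
have ey := ly _ z0l; subst y.
pose g (z : B) : @khom k (path_cat k Q) (tag (v : cover_vert x0)) (tag (z0 : cover_vert x0)) :=
  @kto k (path_cat k Q) _ _ _ _ (path_fmor (cover_map x0) (f z)).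
have g0 : fmor pi (\sum_(z <- l) g z) = 0.
  rewrite fmor_sum -[RHS]u0 big_seq [RHS]big_seq; apply: eq_bigr => z /ly ez.
  by rewrite /g fmor_kto // uf cover_fun_cpi.
rewrite uf; apply/kquot_pi_eq0.
rewrite (phom_sum (f z0)) big_seq; apply: rpred_sum => t tf; apply: rpredZ.
apply: kideal_gen_sub; exists t => //.
move/kquot_pi_eq0: g0 => /(monomial_support I0_monomial); apply.
rewrite -mcoeff_neq0 mcoeff_sum (@mx_sum1 _ _ _ _ _ z0) //.
- by rewrite /g kto_refl mcoeff_path_fmor mcoeff_neq0.
- by move=> z /(mcoeff_path_fmor_out (f z) t).
Qed.

End CoverFunctor.

(** * The endomorphism of [A] defined by new values of the arrows *)

Section Presentation.
Variables (k : fieldType) (Q : quiver) (I0 : kideal (path_cat k Q)).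
Notation A := (kquot I0).
Notation pi := (kquot_pi I0).
Variable chi : forall a : arr Q, khom (pi (src a)) (pi (tgt a)).
Hypothesis chi_kills : kills chi.

Lemma chi_kills_ideal (x y : path_cat k Q) (f : khom x y) :
  f \in ideal_mem I0 x y -> fmor (ev pi chi) f = 0.
Proof. by move=> /kquot_pi_eq0; exact: chi_kills. Qed.

Definition pres_fun : kfun A A := kquot_lift chi_kills_ideal.

Definition pres_mor (x y : A) (f : khom x y) : khom x y := fmor pres_fun f.

Lemma pres_morE (x y : vert Q) (f : phom k x y) :
  pres_mor (fmor pi f) = fmor (ev pi chi) f.
Proof. exact: (kquot_lift_pi chi_kills_ideal f). Qed.

Lemma pres_mor_linear (x y : A) : linear (@pres_mor x y).
Proof. exact: (fmor_linear pres_fun). Qed.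

Lemma pres_mor_id (x : A) : pres_mor (kid A x) = kid A x.
Proof. exact: (fmor_id pres_fun). Qed.

Lemma pres_mor_comp (x y z : A) (v : khom y z) (u : khom x y) :
  pres_mor (kcomp v u) = kcomp (pres_mor v) (pres_mor u).
Proof. exact: (fmor_comp pres_fun). Qed.

End Presentation.

Theorem theorem1 (k : closedFieldType) (Q : quiver) (x0 : vert Q)
    (I0 : kideal (path_cat k Q))
    (Q_finite : finite_quiver Q)
    (Q_connected : qconnected Q)
    (Q_acyclic : no_oriented_cycle Q)
    (Q_simple : no_multiple_arrows Q)
    (I0_admissible : admissible I0)
    (I0_monomial : monomial I0) :
  forall (G : groupType) (C : kcat k) (r : {multiplicative G -> kaut C})
    (F : kfun C (kquot I0)),
    kconnected C -> locally_bounded C -> galois_covering r F ->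
    exists (psi : kaut (kquot I0)) (N : groupClosed (pi1 x0))
      (F' : kfun (cover_cat x0 I0) C),
      [/\ forall x : kquot I0, psi x = x,
          normal_subgroup N,
          galois_covering (restr_act N (cover_act_aut x0 I0)) F',
          kfun_comp F F' = kfun_comp psi (cover_fun x0 I0)
        & exists p : {multiplicative pi1 x0 -> G},
            short_exact (subgrp_incl N) p].
Proof.
move=> G C r F C_conn [C_fin _ _] galF.
have C_findim x := (C_fin x).1.
have [r_free F_act univ] := galF.
have F_trans := galois_trans C_findim galF.
have F_span := galois_span F_act F_trans univ.
(* One object in each fibre; this choice defines the grading [gr]. *)
have [s sK] := choice (galois_surj F_act F_trans univ).
have [E [E_lin E_fmor E_out]] := galois_entries C_findim galF.
pose gr := covering_grading r_free F_act F_trans F_span E_lin E_fmor E_out sK.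
pose pi := kquot_pi I0.
have pi_full (x y : vert Q) (u : khom (pi x) (pi y)) : exists f : phom k x y, u = fmor pi f.
  exact: (@kquot_pi_surj k (path_cat k Q) I0 x y u).
have pi_paths (x y : vert Q) (f : phom k x y) : fmor pi f = 0 ->
    forall p, p \in msupp f -> fmor pi (path_mor k p) = 0.
  move=> /kquot_pi_eq0 fI p pf; apply/kquot_pi_eq0.
  exact: (monomial_support I0_monomial fI).
have pi_long (x y : vert Q) (f : phom k x y) : fmor pi f = 0 ->
    forall p, p \in msupp f -> (2 <= plen p)%N.
  by move=> /kquot_pi_eq0; exact: I0_admissible.1.
have [N Q_bound] := acyclic_bound Q_acyclic Q_finite.2.
have [d [chi [chi_hmg chi_kills chi2]]] :=
  homogeneous_arrows pi_full pi_paths pi_long Q_acyclic Q_bound gr Q_simple.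
pose t := @pres_mor k Q I0 chi chi_kills.
have tE (x y : vert Q) (f : phom k x y) : t x y (fmor pi f) = fmor (ev pi chi) f.
  exact: pres_morE.
have t_inj (x y : kquot I0) (f : khom x y) : t x y f = 0 -> f = 0.
  have [g ->] := kquot_pi_surj f; rewrite tE //.
  exact: (ev_unitriangular_inj Q_bound chi_kills chi2).
have t_surj (x y : kquot I0) (g : khom x y) : exists f, t x y f = g.
  have [f <-] :=
    ev_unitriangular_surj pi_full Q_bound chi2 (g : khom (pi x) (pi y)).
  by exists (fmor pi f); rewrite tE.
pose t_lin := pres_mor_linear chi_kills.
pose t_id := pres_mor_id chi_kills.
pose t_comp := pres_mor_comp chi_kills.
pose psi := twist_aut t_lin t_id t_comp t_inj t_surj.
pose p : {multiplicative pi1 x0 -> G} := @pi1_deg Q G d x0.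
pose deg (v : cover_cat x0 I0) : G := cover_deg d (v : cover_vert x0).
pose Psi := kfun_comp psi (cover_fun x0 I0).
(* On a path of the cover, [Psi] is the product of the homogeneous values [chi] along the image
   path, whose degree is given by [cover_path_deg]. *)
have Psi_hmg (v w : cover_cat x0 I0) (u : khom v w) :
    covering_hmg r F s ((deg v)^-1 * deg w)%g (fmor Psi u).
  move: u; apply: cover_mor_ind => [|c q f IH]; first by rewrite (fmor0 Psi);
    exact: covering_hmg0.
  have qh : covering_hmg r F s ((deg v)^-1 * deg w)%g
      (fmor Psi (fmor (kquot_pi (cover_ideal x0 I0)) (path_mor k q))).
    have -> : fmor Psi (fmor (kquot_pi (cover_ideal x0 I0)) (path_mor k q)) =
        fmor (ev pi chi) (path_mor k (path_map (cover_map x0) q)).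
      apply: etrans (tE _ _ (path_mor k (path_map (cover_map x0) q))).
      exact: (congr1 (t _ _) (cover_fun_path I0 q)).
    have := hmg_ev (path_map (cover_map x0) q) chi_hmg.
    by rewrite (cover_path_deg d q).
  rewrite (fmor_linear Psi); exact: covering_hmg_lin qh IH.
have Psi_act := twist_act t_lin t_id t_comp (@cover_fun_act k Q x0 I0).
have Psi_trans (v w : cover_cat x0 I0) : Psi v = Psi w ->
    exists n, w = cover_act_aut x0 I0 n v.
  exact: cover_act_trans.
have Psi_from (v : cover_cat x0 I0) (y : kquot I0) := twist_span_from (t_linear :=
  t_lin) (t_id := t_id) (t_comp := t_comp) t_surj
  (@cover_span_from k Q x0 I0 v y).
have Psi_to (w : cover_cat x0 I0) (y : kquot I0) := twist_span_to (t_linear :=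
  t_lin) (t_id := t_id) (t_comp := t_comp) t_surj
  (@cover_span_to k Q x0 I0 w y).
have deg_act n (v : cover_cat x0 I0) : deg (cover_act_aut x0 I0 n v) = (p n * deg v)%g.
  exact: cover_deg_act.
exists psi, (kernel_subgroup p), (lift_fun F_act E_lin E_fmor sK Psi_hmg); split.
- by [].
- exact: kernel_normal.
- apply: (lift_galois r_free F_act F_trans E_lin E_fmor E_out sK C_conn) => //.
  + by move=> n v; exact: cover_act_free.
  + exact: (twist_indep t_inj (cover_indep I0_monomial)).
  + exact: (cvert (cid x0)).
- exact: lift_fun_comp.
- exists p; apply: (lift_exact r_free F_act F_trans E_lin E_fmor E_out sK C_conn
    Psi_trans Psi_from Psi_to deg_act Psi_hmg).
  exact: (cvert (cid x0)).
Qed.
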